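(* Let $1<p\le q\le\frac{np}{n-p}<\infty$, and let $E\subset\mathbb{R}^n$ be a nonempty closed set for which there is a constant $C_1=C_1(n,p,q,E)$ such that $$\frac{1}{|R|}\int_{R}d(x,E)^{-n+\frac qp(n-p)}\,dx\le C_1\,r^{-n+\frac qp(n-p)}$$ for every cube $R=Q(x_R,r)$ with midpoint $x_R\in E$ and $r>0$. Let $Q\subset\mathbb{R}^n$ be a cube and $u\in\mathrm{Lip}(Q)$. Then there exists a constant $C=C(n,p,q,C_1)$ such that $$\left(\int_Q|u(x)-u_Q|^q\,d(x,E)^{-n+\frac qp(n-p)}\,dx\right)^{1/q}\le C\left(\int_Q|\nabla u(x)|^p\,dx\right)^{1/p}.$$
   Context: A cube in $\mathbb{R}^n$ is a half-open set $[a_1,b_1)\times\cdots\times[a_n,b_n)$ with equal side lengths; $Q(x,r)$ is the cube with midpoint $x$ and side length $2r$. $d(x,E)$ is the distance from $x$ to $E$. $u_Q=\frac1{|Q|}\int_Qu(x)\,dx$. $\mathrm{Lip}(Q)$ is the set of Lipschitz continuous real-valued functions on $Q$; $\nabla u$ is defined almost everywhere. The notation $1<p\le q\le\frac{np}{n-p}<\infty$ entails $1<p<n$. The constant $C$ depends only on the listed parameters (not on $Q$ or $u$). *)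

(* Defs.v *)
From HB Require Import structures.
From mathcomp Require Import all_boot all_order all_algebra.
From mathcomp Require Import all_classical all_reals all_analysis.
Import Order.TTheory GRing.Theory Num.Theory.
Import numFieldNormedType.Exports.

Set Implicit Arguments.
Unset Strict Implicit.
Unset Printing Implicit Defensive.

Local Open Scope classical_set_scope.
Local Open Scope ring_scope.

(* The sigma-algebra on 'rV[T]_n generated by the coordinate projections (the
   library only has it for n.-tuple T); for T = R it is the Borel one. *)
Definition measure_rV_display : measure_display -> measure_display.
Proof. exact. Qed.

Section measurable_rV.
Context {d} {T : measurableType d}.
Variable n : nat.

Let coors : 'I_n -> 'rV[T]_n -> T := fun i x => x ord0 i.

Let rV_set0 : g_sigma_preimage coors set0.
Proof. exact: sigma_algebra0. Qed.

Let rV_setC A : g_sigma_preimage coors A -> g_sigma_preimage coors (~` A).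
Proof. exact: sigma_algebraC. Qed.

Let rV_bigcup (F : _^nat) : (forall i, g_sigma_preimage coors (F i)) ->
  g_sigma_preimage coors (\bigcup_i (F i)).
Proof. exact: sigma_algebra_bigcup. Qed.

HB.instance Definition _ := @isMeasurable.Build (measure_rV_display d)
  'rV[T]_n (g_sigma_preimage coors) rV_set0 rV_setC rV_bigcup.

Lemma measurable_coord (i : 'I_n) :
  measurable_fun [set: 'rV[T]_n] (fun x : 'rV[T]_n => x ord0 i).
Proof.
move=> _ Y mY; rewrite setTI; apply: sub_sigma_algebra => /=.
rewrite -bigcup_seq/=; exists i => /=; first by rewrite mem_index_enum.
by exists Y => //; rewrite setTI.
Qed.

Lemma measurable_fun_rV d' (T' : measurableType d') (f : T' -> 'rV[T]_n) :
  (forall i, measurable_fun setT (fun x => f x ord0 i)) -> measurable_fun setT f.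
Proof.
move=> mf; suff H : (@measurable _ 'rV[T]_n) `<=`
    [set A | measurable (f @^-1` A)].
  by move=> _ A /H; rewrite setTI.
apply: smallest_sub.
  split => /=.
  - by rewrite preimage_set0.
  - by move=> A; rewrite setTD => mA; rewrite preimage_setC; exact: measurableC.
  - by move=> F mF; rewrite preimage_bigcup; exact: bigcupT_measurable.
rewrite -bigcup_seq => _ [i _ [A mA <-]] /=; rewrite setTI -comp_preimage.
by have := mf i measurableT A mA; rewrite setTI.
Qed.

End measurable_rV.

Section box.
Context {R : realType} {n : nat}.
Implicit Types (a b : 'rV[R]_n) (Q : set 'rV[R]_n).

Definition box a b : set 'rV[R]_n :=
  [set x | forall i, a ord0 i <= x ord0 i < b ord0 i].

Definition is_cube Q := exists a b,
  [/\ forall i, a ord0 i < b ord0 i,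
      forall i j, b ord0 i - a ord0 i = b ord0 j - a ord0 j & Q = box a b].

Definition cube (x : 'rV[R]_n) (r : R) := box (x - const_mx r) (x + const_mx r).

Lemma measurable_box a b : measurable (box a b).
Proof.
rewrite (_ : box a b = \big[setI/setT]_(i < n)
    [set x : 'rV[R]_n | x ord0 i \in `[a ord0 i, b ord0 i[ ]).
  apply: bigsetI_measurable => i _.
  have := @measurable_coord _ R n i measurableT `[a ord0 i, b ord0 i[%classic
    (measurable_itv _).
  by rewrite setTI.
rewrite -bigcap_seq; apply/seteqP; split => x /= xab i.
  by move=> _; rewrite /= in_itv/=.
by have := xab i; rewrite /= in_itv/= mem_index_enum; apply.
Qed.

End box.

Definition cons_rV (R : realType) n (p : R * 'rV[R]_n) : 'rV[R]_n.+1 :=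
  row_mx p.1%:M p.2 : 'rV[R]_(1 + n).

(* n-dimensional Lebesgue measure (on Borel sets), as the product of n copies
   of the one-dimensional one *)
Fixpoint lebesgue_rV (R : realType) (n : nat) : set 'rV[R]_n -> \bar R :=
  match n with
  | 0 => dirac (0 : 'rV[R]_0)
  | m.+1 => pushforward (lebesgue_measure \x @lebesgue_rV R m)%E (@cons_rV R m)
  end.

Lemma sigma_finite_measure_of d (T : measurableType d) (R : realType)
    (mu : set T -> \bar R) :
  mu set0 = 0%E -> (forall A, (0 <= mu A)%E) -> semi_sigma_additive mu ->
  sigma_finite setT mu ->
  exists m : {sigma_finite_measure set T -> \bar R}, mu = m.
Proof.
move=> mu0 mu_ge0 mu_add mu_fin.
pose B := isMeasure.Build _ _ _ mu mu0 mu_ge0 mu_add.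
pose M : measure T R := HB.pack mu B.
pose S := Measure_isSigmaFinite.Build _ _ _ M mu_fin.
pose nu : sigma_finite_measure T R := HB.pack mu B S.
by exists nu.
Qed.

Section lebesgue_rV.
Context {R : realType}.
Local Notation leb n := (@lebesgue_rV R n).

Lemma cons_rV0 n (p : R * 'rV[R]_n) : cons_rV p ord0 ord0 = p.1.
Proof.
transitivity (row_mx (p.1%:M : 'M[R]_1) p.2 ord0 (lshift n ord0)).
  by congr (row_mx _ _ _ _); exact: val_inj.
by rewrite row_mxEl mxE eqxx.
Qed.

Lemma cons_rVS n (p : R * 'rV[R]_n) i :
  cons_rV p ord0 (lift ord0 i) = p.2 ord0 i.
Proof.
transitivity (row_mx (p.1%:M : 'M[R]_1) p.2 ord0 (rshift 1 i)).
  by congr (row_mx _ _ _ _); exact: val_inj.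
by rewrite row_mxEr.
Qed.

Lemma measurable_cons_rV n : measurable_fun setT (@cons_rV R n).
Proof.
apply: measurable_fun_rV => i; case: (unliftP ord0 i) => [j|] ->.
- rewrite (_ : (fun x => _) = (fun y : 'rV[R]_n => y ord0 j) \o snd); last first.
    by apply/funext => x /=; rewrite cons_rVS.
  by apply: measurableT_comp => //; exact: measurable_coord.
- by rewrite (_ : (fun x => _) = fst)//; apply/funext => x; rewrite cons_rV0.
Qed.

Lemma preimage_cons_rV_box n (a b : 'rV[R]_n.+1) :
  @cons_rV R n @^-1` box a b =
  `[a ord0 ord0, b ord0 ord0[%classic `*`
    box (\row_i a ord0 (lift ord0 i)) (\row_i b ord0 (lift ord0 i)).
Proof.
apply/seteqP; split => p /=.
  move=> pab; split; first by have := pab ord0; rewrite cons_rV0 in_itv.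
  by move=> i; have := pab (lift ord0 i); rewrite cons_rVS !mxE.
move=> [p1 p2] i; case: (unliftP ord0 i) => [j|] ->.
  by have := p2 j; rewrite cons_rVS !mxE.
by rewrite cons_rV0; move: p1; rewrite in_itv.
Qed.

Let boxes n k := box (const_mx (- k%:R) : 'rV[R]_n) (const_mx k%:R).

Let boxes_setT n : \bigcup_k @boxes n k = setT.
Proof.
apply/seteqP; split => // x _.
pose M := \sum_i `|x ord0 i|.
have M0 : 0 <= M by apply: sumr_ge0.
exists (Num.truncn M).+1 => // i; rewrite !mxE.
have xM : `|x ord0 i| < (Num.truncn M).+1%:R.
  apply: le_lt_trans (truncnS_gt _).
  by rewrite /M (bigD1 i)//= lerDl sumr_ge0.
by move: xM; rewrite ltr_norml => /andP[/ltW -> ->].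
Qed.

Let lebesgue_rV_ind n :
  (exists mu : {sigma_finite_measure set 'rV[R]_n -> \bar R}, leb n = mu) /\
  (forall a b : 'rV[R]_n, (forall i, a ord0 i <= b ord0 i) ->
    leb n (box a b) = (\prod_i (b ord0 i - a ord0 i))%:E).
Proof.
elim: n => [|n [[mu muE] ih]].
  split; first by exists (dirac (0 : 'rV[R]_0)).
  by move=> a b _; rewrite big_ord0 /= diracE mem_set// => -[].
have box_leb (a b : 'rV[R]_n.+1) : (forall i, a ord0 i <= b ord0 i) ->
    leb n.+1 (box a b) = (\prod_i (b ord0 i - a ord0 i))%:E.
  move=> ab; rewrite /= /pushforward muE preimage_cons_rV_box.
  rewrite product_measure1E; [|exact: measurable_itv|exact: measurable_box].
  rewrite -muE ih; last by move=> i; rewrite !mxE.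
  rewrite big_ord_recl EFinM; congr (_ * _)%E.
    rewrite [LHS](@lebesgue_measure_itv R `[_, _[)/= lte_fin; case: ltP => // ba.
    by rewrite (@le_anti _ _ (a ord0 ord0) (b ord0 ord0)) ?subrr ?ab.
  by congr EFin; apply: eq_bigr => i _; rewrite !mxE.
split => //.
have muS : leb n.+1 = pushforward (lebesgue_measure \x mu)%E (@cons_rV R n).
  by rewrite /= muE.
have mcons := @measurable_cons_rV n.
have m0 : leb n.+1 set0 = 0%E by rewrite muS /pushforward preimage_set0 measure0.
have m_ge0 A : (0 <= leb n.+1 A)%E by rewrite muS; exact: measure_ge0.
have m_add : semi_sigma_additive (leb n.+1).
  by rewrite muS; exact: (@measure_semi_sigma_additive).
have m_fin : sigma_finite setT (leb n.+1).
  exists (@boxes n.+1); first by rewrite boxes_setT.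
  move=> k; split; first exact: measurable_box.
  by rewrite box_leb ?ltry// => i; rewrite !mxE ge0_cp.
exact: sigma_finite_measure_of.
Qed.

Lemma lebesgue_rV_box n (a b : 'rV[R]_n) : (forall i, a ord0 i <= b ord0 i) ->
  leb n (box a b) = (\prod_i (b ord0 i - a ord0 i))%:E.
Proof. by have [_] := lebesgue_rV_ind n; apply. Qed.

Let lebesgue_rV0 n : leb n set0 = 0%E.
Proof. by have [[mu ->] _] := lebesgue_rV_ind n; rewrite measure0. Qed.

Let lebesgue_rV_ge0 n A : (0 <= leb n A)%E.
Proof. by have [[mu ->] _] := lebesgue_rV_ind n; exact: measure_ge0. Qed.

Let lebesgue_rV_semi_sigma_additive n : semi_sigma_additive (leb n).
Proof.
by have [[mu ->] _] := lebesgue_rV_ind n; exact: measure_semi_sigma_additive.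
Qed.

HB.instance Definition _ n := isMeasure.Build _ _ _ (leb n)
  (lebesgue_rV0 n) (@lebesgue_rV_ge0 n) (@lebesgue_rV_semi_sigma_additive n).

Let lebesgue_rV_sigma_finite n : sigma_finite setT (leb n).
Proof. by have [[mu ->] _] := lebesgue_rV_ind n; exact: sigma_finiteT. Qed.

HB.instance Definition _ n := Measure_isSigmaFinite.Build _ _ _ (leb n)
  (@lebesgue_rV_sigma_finite n).

End lebesgue_rV.

(* The exponent -n + (q/p)(n - p), which is <= 0 when q <= np/(n - p). *)
Definition wexp (R : realType) (n : nat) (p q : R) : R :=
  - n%:R + q / p * (n%:R - p).

Section weighted.
Context {R : realType} {n : nat}.
Implicit Types (x : 'rV[R]_n) (E Q : set 'rV[R]_n) (u : 'rV[R]_n -> R).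

(* `|x| on 'rV[R]_n is the sup norm; lengths and distances are Euclidean here. *)
Definition enorm x : R := Num.sqrt (\sum_i x ord0 i ^+ 2).

Definition dist x E : R := inf [set enorm (x - y) | y in E].

(* d(x,E)^s, with value +oo when d(x,E) = 0 and s < 0, where powR is 0. *)
Definition dist_pow E (s : R) x : \bar R :=
  if (dist x E == 0) && (s < 0) then +oo%E else (dist x E `^ s)%:E.

Definition mean Q u : R :=
  (\int[@lebesgue_rV R n]_(x in Q) u x) / fine (lebesgue_rV Q).

(* 'D_v u x is a junk value where the limit does not exist; for u Lipschitz on
   a cube Q (and arbitrary off Q) this happens only on a null subset of Q. *)
Definition grad u x : 'rV[R]_n := \row_i 'D_(delta_mx ord0 i) u x.

End weighted.

(* Main.v *)
(** Write [d] for the distance to [E], [s] for the exponent [wexp n p q <= 0],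
    [v = |u - u_Q|] and [w = d^s].  Telescoping the means of [u] over the dyadic
    subcubes [Q_k(y)], of side [l_k], that contain [y], and using the Poincaré
    inequality in each of them, gives
    [v y <= C * sum_k l_k^(1-n) * int_(Q_k(y)) |grad u|].
    Integrating this against [g w], where [g = v^(q-1)], and exchanging the
    integrals bounds [J = int_Q v^q w] by [C * int_Q |grad u| * G], where
    [G = sum_k l_k^(1-n) * int_(Q_k) g w].  The [w]-averages of [g] over [Q_k]
    are at most the weighted dyadic maximal function [m] of [g] and also, by
    Jensen, at most [(J / w(Q_k))^(1/c)] with [c = q / (q - 1)].  The hypothesis
    on [E] gives [w(Q_k) <= C * l_k^n * max(l_k, d)^s]; interpolating between
    the two bounds turns the sum over [k] into a geometric series decaying on
    both sides of the scale [l_k = d] (of another scale if [s = 0]), so that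
    [G <= C * d^(s/p') * m^(c/p') * J^(1/c-1/p')].  Young's inequality with a
    parameter and Doob's inequality, which controls [int_Q m^c w] by [J], now
    yield [J <= lam^p * C * int_Q |grad u|^p + lam^(-p') * C * J^(p'/c)] for
    all [lam > 0], and it remains to optimize over [lam]. *)
Require Import Defs.
From HB Require Import structures.
From mathcomp Require Import all_boot all_order all_algebra.
From mathcomp Require Import all_classical all_reals all_analysis.
From mathcomp Require Import zify measurable_realfun ring lra.
Import Order.TTheory GRing.Theory Num.Theory.
Import numFieldNormedType.Exports.

Set Implicit Arguments.
Unset Strict Implicit.
Unset Printing Implicit Defensive.

Local Open Scope classical_set_scope.
Local Open Scope ring_scope.

(** * Lipschitz functions of one variable *)

(** The function [u] is controlled on [Q] only, so it is first replaced by a Lipschitz extension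
    [U], for which all integrands are measurable; [grad u] itself is never shown measurable and
    occurs only in upper bounds for integrals of nonnegative functions. The telescoping stops after
    [K] levels: the Lipschitz constant of [U] bounds the remainder by [L l / 2^K]. This replaces
    Lebesgue's differentiation theorem, keeps all sums and maxima finite and disappears in the
    limit, while no constant depends on [K]. The averages are taken with respect to [w] itself and
    the maximal function is dyadic because Doob's inequality then asks nothing of the weight beyond
    positive and finite masses. The interpolation parameter [c / p'] is at most [1] because
    [p <= q], and it is the one for which the power [p'] of the bound for [G] contains exactly
    [m^c]. In the final inequality [J] occurs on the right with the power [p'/c >= 1], so [lam] has
    to depend on [J]; this manipulation needs [J] finite, which holds since [v] is bounded on
    [Q]. *)

Section lipschitz_line.
Context {R : realType}.
Notation leb := (@lebesgue_measure R).

Lemma lipschitz_continuous (psi : R -> R) (L : R) :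
  (forall x y, `|psi x - psi y| <= L * `|x - y|) -> continuous psi.
Proof.
move=> psiL x; apply/cvgrPdist_lt => e e0.
have L0 : 0 <= L by have := psiL 1 0; rewrite subr0 normr1 mulr1; apply: le_trans.
near=> y; apply: le_lt_trans (psiL _ _) _.
have : `|x - y| < e / (L + 1).
  by near: y; apply: (@cvgr_dist_lt _ _ _ _ _ id) => //; rewrite divr_gt0// ltr_wpDl.
rewrite ltr_pdivlMr ?ltr_wpDl// => /le_lt_trans; apply.
by rewrite mulrC ler_wpM2l// lerDl.
Unshelve. all: by end_near. Qed.

Lemma cumulative_of (f : R -> R) : {homo f : x y / x <= y} -> continuous f ->
  exists F : cumulative R R, f = F.
Proof.
move=> nd_f cf.
pose B := isCumulative.Build R _ R f nd_f (right_continuousW cf).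
pose F : cumulative R R := HB.pack f B.
by exists F.
Qed.

Lemma lebesgue_stieltjes_ocitv (F : cumulative R R) (a b : R) : a <= b ->
  lebesgue_stieltjes_measure F `]a, b]%classic = (F b - F a)%:E.
Proof.
move=> ab; rewrite /lebesgue_stieltjes_measure /measure_extension.
rewrite measurable_mu_extE/=; last exact: is_ocitv.
by rewrite wlength_itv_bnd.
Qed.

(** [M x - F x] is again nondecreasing and continuous, so its Stieltjes measure and that of [F] add
    up to [M] times Lebesgue measure; the equalities of measures are checked on the intervals []x,
    y]]. The bound yields absolute continuity. *)
Lemma lebesgue_stieltjes_lipschitz_le (F : cumulative R R) (M : R) : 0 <= M ->
  (forall x y, x <= y -> F y - F x <= M * (y - x)) ->
  forall A, measurable A ->
    (lebesgue_stieltjes_measure F A <= M%:E * leb A)%E.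
Proof.
move=> M0 FM A mA.
have ndG : {homo (fun x => M * x - F x) : x y / x <= y}.
  by move=> x y xy; have := FM _ _ xy; rewrite mulrBr; lra.
have cF : continuous F.
  apply: (@lipschitz_continuous _ M).
  move=> x y; wlog xy : x y / x <= y.
    by move=> h; have [/h//|/ltW/h] := leP x y; rewrite distrC (distrC y).
  rewrite distrC (distrC x) ger0_norm ?ger0_norm ?subr_ge0//; first exact: FM.
  exact: cumulative_is_nondecreasing.
have cG : continuous (fun x => M * x - F x).
  by move=> x; apply: cvgB; [apply: cvgMr; exact: cvg_id|exact: cF].
have [G GE] := cumulative_of ndG cG.
have ndH : {homo (fun x => M * x) : x y / x <= y}.
  by move=> x y; exact: ler_wpM2l.
have cH : continuous (fun x : R => M * x).
  by move=> x; apply: cvgMr; exact: cvg_id.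
have [H HE] := cumulative_of ndH cH.
have h1 : lebesgue_stieltjes_measure H A = (M%:E * leb A)%E.
  rewrite (@lebesgue_stieltjes_measure_unique _ H
    (mscale (NngNum M0) leb))// => _ [[x y] _ <-]/=.
  have [xy|yx] := leP x y; last first.
    by rewrite set_itv_ge ?bnd_simp -?leNgt ?(ltW yx)// !measure0.
  rewrite lebesgue_stieltjes_ocitv// /mscale/=.
  rewrite /lebesgue_measure lebesgue_stieltjes_ocitv// -HE/=.
  by rewrite -EFinM mulrBr.
have h2 : lebesgue_stieltjes_measure H A =
    (lebesgue_stieltjes_measure F A + lebesgue_stieltjes_measure G A)%E.
  rewrite -measure_addE.
  apply: lebesgue_stieltjes_measure_unique => // _ [[x y] _ <-]/=.
  have [xy|yx] := leP x y; last first.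
    by rewrite set_itv_ge ?bnd_simp -?leNgt ?(ltW yx)// !measure0.
  rewrite [RHS]measure_addE.
  rewrite [in RHS]/= !lebesgue_stieltjes_ocitv// -HE -GE/=.
  by rewrite -EFinD; congr EFin; ring.
by rewrite -h1 h2 leeDl.
Qed.

(* [psi x + L x] is nondecreasing and Lipschitz, so its Lebesgue-Stieltjes
   measure is absolutely continuous; integrate its Radon-Nikodym density. *)
Lemma lipschitz_ae_derivable (psi : R -> R) (L a b : R) : a < b ->
    (forall x y, `|psi x - psi y| <= L * `|x - y|) ->
  exists g : R -> R, [/\ leb.-integrable `]a, b] (EFin \o g),
    forall x, a <= x <= b -> psi x - psi a = \int[leb]_(t in `]a, x]) g t &
    {ae leb, forall t, a < t < b -> is_derive t 1 psi (g t)}].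
Proof.
move=> ab psiL.
have L0 : 0 <= L by have := psiL 1 0; rewrite subr0 normr1 mulr1; apply: le_trans.
have ndf : {homo (fun x => L * x + psi x) : x y / x <= y}.
  move=> x y xy; have := psiL x y; rewrite [`|x - y|]distrC [`|y - x|]ger0_norm ?subr_ge0//.
  rewrite ler_norml => /andP[_]; rewrite mulrBr; lra.
have cf : continuous (fun x => L * x + psi x).
  move=> x; apply: cvgD; first by apply: cvgMr; exact: cvg_id.
  exact: (lipschitz_continuous psiL).
have [F FE] := cumulative_of ndf cf.
have F2L x y : x <= y -> F y - F x <= (2 * L) * (y - x).
  move=> xy; rewrite -FE; have := psiL y x; rewrite [`|y - x|]ger0_norm ?subr_ge0//.
  rewrite ler_norml => /andP[_]; rewrite !mulrBr; lra.
have L20 : 0 <= 2 * L by rewrite mulr_ge0.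
have muF := lebesgue_stieltjes_lipschitz_le L20 F2L.
have mab : measurable (`]a, b]%classic : set (measurableTypeR R)) by exact: measurable_itv.
have fab : (lebesgue_stieltjes_measure F `]a, b]%classic < +oo)%E.
  by rewrite lebesgue_stieltjes_ocitv ?ltry// ltW.
(* The restriction to []a, b]] is finite, so it has an integrable density with respect to Lebesgue
   measure. *)
pose nu : {finite_measure set (measurableTypeR R) -> \bar R} := mfrestr mab fab.
have nuE A : nu A = lebesgue_stieltjes_measure F (A `&` `]a, b]%classic) by [].
have nu_leb : nu `<< leb.
  apply/null_content_dominatesP => A mA A0; apply/eqP.
  rewrite eq_le measure_ge0 andbT nuE.
  have mAab : measurable (A `&` `]a, b]%classic) by exact: measurableI.
  apply: (le_trans (muF _ mAab)).
  rewrite (_ : leb _ = 0%E) ?mule0//.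
  by apply: (subset_measure0 _ _ _ A0) => //; exact: subIsetl.
have [f [f0 ffin intf fE]] := radon_nikodym_sigma_finite nu_leb.
pose h : R -> R := fun x => fine (f x).
have hf : EFin \o h = f by apply/funext => x /=; rewrite fineK.
have inth : leb.-integrable [set: R] (EFin \o h) by rewrite hf.
have mh : measurable_fun [set: R] h by apply/measurable_EFinP; exact: measurable_int inth.
have inth_itv (i : interval R) : leb.-integrable [set` i] (EFin \o h).
  by apply: integrableS inth => //; exact: measurable_itv.
have loch : locally_integrable [set: R] h by apply: open_integrable_locally => //; exact: openT.
have FTC := @FTC1 R h (BRight a) (fun y => inth_itv _) loch.
have FI x : a <= x <= b -> F x - F a = \int[leb]_(t in `]a, x]) h t.
  move=> /andP[ax xb]; rewrite /Rintegral.
  under eq_integral do rewrite fineK//.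
  rewrite -fE; last exact: measurable_itv.
  rewrite nuE (setIidl _); last first.
    by move=> t /=; rewrite !in_itv/= => /andP[-> /le_trans ->].
  by rewrite lebesgue_stieltjes_ocitv.
have cst_int x : leb.-integrable `]a, x] (EFin \o cst L).
  apply/integrableP; split; first exact/measurable_EFinP.
  under eq_integral do rewrite /= (ger0_norm L0).
  rewrite integral_cst//=.
  rewrite lebesgue_measure_itv/= lte_fin; case: ifP => _; last by rewrite mule0 ltry.
  by rewrite -EFinB -EFinM ltry.
exists (fun x => h x - L); split.
- rewrite (_ : _ \o _ = (EFin \o h) \- (EFin \o cst L))%E; last by apply/funext.
  have mab2 := mab; by have := integrableB mab2 (inth_itv `]a, b]) (cst_int b).
- move=> x axb; rewrite RintegralB//.
  rewrite -FI// Rintegral_cst//.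
  move: axb => /andP[ax xb].
  have mux : lebesgue_measure `]a, x]%classic = (x - a)%:E :> \bar R.
    rewrite lebesgue_measure_itv/= lte_fin; case: ltP => [_//|xa].
    by have -> : x = a; [apply/le_anti; rewrite ax xa|rewrite subrr].
  transitivity (F x - F a - L * (x - a)); first by rewrite -FE/=; ring.
  by congr (_ - L * _); apply/esym; exact: (congr1 fine mux).
- apply: (@filterS _ _ (ae_filter_ringOfSetsType leb) _ _ _ FTC) => x /= + /andP[ax xb].
  rewrite lte_fin => /(_ ax) [dF dFE].
  have dF' : is_derive x 1 (fun y => \int[leb]_(t in `]a, y]) h t) (h x).
    by apply: DeriveDef; [exact: dF|rewrite -derive1E].
  (* Near an interior point, [psi] agrees with the primitive of [h] plus [F a - L y]. *)
  have : is_derive x 1 (fun y => \int[leb]_(t in `]a, y]) h t + (F a - L * y)) (h x + (0 - L)).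
    apply: is_deriveD; apply: is_deriveB.
    by rewrite -[X in is_derive _ _ _ X]mulr1; apply: is_deriveZ.
  rewrite sub0r; apply: near_eq_is_derive.
  near=> y; rewrite -FI; last first.
    apply/andP; split; apply: ltW; near: y; [exact: lt_nbhsr|exact: lt_nbhsl].
  by rewrite -FE/=; ring.
Unshelve. all: by end_near. Qed.

End lipschitz_line.

(** * Integration on ['rV_n] *)

Section integral_nneg.
Context d (T : measurableType d) (R : realType).
Variable mu : {measure set T -> \bar R}.
Local Open Scope ereal_scope.

(** The integral of a nonnegative function is a supremum over the simple functions below it, so
    monotonicity asks for no measurability. This matters for integrands built from [grad u]. *)
Lemma le_integral_nneg (D : set T) (f g : T -> \bar R) :
  (forall x, D x -> 0 <= f x) -> (forall x, D x -> f x <= g x) ->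
  \int[mu]_(x in D) f x <= \int[mu]_(x in D) g x.
Proof.
move=> f0 fg.
have g0 x : D x -> 0 <= g x by move=> Dx; exact: le_trans (f0 _ Dx) (fg _ Dx).
rewrite !ge0_integralE//; apply: ereal_sup_le => _ [h hf <-].
exists h => // x; apply: le_trans (hf x) _; rewrite /patch; case: ifPn => //.
by move=> /set_mem; exact: fg.
Qed.

End integral_nneg.

Section tonelli_in.
Context d1 d2 (T1 : measurableType d1) (T2 : measurableType d2) (R : realType).
Variable m1 : {sigma_finite_measure set T1 -> \bar R}.
Variable m2 : {sigma_finite_measure set T2 -> \bar R}.
Variables (D1 : set T1) (D2 : set T2) (f : T1 * T2 -> \bar R).
Hypotheses (mD1 : measurable D1) (mD2 : measurable D2).
Hypothesis mf : measurable_fun setT f.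
Hypothesis f0 : forall z, (0 <= f z)%E.
Local Open Scope ereal_scope.

Let F := f \_ (setT `*` D2).

Let mF : measurable_fun setT F.
Proof.
apply/(measurable_restrictT _ _).1; first exact: measurableX.
exact: measurable_funS mf.
Qed.

Lemma measurable_fun_integral_in :
  measurable_fun setT (fun x => \int[m2]_(y in D2) f (x, y)).
Proof.
rewrite (_ : (fun x => _) = fubini_F m2 F).
  by apply: measurable_fun_fubini_tonelli_F => // z; exact: erestrict_ge0.
apply/funext => x; rewrite /fubini_F [LHS]integral_mkcond; apply: eq_integral => y _.
rewrite /F /patch; congr (if _ then _ else _).
by apply/idP/idP => /set_mem h; apply/mem_set => //; case: h.
Qed.

Lemma tonelli_in :
  \int[m1]_(x in D1) \int[m2]_(y in D2) f (x, y) =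
  \int[m2]_(y in D2) \int[m1]_(x in D1) f (x, y).
Proof.
pose G := f \_ (D1 `*` D2).
have G0 z : 0 <= G z by exact: erestrict_ge0.
have mG : measurable_fun setT G.
  apply/(measurable_restrictT _ _).1; first exact: measurableX.
  exact: measurable_funS mf.
transitivity (\int[m1]_x \int[m2]_y G (x, y)).
  rewrite [LHS]integral_mkcond; apply: eq_integral => x _.
  rewrite {1}/patch; case: ifPn => xD1.
    rewrite [LHS]integral_mkcond; apply: eq_integral => y _; rewrite /G /patch.
    by rewrite in_setX xD1.
  by rewrite integral0_eq// => y _; rewrite /G /patch in_setX (negbTE xD1).
rewrite (fubini_tonelli G mG G0).
rewrite [RHS]integral_mkcond; apply: eq_integral => y _.
rewrite [RHS]/patch; case: ifPn => yD2.
  rewrite [RHS]integral_mkcond; apply: eq_integral => x _; rewrite /G /patch.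
  by rewrite in_setX yD2 andbT.
by rewrite integral0_eq// => x _; rewrite /G /patch in_setX (negbTE yD2) andbF.
Qed.

End tonelli_in.

Definition upd (R : realType) n (x : 'rV[R]_n) (i : 'I_n) (t : R) : 'rV[R]_n :=
  \row_j (if j == i then t else x ord0 j).

Arguments lebesgue_rV : simpl never.

Section cons_rV_theory.
Context {R : realType}.
Local Notation leb n := (@lebesgue_rV R n).

Lemma cons_rV_surj n (x : 'rV[R]_n.+1) :
  x = cons_rV (x ord0 ord0, \row_i x ord0 (lift ord0 i)).
Proof.
apply/rowP => i; case: (unliftP ord0 i) => [j|] ->; last by rewrite cons_rV0.
by rewrite cons_rVS mxE.
Qed.

Lemma upd_id n (x : 'rV[R]_n) i : upd x i (x ord0 i) = x.
Proof. by apply/rowP => j; rewrite mxE; case: eqP => [->|]. Qed.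

Lemma upd_cons0 n t (y : 'rV[R]_n) s : upd (cons_rV (t, y)) ord0 s = cons_rV (s, y).
Proof.
apply/rowP => i; rewrite mxE; case: (unliftP ord0 i) => [j|] ->.
  by rewrite -(inj_eq val_inj)/= !cons_rVS.
by rewrite eqxx cons_rV0.
Qed.

Lemma upd_consS n t (y : 'rV[R]_n) j s :
  upd (cons_rV (t, y)) (lift ord0 j) s = cons_rV (t, upd y j s).
Proof.
apply/rowP => i; rewrite mxE; case: (unliftP ord0 i) => [k|] ->.
  by rewrite (inj_eq lift_inj) !cons_rVS mxE.
by rewrite -(inj_eq val_inj)/= !cons_rV0.
Qed.

Lemma measurable_consr n t : measurable_fun setT (fun y : 'rV[R]_n => cons_rV (t, y)).
Proof.
apply: (measurableT_comp (@measurable_cons_rV R n)).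
exact: measurable_fun_pair.
Qed.

Lemma integral_cons_rV n (a b : 'rV[R]_n.+1) (h : 'rV[R]_n.+1 -> \bar R) :
  measurable_fun setT h -> (forall x, (0 <= h x)%E) ->
  (\int[leb n.+1]_(x in box a b) h x =
   \int[lebesgue_measure]_(t in `[a ord0 ord0, b ord0 ord0[)
     \int[leb n]_(y in box (\row_i a ord0 (lift ord0 i)) (\row_i b ord0 (lift ord0 i)))
       h (cons_rV (t, y)))%E.
Proof.
move=> mh h0.
have mc : measurable_fun [set: (measurableTypeR R * 'rV[R]_n)%type] (@cons_rV R n).
  exact: (@measurable_cons_rV R n).
pose P : set (measurableTypeR R * 'rV[R]_n) := `[a ord0 ord0, b ord0 ord0[%classic `*`
    box (\row_i a ord0 (lift ord0 i)) (\row_i b ord0 (lift ord0 i)).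
have mP : measurable P by apply: measurableX; [exact: measurable_itv|exact: measurable_box].
transitivity (\int[lebesgue_measure \x leb n]_(z in P) h (cons_rV z))%E.
  rewrite /P -preimage_cons_rV_box.
  have := @ge0_integral_pushforward _ _ (measurableTypeR R * 'rV[R]_n)%type _ R (@cons_rV R n) mc
    (lebesgue_measure \x leb n)%E (box a b) h (measurable_box _ _)
    (measurable_funTS mh) (fun x _ => h0 x).
  move=> <-.
  exact: eq_measure_integral.
rewrite [LHS]integral_mkcond.
pose G := (h \o @cons_rV R n) \_ P.
have G0 z : (0 <= G z)%E by apply: erestrict_ge0 => ? _; exact: h0.
have mG : measurable_fun setT G.
  apply/(measurable_restrictT _ _).1 => //.
  by apply: measurable_funTS; exact: measurableT_comp.
rewrite (fubini_tonelli1 G)// [RHS]integral_mkcond.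
apply: eq_integral => t _; rewrite [RHS]/patch /fubini_F; case: ifPn => tI.
  rewrite [RHS]integral_mkcond; apply: eq_integral => y _; rewrite /G /patch.
  by rewrite in_setX tI.
by rewrite integral0_eq// => y _; rewrite /G /patch in_setX (negbTE tI).
Qed.

(** Tonelli's theorem in direction [i], by induction on the dimension; it serves to show that the
    faces of a cube are null. *)
Lemma lebesgue_rV_slices0 n (A : set 'rV[R]_n) (i : 'I_n) : measurable A ->
  (forall x, lebesgue_measure [set t | A (upd x i t)] = 0%E) -> leb n A = 0%E.
Proof.
elim: n A i => [A []//|n ih A i mA].
have mc : measurable_fun [set: (measurableTypeR R * 'rV[R]_n)%type] (@cons_rV R n).
  exact: (@measurable_cons_rV R n).
have mB : measurable (@cons_rV R n @^-1` A) by rewrite -[X in measurable X]setTI; exact: mc.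
have -> : leb n.+1 A = (lebesgue_measure \x leb n)%E (@cons_rV R n @^-1` A) by [].
case: (unliftP ord0 i) => [j|] -> A0.
  rewrite /product_measure1 integral0_eq// => t _ /=; apply: (ih _ j).
    exact: measurable_xsection.
  move=> y; rewrite -(A0 (cons_rV (t, y))); congr lebesgue_measure.
  by apply/seteqP; split => s /=; rewrite upd_consS /xsection/= inE.
(* Now the sections run along the first coordinate, the outer variable of the product measure, so
   the order of integration is exchanged. *)
have := @indic_fubini_tonelli2 _ _ _ _ R lebesgue_measure (leb n) _ mB.
have := @indic_fubini_tonelli1 _ _ _ _ R lebesgue_measure (leb n) _ mB.
rewrite integral_indic// setIT => ->.
rewrite integral_indic// setIT => h2.
rewrite (@indic_fubini_tonelli _ _ _ _ R lebesgue_measure (leb n) _ mB).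
rewrite -h2; apply: integral0_eq => y _ /=.
rewrite -(A0 (cons_rV (0, y))); congr lebesgue_measure.
by apply/seteqP; split => s /=; rewrite upd_cons0 /ysection/= inE.
Qed.

End cons_rV_theory.

(** * The Poincaré inequality on a box *)

Section box_poincare.
Context {R : realType}.
Local Notation leb n := (@lebesgue_rV R n).
Local Notation tail x := (\row_i x ord0 (lift ord0 i)).

Lemma measurable_tail n : measurable_fun setT (fun x : 'rV[R]_n.+1 => tail x : 'rV[R]_n).
Proof.
apply: measurable_fun_rV => i; under eq_fun do rewrite mxE.
exact: measurable_coord.
Qed.

Lemma tail_cons n t (y : 'rV[R]_n) : tail (cons_rV (t, y)) = y.
Proof. by apply/rowP => i; rewrite mxE cons_rVS. Qed.

Lemma box_cons n (a b : 'rV[R]_n.+1) t y :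
  box a b (cons_rV (t, y)) <->
  (a ord0 ord0 <= t < b ord0 ord0) /\ box (tail a) (tail b) y.
Proof.
have := congr1 (fun A => A (t, y)) (preimage_cons_rV_box a b) => /= ->.
by rewrite in_itv.
Qed.

Lemma integral_itv_cst (a b : R) (k : \bar R) : a <= b ->
  (\int[lebesgue_measure]_(t in `[a, b[) k = (b - a)%:E * k)%E.
Proof.
move=> ab; have := @integral_cst _ _ _ (@lebesgue_measure R) `[a, b[%classic (measurable_itv _) k.
rewrite /= => ->; rewrite muleC; congr (_ * _)%E.
rewrite lebesgue_measure_itv/= lte_fin; case: ltP => // ba.
by rewrite (@le_anti _ _ a b) ?subrr ?ab.
Qed.

(** Go from [x] to [y] through the point with the head of [x] and the tail of [y]. The change of
    tail is handled by the induction hypothesis in a slice, the change of head by [uf] along the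
    first axis. The [f i] stand for absolute partial derivatives; keeping them abstract lets the
    hypotheses pass to slices. *)
Lemma box_poincare n (a b : 'rV[R]_n) (u : 'rV[R]_n -> R)
    (f : 'I_n -> 'rV[R]_n -> R) :
  (forall i, a ord0 i <= b ord0 i) ->
  measurable_fun setT u -> (forall i, measurable_fun setT (f i)) ->
  (forall i x, 0 <= f i x) ->
  (forall i x t, box a b x -> a ord0 i <= t < b ord0 i ->
    (`|u x - u (upd x i t)|%:E <=
     \int[lebesgue_measure]_(s in `[a ord0 i, b ord0 i[) (f i (upd x i s))%:E)%E) ->
  (\int[leb n]_(x in box a b) \int[leb n]_(y in box a b) `|u x - u y|%:E <=
   (\prod_i (b ord0 i - a ord0 i))%:E *
   \sum_i ((b ord0 i - a ord0 i)%:E * \int[leb n]_(x in box a b) (f i x)%:E))%E.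
Proof.
elim: n a b u f => [|n ih] a b u f ab mu mf f0 uf.
  rewrite !big_ord0 mule0 integral0_eq// => x _; rewrite integral0_eq// => y _.
  have -> : x = y by apply/rowP => -[].
  by rewrite subrr normr0.
pose B := box a b; pose B' := box (tail a) (tail b).
pose l0 := b ord0 ord0 - a ord0 ord0.
pose I0 := `[a ord0 ord0, b ord0 ord0[%classic : set (measurableTypeR R).
have l00 : 0 <= l0 by rewrite subr_ge0.
have mB : measurable B by exact: measurable_box.
have mB' : measurable B' by exact: measurable_box.
have mI0 : measurable I0 by exact: measurable_itv.
have mcons : measurable_fun [set: (measurableTypeR R * 'rV[R]_n)%type] (@cons_rV R n).
  exact: (@measurable_cons_rV R n).
pose Phi (w : 'rV[R]_n) := (\int[lebesgue_measure]_(s in I0) (f ord0 (cons_rV (s, w)))%:E)%E.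
have Phi0 w : (0 <= Phi w)%E by apply: integral_ge0 => s _; rewrite lee_fin.
have mf0 : measurable_fun [set: ('rV[R]_n * measurableTypeR R)%type]
    (fun z => (f ord0 (cons_rV (z.2, z.1)))%:E).
  apply/measurable_EFinP; apply: (measurableT_comp (mf _)).
  by apply: (measurableT_comp mcons); exact: measurable_fun_pair.
have mPhi : measurable_fun setT Phi.
  apply: (@measurable_fun_integral_in _ _ _ _ R lebesgue_measure I0
    (fun z => (f ord0 (cons_rV (z.2, z.1)))%:E)) => // z; by rewrite lee_fin.
pose psi (x : 'rV[R]_n.+1) :=
  (\int[leb n]_(w in B') `|u x - u (cons_rV (x ord0 ord0, w))|%:E)%E.
have psi0 x : (0 <= psi x)%E by apply: integral_ge0 => s _; rewrite lee_fin.
have mx0 : measurable_fun setT (fun z : 'rV[R]_n.+1 * 'rV[R]_n => z.1 ord0 ord0).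
  by apply: (measurableT_comp (@measurable_coord _ R n.+1 ord0)).
have mux0 : measurable_fun setT (fun z : 'rV[R]_n.+1 * 'rV[R]_n =>
    `|u z.1 - u (cons_rV (z.1 ord0 ord0, z.2))|%:E).
  apply/measurable_EFinP; apply: (measurableT_comp (@normr_measurable _ _)).
  apply: measurable_funB; first by apply: measurableT_comp.
  apply: (measurableT_comp mu); apply: (measurableT_comp mcons).
  by apply: measurable_fun_pair.
have mpsi : measurable_fun setT psi.
  apply: (@measurable_fun_integral_in _ _ _ _ R (leb n) B'
    (fun z => `|u z.1 - u (cons_rV (z.1 ord0 ord0, z.2))|%:E)) => // z; by rewrite lee_fin.
have int_tail (g : 'rV[R]_n -> \bar R) : measurable_fun setT g -> (forall w, 0 <= g w)%E ->
    (\int[leb n.+1]_(y in B) g (tail y) = l0%:E * \int[leb n]_(w in B') g w)%E.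
  move=> mg g0; rewrite integral_cons_rV//; last first.
    exact: (measurableT_comp mg (@measurable_tail n)).
  under eq_integral do under eq_integral do rewrite tail_cons.
  by rewrite integral_itv_cst.
have intPhi : (\int[leb n]_(w in B') Phi w = \int[leb n.+1]_(x in B) (f ord0 x)%:E)%E.
  rewrite /Phi (@tonelli_in _ _ _ _ R (leb n) lebesgue_measure _ _
    (fun z => (f ord0 (cons_rV (z.2, z.1)))%:E))//; last first.
    by move=> z; rewrite lee_fin.
  rewrite -(@integral_cons_rV _ _ a b (EFin \o f ord0))//.
    by apply/measurable_EFinP.
  by move=> x; rewrite lee_fin.
(* [psi x] collects the changes of tail with the head of [x] kept fixed; the line integrals [Phi]
   for the change of head depend on the tail of [y] only, and integrate to a quantity free of
   [x]. *)
have inner x : B x -> (\int[leb n.+1]_(y in B) `|u x - u y|%:E <=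
    l0%:E * psi x + l0%:E * \int[leb n.+1]_(x in B) (f ord0 x)%:E)%E.
  move=> Bx.
  pose g w := `|u x - u (cons_rV (x ord0 ord0, w))|%:E.
  have mg : measurable_fun setT g.
    apply/measurable_EFinP; apply: (measurableT_comp (@normr_measurable _ _)).
    apply: measurable_funB => //; apply: (measurableT_comp mu).
    exact: measurable_consr.
  have g0 w : (0 <= g w)%E by rewrite lee_fin.
  have -> : psi x = (\int[leb n]_(w in B') g w)%E by [].
  rewrite -intPhi -!int_tail// -ge0_integralD//; last 2 first.
  - apply: measurable_funTS; exact: (measurableT_comp mg (@measurable_tail n)).
  - apply: measurable_funTS; exact: (measurableT_comp mPhi (@measurable_tail n)).
  apply: le_integral_nneg => [y _|y By]; first by rewrite lee_fin.
  have Bx' : B (cons_rV (x ord0 ord0, tail y)).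
    apply/box_cons; split; first exact: Bx.
    by move=> i; rewrite !mxE; exact: By.
  have := uf ord0 _ (y ord0 ord0) Bx' (By ord0).
  rewrite upd_cons0 -cons_rV_surj.
  under eq_integral do rewrite upd_cons0.
  move=> /(leeD2l (g (tail y))); apply: le_trans.
  by rewrite /g -EFinD lee_fin -[X in `|X|](subrKA (u (cons_rV (x ord0 ord0, tail y)))) ler_normD.
apply: (@le_trans _ _ (\int[leb n.+1]_(x in B) (l0%:E * psi x + l0%:E * \int[leb n.+1]_(x in B) (f ord0 x)%:E))%E).
  apply: le_integral_nneg => // x _.
  by apply: integral_ge0 => y _; rewrite lee_fin.
have F00 : (0 <= \int[leb n.+1]_(x in B) (f ord0 x)%:E)%E by apply: integral_ge0 => x _; rewrite lee_fin.
rewrite ge0_integralD//; last 3 first.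
- by move=> x _; rewrite mule_ge0.
- by apply: measurable_funTS; exact: measurable_funeM.
- by move=> x _; rewrite mule_ge0.
rewrite ge0_integralZl//; last exact: measurable_funTS.
rewrite integral_cst// [X in (_ + _ * X <= _)%E](_ : _ = (\prod_i (b ord0 i - a ord0 i))%:E); last first.
  exact: lebesgue_rV_box.
rewrite big_ord_recl [X in (_ <= _ * X)%E]big_ord_recl -/l0.
set V := \prod_(i < n) _; set F0 := (\int[_]_(x in B) (f _ x)%:E)%E; set S := (X in (_ <= _ * (_ + X))%E).
have S0 : (0 <= S)%E.
  apply: sume_ge0 => i _; rewrite mule_ge0 ?lee_fin ?subr_ge0//.
  by apply: integral_ge0 => x _; rewrite lee_fin.
have V0 : 0 <= V by apply: prodr_ge0 => i _; rewrite subr_ge0.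
rewrite [X in (_ <= X)%E]ge0_muleDr//; last by rewrite mule_ge0.
rewrite addeC [X in (X + _ <= _)%E]muleC leeD2l// EFinM -muleA lee_wpmul2l ?lee_fin//.
rewrite integral_cons_rV//.
(* For each value [t] of the first coordinate, the induction hypothesis applies to the slice of [u]
   at [t]. *)
apply: (@le_trans _ _ (\int[lebesgue_measure]_(t in I0) (V%:E * \sum_(i < n)
  ((b ord0 (lift ord0 i) - a ord0 (lift ord0 i))%:E *
   \int[leb n]_(y in B') (f (lift ord0 i) (cons_rV (t, y)))%:E)))%E).
  apply: le_integral_nneg => [t _|t It]; first exact: integral_ge0.
  have mct := @measurable_consr R n t.
  have ab' i : (tail a) ord0 i <= (tail b) ord0 i by rewrite !mxE.
  have := ih (tail a) (tail b) (fun y => u (cons_rV (t, y))) (fun i y => f (lift ord0 i) (cons_rV (t, y)))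
    ab' (measurableT_comp mu mct) (fun i => measurableT_comp (mf _) mct) (fun i y => f0 _ _).
  have -> : \prod_(i < n) ((tail b) ord0 i - (tail a) ord0 i) = V.
    by apply: eq_bigr => i _; rewrite !mxE.
  under [X in (_ -> _ <= _ * X)%E -> _]eq_bigr do rewrite !mxE.
  move=> h; apply: le_trans (h _).
    apply: le_integral_nneg => [y _|y _]; first exact: psi0.
    by rewrite /psi cons_rV0.
  move=> i y s B'y abs.
  have Bty : B (cons_rV (t, y)) by apply/box_cons; split => //; move: It; rewrite /I0/= in_itv.
  move: abs; rewrite !mxE => abs.
  have := uf (lift ord0 i) _ s Bty abs.
  rewrite upd_consS => /le_trans; apply.
  by apply: le_integral_nneg => [r _|r _]; rewrite ?lee_fin// upd_consS.
pose G i t := (\int[leb n]_(y in B') (f (lift ord0 i) (cons_rV (t, y)))%:E)%E.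
have G0 i t : (0 <= G i t)%E by apply: integral_ge0 => y _; rewrite lee_fin.
have mG i : measurable_fun [set: measurableTypeR R] (G i).
  apply: (@measurable_fun_integral_in _ _ _ _ R (leb n) B'
    (fun z : measurableTypeR R * 'rV[R]_n => (f (lift ord0 i) (cons_rV z))%:E)) => //.
    by apply/measurable_EFinP; exact: (measurableT_comp (mf _) mcons).
  by move=> z; rewrite lee_fin.
have mGl i : measurable_fun [set: measurableTypeR R]
    (fun t => (b ord0 (lift ord0 i) - a ord0 (lift ord0 i))%:E * G i t)%E.
  exact: measurable_funeM.
have l0i i : 0 <= b ord0 (lift ord0 i) - a ord0 (lift ord0 i) by rewrite subr_ge0.
rewrite ge0_integralZl//; last 2 first.
- apply: measurable_funTS; apply: emeasurable_sum => i; exact: mGl.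
- by move=> t _; apply: sume_ge0 => i _; apply: mule_ge0; [rewrite lee_fin|exact: G0].
rewrite lee_wpmul2l ?lee_fin// ge0_integral_sum//; last 2 first.
- by move=> i; apply: measurable_funTS; exact: mGl.
- by move=> i t _; apply: mule_ge0; [rewrite lee_fin|exact: G0].
apply: lee_sum => i _; rewrite ge0_integralZl ?lee_fin//; last 2 first.
- exact: (measurable_funTS (mG i)).
- by move=> t _; exact: G0.
rewrite lee_wpmul2l ?lee_fin//.
rewrite [X in (_ <= X)%E]integral_cons_rV//; first exact/measurable_EFinP.
by move=> x; rewrite lee_fin.
Qed.

End box_poincare.

(** * Averages and the maximal function over nested partitions *)

Section young.
Context {R : realType}.
Implicit Types (c q x y : R).

Lemma conjugate_gt1 c q : 0 < c -> 0 < q -> c^-1 + q^-1 = 1 -> 1 < c.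
Proof.
move=> c0 q0 cq; rewrite -[c]invrK invf_gt1 ?invr_gt0//.
by rewrite -cq ltrDl invr_gt0.
Qed.

Lemma powRB1K c q x : 0 < c -> 0 < q -> c^-1 + q^-1 = 1 ->
  (x `^ (c - 1)) `^ q = x `^ c.
Proof.
move=> c0 q0 cq; rewrite -powRrM; congr (_ `^ _).
have -> : c - 1 = c * q^-1.
  by have -> : q^-1 = 1 - c^-1; [rewrite -cq; ring|rewrite mulrBr mulr1 divff ?gt_eqF].
by rewrite mulfVK ?gt_eqF.
Qed.

(** Young's inequality multiplied by [q], using [(c - 1) q = c] and [q / c = q - 1]. In this form it
    is the tangent-line inequality for the power [c], with equality at [x = y], and serves both
    Doob's and Jensen's inequalities. *)
Lemma young_powR c q x y : 0 < c -> 0 < q -> c^-1 + q^-1 = 1 -> 0 <= x -> 0 <= y ->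
  q * x * y `^ (c - 1) <= (q - 1) * x `^ c + y `^ c.
Proof.
move=> c0 q0 cq x0 y0.
have := @conjugate_powR R x (y `^ (c - 1)) c q x0 (powR_ge0 _ _) c0 q0 cq.
rewrite (powRB1K _ c0 q0 cq) => /(ler_wpM2l (ltW q0)); rewrite mulrA => /le_trans; apply.
have -> : q - 1 = q / c.
  have -> : c^-1 = 1 - q^-1 by rewrite -cq; ring.
  by rewrite mulrBr mulr1 divff ?gt_eqF.
rewrite le_eqVlt; apply/orP; left; apply/eqP; field; by rewrite !gt_eqF.
Qed.

(** If the maximum stays [m] there is nothing to show; if it rises to [s], the claim is [young_powR]
    for [s] and [m]. *)
Lemma max_powR_step c q m s : 0 < c -> 0 < q -> c^-1 + q^-1 = 1 ->
    0 <= m -> 0 <= s ->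
  Num.max m s `^ c + q * (m `^ (c - 1) * s) <=
  m `^ c + q * (Num.max m s `^ (c - 1) * s).
Proof.
move=> c0 q0 cq m0 s0; have [sm|ms] := leP s m; first by [].
have := young_powR c0 q0 cq s0 m0.
have -> : s `^ (c - 1) * s = s `^ c by rewrite mulrC mulr_powRB1.
by rewrite mulrBl mul1r mulrAC -mulrA; lra.
Qed.

(** Splitting the product into [2 q x] and half of [y^(c - 1)] leaves a coefficient of [y^c] small
    enough to be absorbed. *)
Lemma young_half c q x y : 0 < c -> 0 < q -> c^-1 + q^-1 = 1 -> 0 <= x -> 0 <= y ->
  q * x * y `^ (c - 1) <= (2 * q) `^ c * x `^ c + 2^-1 * y `^ c.
Proof.
move=> c0 q0 cq x0 y0.
have c1 := conjugate_gt1 c0 q0 cq.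
have q1 : 1 < q by apply: (conjugate_gt1 q0 c0); rewrite addrC.
have := @conjugate_powR R (2 * q * x) (2^-1 * y `^ (c - 1)) c q _ _ c0 q0 cq.
rewrite !mulr_ge0 ?powR_ge0 ?invr_ge0 ?(ltW q0)//.
move=> /(_ isT isT); rewrite (_ : _ * _ * _ * _ = q * x * y `^ (c - 1)); last first.
  by field.
move=> /le_trans; apply; rewrite lerD//.
  rewrite powRM ?mulr_ge0 ?(ltW q0)// ler_pdivrMr// ler_peMr ?(ltW c1)//.
  by rewrite mulr_ge0 ?powR_ge0.
rewrite powRM ?powR_ge0 ?invr_ge0 ?ler0n// (powRB1K _ c0 q0 cq).
have half : (2^-1 : R) `^ q <= 2^-1.
  by apply: ge1r_powR; rewrite ?(ltW q1)// invr_gt0 ltr0n invf_le1 ?ltr0n ?ler1n.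
rewrite ler_pdivrMr//.
have M0 : 0 <= y `^ c by exact: powR_ge0.
have h1 : 2^-1 `^ q * y `^ c <= 2^-1 * y `^ c by rewrite ler_wpM2r.
have h2 : 0 <= 2^-1 * y `^ c by rewrite mulr_ge0 ?invr_ge0.
by rewrite (le_trans h1)// ler_peMr ?(ltW q1).
Qed.

End young.

Lemma absorb_half (R : realType) (r : R) (i j : \bar R) : 0 < r -> (0 <= j)%E ->
  i \is a fin_num -> (i <= r%:E * j + (2^-1)%:E * i -> i <= (2 * r)%:E * j)%E.
Proof.
move=> r0 j0 /fineK <-; have [->|jfin] := eqVneq j +oo%E.
  by move=> _; rewrite mulry gtr0_sg ?mulr_gt0// mul1e leey.
have /fineK <- : j \is a fin_num by rewrite ge0_fin_numE// ltey.
by rewrite -!EFinM -EFinD !lee_fin; lra.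
Qed.

(* A measurable partition of [Q] is encoded by the equivalence relation [E] of
   lying in the same cell; outside [Q] cells are empty. *)
Section cell_integral.
Context d (T : measurableType d) (R : realType).
Variable mu : {sigma_finite_measure set T -> \bar R}.
Variables (Q : set T) (E : set (T * T)).
Hypothesis mQ : measurable Q.
Hypothesis mE : measurable E.
Hypothesis E_sym : forall x y, E (x, y) -> E (y, x).
Hypothesis E_trans : forall x y z, E (x, y) -> E (y, z) -> E (x, z).
Hypothesis E_dom : forall x y, E (x, y) -> Q x.
Local Open Scope ereal_scope.

Definition cell (y : T) : set T := [set x | E (y, x)].
Definition cell_int (h : T -> \bar R) (y : T) := \int[mu]_(x in cell y) h x.

Lemma measurable_cell y : measurable (cell y).
Proof.
rewrite (_ : cell y = xsection E y); first exact: measurable_xsection.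
by apply/seteqP; split => x; rewrite /xsection/= inE.
Qed.

Lemma cell_sub y : cell y `<=` Q.
Proof. by move=> x /E_sym/E_dom. Qed.

Lemma cell_eq x y : E (x, y) -> cell x = cell y.
Proof.
move=> xy; apply/seteqP; split => z /=; first exact/E_trans/E_sym.
exact: E_trans.
Qed.

Lemma cell_int_inv h x y : E (x, y) -> cell_int h x = cell_int h y.
Proof. by move=> xy; rewrite /cell_int (cell_eq xy). Qed.

Lemma cell_intE h y : cell_int h y = \int[mu]_x ((\1_E (y, x))%:E * h x).
Proof.
rewrite /cell_int [LHS]integral_mkcond; apply: eq_integral => x _.
rewrite /patch indicE; case: ifPn => xy.
  by rewrite mem_set ?mul1e//; exact: set_mem xy.
rewrite memNset ?mul0e// => xy'; move: xy; rewrite notin_setE; exact.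
Qed.

Let mK (h : T -> \bar R) : measurable_fun setT h ->
  measurable_fun setT (fun z : T * T => (\1_E z)%:E * h z.2).
Proof.
move=> mh; apply: emeasurable_funM; first exact/measurable_EFinP.
exact: measurableT_comp.
Qed.

Lemma measurable_cell_int h : measurable_fun setT h -> (forall x, 0 <= h x) ->
  measurable_fun setT (cell_int h).
Proof.
move=> mh h0.
rewrite (_ : cell_int h = fubini_F mu (fun z : T * T => (\1_E z)%:E * h z.2)).
  by apply: measurable_fun_fubini_tonelli_F => [|z]; [exact: mK|rewrite mule_ge0 ?lee_fin].
by apply/funext => y; rewrite cell_intE.
Qed.

Lemma cell_int_ge0 h y : (forall x, 0 <= h x) -> 0 <= cell_int h y.
Proof. by move=> h0; exact: integral_ge0. Qed.

(** Integration over cells is self-adjoint: both sides are the integral of [h1 x * h2 y] over the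
    pairs in a common cell, a symmetric relation. *)
Lemma cell_int_sym (h1 h2 : T -> \bar R) :
  measurable_fun setT h1 -> (forall x, 0 <= h1 x) ->
  measurable_fun setT h2 -> (forall x, 0 <= h2 x) ->
  \int[mu]_(y in Q) (h1 y * cell_int h2 y) =
  \int[mu]_(y in Q) (h2 y * cell_int h1 y).
Proof.
have aux h h' : measurable_fun setT h -> (forall x, 0 <= h x) ->
    measurable_fun setT h' -> (forall x, 0 <= h' x) ->
    \int[mu]_(y in Q) (h y * cell_int h' y) =
    \int[mu]_y \int[mu]_x ((\1_E (y, x))%:E * (h y * h' x)).
  move=> mh h0 mh' h'0; rewrite [LHS]integral_mkcond; apply: eq_integral => y _.
  rewrite /patch; case: ifPn => yQ.
    rewrite cell_intE -ge0_integralZl//.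
    - by apply: eq_integral => x _; rewrite muleCA.
    - exact: (measurable_fun_pair2 _ (mK mh')).
    - by move=> x _; rewrite mule_ge0 ?lee_fin.
  rewrite integral0_eq// => x _; rewrite indicE memNset ?mul0e//.
  by move=> /E_dom; move: yQ; rewrite notin_setE.
move=> mh1 h10 mh2 h20; rewrite (aux _ _ mh1 h10 mh2 h20) (aux _ _ mh2 h20 mh1 h10).
pose F (z : T * T) := (\1_E z)%:E * (h1 z.1 * h2 z.2).
have F0 z : 0 <= F z by rewrite !mule_ge0 ?lee_fin.
have mF : measurable_fun setT F.
  apply: emeasurable_funM; first exact/measurable_EFinP.
  by apply: emeasurable_funM; exact: measurableT_comp.
rewrite (fubini_tonelli F mF F0).
apply: eq_integral => x _; apply: eq_integral => y _; rewrite /F/= [h1 _ * _]muleC !indicE.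
congr ((_ : bool)%:R%:E * _); apply/idP/idP => /set_mem/E_sym; exact: mem_set.
Qed.

Lemma cell_intM (b : T -> R) (h : T -> \bar R) y :
  (forall x x', E (x, x') -> b x = b x') -> (forall x, (0 <= b x)%R) ->
  measurable_fun setT h -> (forall x, 0 <= h x) ->
  cell_int (fun x => (b x)%:E * h x) y = (b y)%:E * cell_int h y.
Proof.
move=> b_inv b0 mh h0; rewrite /cell_int -ge0_integralZl ?lee_fin//.
- by apply: eq_integral => x /set_mem yx; rewrite (b_inv y x).
- exact: measurable_cell.
- exact: measurable_funTS.
Qed.

End cell_integral.

(** * Doob's maximal inequality and Jensen's inequality for weighted averages *)

Section doob.
Context d (T : measurableType d) (R : realType).
Variable mu : {sigma_finite_measure set T -> \bar R}.
Variables (Q : set T) (E : nat -> set (T * T)).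
Hypothesis mQ : measurable Q.
Hypothesis mE : forall k, measurable (E k).
Hypothesis E_sym : forall k x y, E k (x, y) -> E k (y, x).
Hypothesis E_trans : forall k x y z, E k (x, y) -> E k (y, z) -> E k (x, z).
Hypothesis E_dom : forall k x y, E k (x, y) -> Q x.
Hypothesis E_sub : forall k, E k.+1 `<=` E k.
Variables (W g : T -> R) (B : R).
Hypothesis mW : measurable_fun setT W.
Hypothesis W0 : forall x, 0 <= W x.
Hypothesis mg : measurable_fun setT g.
Hypothesis g0 : forall x, 0 <= g x.
Hypothesis gB : forall x, Q x -> g x <= B.
Hypothesis W_fin : (\int[mu]_(x in Q) (W x)%:E < +oo)%E.
Hypothesis W_pos : forall k x, Q x -> (0 < cell_int mu (E k) (EFin \o W) x)%E.

Definition cell_mass k y : R := fine (cell_int mu (E k) (EFin \o W) y).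
Definition cell_moment k y : R :=
  fine (cell_int mu (E k) (fun x => (g x * W x)%:E) y).
Definition cell_avg k y : R := cell_moment k y / cell_mass k y.
(** The dyadic maximal function truncated at level [k]: a finite maximum, constant on the cells of
    level [k]. The estimates for it are uniform in [k]. *)
Fixpoint max_avg k y : R :=
  if k is k'.+1 then Num.max (max_avg k' y) (cell_avg k y) else cell_avg 0 y.

Let mgW : measurable_fun setT (fun x => (g x * W x)%:E).
Proof. by apply/measurable_EFinP; exact: measurable_funM. Qed.

Let gW0 x : (0 <= (g x * W x)%:E)%E.
Proof. by rewrite lee_fin mulr_ge0. Qed.

Let mEW : measurable_fun setT (EFin \o W).
Proof. exact/measurable_EFinP. Qed.

Let EW0 x : (0 <= (EFin \o W) x)%E.
Proof. by rewrite lee_fin. Qed.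

Lemma cell_massE k y :
  (cell_mass k y)%:E = cell_int mu (E k) (EFin \o W) y.
Proof.
rewrite fineK// ge0_fin_numE ?cell_int_ge0//.
apply: le_lt_trans W_fin; apply: ge0_subset_integral => //.
- exact: measurable_cell.
- exact: measurable_funTS.
- exact: (cell_sub (E_sym (k := k)) (E_dom (k := k))).
Qed.

Let B0 y : Q y -> 0 <= B.
Proof. by move=> Qy; exact: le_trans (g0 y) (gB Qy). Qed.

Let cell_subQ k y : cell (E k) y `<=` Q.
Proof. exact: (cell_sub (E_sym (k := k)) (E_dom (k := k))). Qed.

Let moment_le k y : Q y -> (cell_int mu (E k) (fun x => (g x * W x)%:E) y <=
  (B * cell_mass k y)%:E)%E.
Proof.
move=> Qy; rewrite EFinM cell_massE /cell_int -ge0_integralZl ?lee_fin ?(B0 Qy)//.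
- apply: le_integral_nneg => // x xy; rewrite -EFinM lee_fin ler_wpM2r// gB//.
  exact: cell_subQ xy.
- exact: measurable_cell.
- exact: measurable_funTS.
Qed.

Lemma cell_momentE k y : Q y ->
  (cell_moment k y)%:E = cell_int mu (E k) (fun x => (g x * W x)%:E) y.
Proof.
move=> Qy; rewrite fineK// ge0_fin_numE ?cell_int_ge0//.
by apply: le_lt_trans (moment_le k Qy) _; rewrite ltry.
Qed.

Lemma cell_mass_gt0 k y : Q y -> 0 < cell_mass k y.
Proof. by move=> Qy; rewrite -lte_fin cell_massE; exact: W_pos. Qed.

Lemma cell_mass_ge0 k y : 0 <= cell_mass k y.
Proof. by rewrite -lee_fin cell_massE; exact: cell_int_ge0. Qed.

Lemma cell_moment_ge0 k y : 0 <= cell_moment k y.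
Proof. by rewrite fine_ge0// cell_int_ge0. Qed.

Lemma cell_avg_ge0 k y : 0 <= cell_avg k y.
Proof. by rewrite divr_ge0// ?cell_moment_ge0// cell_mass_ge0. Qed.

Lemma max_avg_ge0 k y : 0 <= max_avg k y.
Proof. by elim: k => [|k ih] /=; rewrite ?le_max ?cell_avg_ge0 ?ih. Qed.

Lemma cell_avg_le k y : Q y -> cell_avg k y <= B.
Proof.
move=> Qy; rewrite ler_pdivrMr ?cell_mass_gt0// -lee_fin cell_momentE//.
exact: moment_le.
Qed.

Lemma max_avg_le k y : Q y -> max_avg k y <= B.
Proof. by move=> Qy; elim: k => [|k ih] /=; rewrite ?ge_max ?cell_avg_le ?ih. Qed.

Lemma cell_avg_le_max j k y : (j <= k)%N -> cell_avg j y <= max_avg k y.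
Proof.
elim: k => [|k ih]; first by rewrite leqn0 => /eqP ->.
by rewrite leq_eqVlt ltnS le_max => /predU1P[->|/ih ->//]; rewrite lexx orbT.
Qed.

Lemma cell_avg_inv k x y : E k (x, y) -> cell_avg k x = cell_avg k y.
Proof.
move=> xy; rewrite /cell_avg /cell_moment /cell_mass.
by rewrite !(cell_int_inv _ (E_sym (k := k)) (E_trans (k := k)) _ xy).
Qed.

Lemma max_avg_inv k x y : E k (x, y) -> max_avg k x = max_avg k y.
Proof.
elim: k => [|k ih] xy /=; first exact: cell_avg_inv.
by rewrite (cell_avg_inv xy) ih//; exact: E_sub.
Qed.

Lemma measurable_cell_avg k : measurable_fun setT (cell_avg k).
Proof.
apply: measurable_funM; first by apply: measurableT_comp => //; exact: measurable_cell_int.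
have -> : (fun y => (cell_mass k y)^-1) = (@powR R ^~ (-1)) \o cell_mass k.
  by apply/funext => y /=; rewrite powR_inv1 ?cell_mass_ge0.
apply: measurableT_comp => //.
by apply: measurableT_comp => //; exact: measurable_cell_int.
Qed.

Lemma measurable_max_avg k : measurable_fun setT (max_avg k).
Proof.
elim: k => [|k ih] /=; first exact: measurable_cell_avg.
by apply: measurable_maxr => //; exact: measurable_cell_avg.
Qed.

Local Open Scope ereal_scope.

(** Averaging is self-adjoint for the measure with density [W], so it can be moved from [g] to [b],
    which it leaves unchanged because [b] is constant on the cells. *)
Lemma integral_cell_avg k (b : T -> R) : measurable_fun setT b ->
  (forall x, (0 <= b x)%R) -> (forall x y, E k (x, y) -> b x = b y) ->
  \int[mu]_(x in Q) (b x * cell_avg k x * W x)%:E =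
  \int[mu]_(x in Q) (b x * g x * W x)%:E.
Proof.
move=> mb b0 b_inv.
have c0 x : (0 <= b x / cell_mass k x)%R by rewrite divr_ge0 ?cell_mass_ge0.
have mc : measurable_fun setT (fun x => b x / cell_mass k x)%R.
  apply: measurable_funM => //.
  have -> : (fun y => (cell_mass k y)^-1)%R = (@powR R ^~ (-1)%R) \o cell_mass k.
    by apply/funext => y /=; rewrite powR_inv1 ?cell_mass_ge0.
  apply: measurableT_comp => //.
  by apply: measurableT_comp => //; exact: measurable_cell_int.
have c_inv x y : E k (x, y) -> (b x / cell_mass k x = b y / cell_mass k y)%R.
  move=> xy; rewrite (b_inv _ _ xy); congr (_ / fine _)%R.
  exact: (cell_int_inv _ (E_sym (k := k)) (E_trans (k := k)) _ xy).
transitivity (\int[mu]_(x in Q) ((b x / cell_mass k x * W x)%:E *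
    cell_int mu (E k) (fun x => (g x * W x)%:E) x)).
  apply: eq_integral => x /set_mem Qx; rewrite -cell_momentE// -EFinM; congr EFin.
  by rewrite /cell_avg; ring.
rewrite (cell_int_sym mu (mE k) (E_sym (k := k)) (E_dom (k := k)))//; last 2 first.
- by apply/measurable_EFinP; exact: measurable_funM.
- by move=> x; rewrite lee_fin mulr_ge0.
apply: eq_integral => x /set_mem Qx.
under [X in _ * cell_int _ _ X _]eq_fun do rewrite EFinM.
rewrite (@cell_intM _ _ _ mu (E k) (mE k) (fun x => b x / cell_mass k x)%R)//.
rewrite -cell_massE -!EFinM; congr EFin.
by rewrite divfK ?gt_eqF ?cell_mass_gt0//; ring.
Qed.

Section exponents.
Variables c q : R.
Hypotheses (c0 : (0 < c)%R) (q0 : (0 < q)%R) (cq : (c^-1 + q^-1 = 1)%R).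

Let mM k t : measurable_fun setT (fun x => max_avg k x `^ t)%R.
Proof. exact: (measurableT_comp (@measurable_powR R t) (measurable_max_avg k)). Qed.

Let intZ r (h : T -> R) : (0 <= r)%R -> measurable_fun setT h -> (forall x, 0 <= h x)%R ->
  r%:E * \int[mu]_(x in Q) (h x)%:E = \int[mu]_(x in Q) (r * h x)%:E.
Proof.
move=> r0 mh h0; rewrite [RHS](eq_integral (fun x => r%:E * (h x)%:E)).
  have mhQ : measurable_fun Q (EFin \o h).
    by apply: measurable_funTS; exact/measurable_EFinP.
  by rewrite (ge0_integralZl mu mQ mhQ) ?lee_fin// => x _; rewrite lee_fin.
by move=> x _; rewrite EFinM.
Qed.

Let intD (h1 h2 : T -> R) : measurable_fun setT h1 -> measurable_fun setT h2 ->
  (forall x, 0 <= h1 x)%R -> (forall x, 0 <= h2 x)%R ->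
  \int[mu]_(x in Q) (h1 x)%:E + \int[mu]_(x in Q) (h2 x)%:E =
  \int[mu]_(x in Q) (h1 x + h2 x)%:E.
Proof.
move=> mh1 mh2 h10 h20; rewrite [RHS](eq_integral (fun x => (h1 x)%:E + (h2 x)%:E)).
  rewrite ge0_integralD//.
  - by move=> x _; rewrite lee_fin.
  - by apply: measurable_funTS; exact/measurable_EFinP.
  - by move=> x _; rewrite lee_fin.
  - by apply: measurable_funTS; exact/measurable_EFinP.
by move=> x _; rewrite EFinD.
Qed.

Let int_fin (h : T -> R) K : (forall x, 0 <= h x)%R -> (0 <= K)%R ->
  (forall x, Q x -> h x <= K)%R -> \int[mu]_(x in Q) (h x * W x)%:E < +oo.
Proof.
move=> h0 K0 hK; apply: (@le_lt_trans _ _ (K%:E * \int[mu]_(x in Q) (W x)%:E)).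
  rewrite -ge0_integralZl//; last 2 first.
  - exact: measurable_funTS.
  - by move=> x _; rewrite lee_fin.
  apply: le_integral_nneg => x Qx; first by rewrite lee_fin mulr_ge0.
  by rewrite -EFinM lee_fin ler_wpM2r// hK.
by rewrite lte_mul_pinfty ?lee_fin.
Qed.

(* Induction on the number of levels: [max_powR_step] compares the maximal
   functions of [k] and [k + 1] levels pointwise, and the previous maximal
   function is constant on the new cells, so the average integrates to [g]. *)
Lemma max_avg_doob k :
  \int[mu]_(x in Q) (max_avg k x `^ c * W x)%:E <=
  q%:E * \int[mu]_(x in Q) (max_avg k x `^ (c - 1) * g x * W x)%:E.
Proof.
have q1 : (1 < q)%R by apply: (conjugate_gt1 q0 c0); rewrite addrC.
elim: k => [|k ih].
  have powR0 x : (0 <= max_avg 0 x `^ (c - 1))%R by exact: powR_ge0.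
  have pow_inv x y : E 0%N (x, y) -> (max_avg 0 x `^ (c - 1) = max_avg 0 y `^ (c - 1))%R.
    by move=> xy; rewrite (max_avg_inv xy).
  rewrite -(integral_cell_avg (mM 0 (c - 1)%R) powR0 pow_inv).
  have -> : \int[mu]_(x in Q) (max_avg 0 x `^ c * W x)%:E =
      \int[mu]_(x in Q) (max_avg 0 x `^ (c - 1) * cell_avg 0 x * W x)%:E.
    apply: eq_integral => x _; rewrite [(_ * cell_avg _ _)%R]mulrC mulr_powRB1//.
    exact: cell_avg_ge0.
  rewrite -[leLHS]mul1e lee_wpmul2r ?lee_fin ?(ltW q1)//.
  by apply: integral_ge0 => x _; rewrite lee_fin mulr_ge0// mulr_ge0 ?powR_ge0 ?cell_avg_ge0.
pose a j l x := (max_avg j x `^ (c - 1) * cell_avg l x * W x)%R.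
pose A j l := \int[mu]_(x in Q) (a j l x)%:E.
have ma j l : measurable_fun setT (a j l).
  apply: measurable_funM => //; apply: measurable_funM; first exact: mM.
  exact: measurable_cell_avg.
have mm j : measurable_fun setT (fun x => max_avg j x `^ c * W x)%R.
  by apply: measurable_funM => //; exact: mM.
have mm0 j x : (0 <= max_avg j x `^ c * W x)%R by rewrite mulr_ge0// powR_ge0.
have A0 j l x : (0 <= a j l x)%R.
  by rewrite mulr_ge0// mulr_ge0 ?powR_ge0 ?cell_avg_ge0.
have Ak : A k k.+1 = \int[mu]_(x in Q) (max_avg k x `^ (c - 1) * g x * W x)%:E.
  apply: integral_cell_avg => // [x|x y xy]; first exact: powR_ge0.
  by rewrite (@max_avg_inv k x y)//; exact: E_sub.
have AS : A k.+1 k.+1 = \int[mu]_(x in Q) (max_avg k.+1 x `^ (c - 1) * g x * W x)%:E.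
  apply: integral_cell_avg => // [x|x y xy]; first exact: powR_ge0.
  by rewrite (@max_avg_inv k.+1 x y).
rewrite -AS.
(* This term is added to both sides and later cancelled, which is legitimate only for a finite
   value; the bound [B] on [g] provides it. *)
have Afin : q%:E * A k k.+1 \is a fin_num.
  rewrite ge0_fin_numE; last first.
    by apply: mule_ge0; [rewrite lee_fin ltW|apply: integral_ge0 => x _; rewrite lee_fin].
  rewrite lte_mul_pinfty ?lee_fin ?(ltW q0)//.
  have [[y Qy]|nQ] := pselect (exists y, Q y); last first.
    by rewrite /A integral0_eq ?ltry// => x Qx; exfalso; apply: nQ; exists x.
  apply: (@int_fin (fun x => max_avg k x `^ (c - 1) * cell_avg k.+1 x)%R (B `^ (c - 1) * B)%R).
  - by move=> x; rewrite mulr_ge0 ?powR_ge0 ?cell_avg_ge0.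
  - by rewrite mulr_ge0 ?powR_ge0 ?(B0 Qy).
  - move=> x Qx; rewrite ler_pM ?powR_ge0 ?cell_avg_ge0 ?cell_avg_le//.
    rewrite ge0_ler_powR ?nnegrE ?max_avg_ge0 ?(B0 Qy) ?max_avg_le//.
    by rewrite subr_ge0 ltW// (conjugate_gt1 c0 q0).
rewrite -(leeD2rE _ _ Afin).
apply: (@le_trans _ _ (\int[mu]_(x in Q) (max_avg k x `^ c * W x)%:E + q%:E * A k.+1 k.+1)); last first.
  by rewrite addeC leeD2l// Ak.
have qa0 j l x : (0 <= q * a j l x)%R by apply: mulr_ge0; [exact: ltW|exact: A0].
have mqa j l : measurable_fun setT (fun x => q * a j l x)%R by exact: measurable_funM.
have qA j l : q%:E * A j l = \int[mu]_(x in Q) (q * a j l x)%:E.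
  exact: (intZ (ltW q0) (ma j l) (A0 j l)).
rewrite (qA k k.+1) (qA k.+1 k.+1).
rewrite [leLHS](intD (mm k.+1) (mqa k k.+1) (mm0 k.+1) (qa0 k k.+1)).
rewrite [leRHS](intD (mm k) (mqa k.+1 k.+1) (mm0 k) (qa0 k.+1 k.+1)).
apply: le_integral_nneg => x Qx; rewrite lee_fin; first exact: addr_ge0.
rewrite /a.
have := max_powR_step c0 q0 cq (max_avg_ge0 k x) (cell_avg_ge0 k.+1 x).
by move=> /(ler_wpM2r (W0 x)); rewrite !mulrDl !mulrA.
Qed.

(** [young_half] turns [max_avg_doob] into a bound by the integral of [g^c] plus half of the
    left-hand side. Absorbing that half needs the left-hand side finite, which follows from [gB] and
    [W_fin]; the constant involves neither [B] nor [k]. *)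
Lemma max_avg_maximal k :
  \int[mu]_(x in Q) (max_avg k x `^ c * W x)%:E <=
  (2 * (2 * q) `^ c)%:E * \int[mu]_(x in Q) (g x `^ c * W x)%:E.
Proof.
have q1 : (1 < q)%R by apply: (conjugate_gt1 q0 c0); rewrite addrC.
have c1 := conjugate_gt1 c0 q0 cq.
have mgW' (h : T -> R) : measurable_fun setT h -> measurable_fun setT (fun x => (h x * W x)%:E).
  by move=> mh; apply/measurable_EFinP; exact: measurable_funM.
have mgc : measurable_fun setT (fun x => g x `^ c)%R by exact: (measurableT_comp (@measurable_powR R c) mg).
set I := \int[mu]_(x in Q) (max_avg k x `^ c * W x)%:E; set J := \int[mu]_(x in Q) (g x `^ c * W x)%:E.
have Ifin : I \is a fin_num.
  rewrite ge0_fin_numE; last by apply: integral_ge0 => x _; rewrite lee_fin mulr_ge0 ?powR_ge0.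
  have [[y Qy]|nQ] := pselect (exists y, Q y); last first.
    by rewrite /I integral0_eq ?ltry// => x Qx; exfalso; apply: nQ; exists x.
  apply: (@int_fin (fun x => max_avg k x `^ c)%R (B `^ c)%R) => [x||x Qx]; rewrite ?powR_ge0//.
  by rewrite ge0_ler_powR ?nnegrE ?max_avg_ge0 ?(B0 Qy) ?max_avg_le ?(ltW c0).
have : I <= ((2 * q) `^ c)%:E * J + (2^-1)%:E * I.
  apply: (le_trans (max_avg_doob k)).
  rewrite /I /J -!ge0_integralZl ?lee_fin ?(ltW q0) ?powR_ge0//; last 6 first.
  - by apply: measurable_funTS; exact: mgW'.
  - by move=> x _; rewrite lee_fin !mulr_ge0 ?powR_ge0.
  - by apply: measurable_funTS; exact: mgW'.
  - by move=> x _; rewrite lee_fin !mulr_ge0 ?powR_ge0.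
  - apply: measurable_funTS; exact: (mgW' _ (measurable_funM (mM k (c - 1)%R) mg)).
  - by move=> x _; rewrite lee_fin !mulr_ge0 ?powR_ge0.
  rewrite -ge0_integralD//; last 4 first.
  - by move=> x _; rewrite mule_ge0 ?lee_fin ?mulr_ge0 ?powR_ge0.
  - by apply: measurable_funTS; apply: measurable_funeM; exact: mgW'.
  - by move=> x _; rewrite mule_ge0 ?lee_fin ?mulr_ge0 ?powR_ge0.
  - by apply: measurable_funTS; apply: measurable_funeM; exact: mgW'.
  apply: le_integral_nneg => x Qx; rewrite -!EFinM -?EFinD lee_fin.
    by rewrite !mulr_ge0 ?powR_ge0 ?(ltW q0).
  have := young_half c0 q0 cq (g0 x) (max_avg_ge0 k x).
  by move=> /(ler_wpM2r (W0 x)); rewrite mulrDl -!mulrA [(g x * (_ * _))%R]mulrCA.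
apply: absorb_half Ifin => //; first by rewrite powR_gt0// mulr_gt0.
by apply: integral_ge0 => x _; rewrite lee_fin mulr_ge0 ?powR_ge0.
Qed.

(** Jensen's inequality by the tangent line at the average [s]: integrate [young_powR], with
    [y = s], over the cell against [W]. The left side becomes [q s^c] times the mass, and [s^c]
    times the mass cancels from both sides. *)
Lemma cell_avg_jensen k y : Q y ->
  ((cell_mass k y * cell_avg k y `^ c)%:E <= \int[mu]_(x in Q) (g x `^ c * W x)%:E).
Proof.
move=> Qy.
have mgW' (h : T -> R) : measurable_fun setT h -> measurable_fun setT (fun x => (h x * W x)%:E).
  by move=> mh; apply/measurable_EFinP; exact: measurable_funM.
have mgc : measurable_fun setT (fun x => g x `^ c)%R by exact: (measurableT_comp (@measurable_powR R c) mg).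
have mcell := measurable_cell (mE k) y.
set s := cell_avg k y; have s0 : (0 <= s)%R := cell_avg_ge0 k y.
have q1 : (1 < q)%R by apply: (conjugate_gt1 q0 c0); rewrite addrC.
have key : (q * s `^ (c - 1))%:E * cell_int mu (E k) (fun x => (g x * W x)%:E) y <=
    (q - 1)%:E * cell_int mu (E k) (fun x => (g x `^ c * W x)%:E) y +
    (s `^ c)%:E * cell_int mu (E k) (EFin \o W) y.
  rewrite /cell_int -!ge0_integralZl ?lee_fin ?mulr_ge0 ?powR_ge0 ?(ltW q0) ?subr_ge0 ?(ltW q1)//; last 3 first.
  - by apply: measurable_funTS; exact: mgW'.
  - by move=> x _; rewrite lee_fin !mulr_ge0 ?powR_ge0.
  - exact: measurable_funTS.
  rewrite -ge0_integralD//; last 4 first.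
  - by move=> x _; rewrite mule_ge0 ?lee_fin ?mulr_ge0 ?powR_ge0 ?subr_ge0 ?(ltW q1).
  - by apply: measurable_funTS; apply: measurable_funeM; exact: mgW'.
  - by move=> x _; rewrite mule_ge0 ?lee_fin ?mulr_ge0 ?powR_ge0.
  - by apply: measurable_funTS; apply: measurable_funeM.
  apply: le_integral_nneg => x _; rewrite -!EFinM -?EFinD lee_fin.
    by rewrite !mulr_ge0 ?powR_ge0 ?(ltW q0).
  have := young_powR c0 q0 cq (g0 x) s0.
  by move=> /(ler_wpM2r (W0 x)); rewrite mulrDl !mulrA [(q * _ * g x)%R]mulrAC.
  exact: measurable_funTS.
have sub : cell_int mu (E k) (fun x => (g x `^ c * W x)%:E) y <=
    \int[mu]_(x in Q) (g x `^ c * W x)%:E.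
  apply: ge0_subset_integral => //; first by apply: measurable_funTS; exact: mgW'.
  by move=> x _; rewrite lee_fin !mulr_ge0 ?powR_ge0.
apply: (le_trans _ sub); move: key.
have [|] := eqVneq (cell_int mu (E k) (fun x => (g x `^ c * W x)%:E) y) +oo.
  by move=> -> _; rewrite leey.
rewrite -ltey => Jlt.
have Jfin : cell_int mu (E k) (fun x => (g x `^ c * W x)%:E) y \is a fin_num.
  rewrite ge0_fin_numE//; apply: cell_int_ge0 => x; by rewrite lee_fin mulr_ge0 ?powR_ge0.
rewrite -cell_massE -cell_momentE// -(fineK Jfin) -!EFinM -EFinD !lee_fin.
have -> : cell_moment k y = (s * cell_mass k y)%R.
  by rewrite /s /cell_avg divfK// gt_eqF// cell_mass_gt0.
have -> : (q * s `^ (c - 1) * (s * cell_mass k y) = q * (s `^ c * cell_mass k y))%R.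
  by rewrite -(mulr_powRB1 s0 c0); ring.
rewrite [(cell_mass k y * _)%R]mulrC => h.
have q10 : (0 < q - 1)%R by rewrite subr_gt0.
rewrite -(ler_pM2l q10); lra.
Qed.

End exponents.

End doob.

(** * Summation over the scales *)

Section two_sided_sum.
Context {R : realType}.
Implicit Types (a b x : R).

Lemma powR_gt1 a x : 0 < a -> 1 < x -> 1 < x `^ a.
Proof.
move=> a0 x1; have := @gt0_ltr_powR R a a0 1 x; rewrite powR1; apply; rewrite ?nnegrE//.
by rewrite (le_trans ler01) ?ltW.
Qed.

(** For [a, b > 0] this is [x^a] up to [1] and [x^(-b)] beyond, so along [x / 2^k] it decays
    geometrically on both sides of [1]. *)
Definition peak a b x : R := Num.min (x `^ a) (x `^ (- b)).

Lemma sum_peak_le1 a x K : 0 < a -> 0 < x ->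
  \sum_(k < K) (x / 2 ^+ k) `^ a <= (1 - 2 `^ (- a))^-1 * x `^ a.
Proof.
move=> a0; have two_a : 2 `^ (- a) < 1 :> R.
  by rewrite powRN invf_lt1 ?powR_gt0// powR_gt1 ?ltr1n.
have c0 : 0 <= (1 - 2 `^ (- a))^-1 :> R by rewrite invr_ge0 subr_ge0 ltW.
elim: K x => [|K ih] x x0; first by rewrite big_ord0 mulr_ge0 ?powR_ge0.
rewrite big_ord_recl/= expr0 divr1.
have x20 : 0 < x / 2 by rewrite divr_gt0.
under eq_bigr do rewrite exprS invfM mulrA.
have := ih _ x20.
move=> /(lerD (lexx (x `^ a))) /le_trans; apply.
rewrite powRM ?invr_ge0 ?(ltW x0)// -(powR_inv1 (ler0n _ 2)) -powRrM mulN1r.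
set z := 2 `^ (- a) in two_a c0 *.
have z1 : 1 - z != 0 by rewrite subr_eq0 gt_eqF.
rewrite le_eqVlt; apply/orP; left; apply/eqP; field.
by [].
Qed.

Lemma sum_peak a b : 0 < a -> 0 < b ->
  exists C, 0 <= C /\ forall x K, 0 < x ->
    \sum_(k < K) peak a b (x / 2 ^+ k) <= C.
Proof.
move=> a0 b0; pose Ca : R := (1 - 2 `^ (- a))^-1; pose D : R := (2 `^ b - 1)^-1.
have two_a : 2 `^ (- a) < 1 :> R.
  by rewrite powRN invf_lt1 ?powR_gt0// powR_gt1 ?ltr1n.
have two_b : 1 < 2 `^ b :> R by rewrite powR_gt1 ?ltr1n.
have Ca0 : 0 <= Ca by rewrite invr_ge0 subr_ge0 ltW.
have D0 : 0 <= D by rewrite invr_ge0 subr_ge0 ltW.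
have small x K : 0 < x -> x <= 1 -> \sum_(k < K) peak a b (x / 2 ^+ k) <= Ca.
  move=> x0 x1; apply: (@le_trans _ _ (\sum_(k < K) (x / 2 ^+ k) `^ a)).
    by apply: ler_sum => k _; rewrite ge_min lexx.
  apply: (le_trans (sum_peak_le1 K a0 x0)).
  by rewrite -[leRHS]mulr1 ler_wpM2l// -[leRHS](congr1 (@^~ a) (powR1 R)) ge0_ler_powR ?nnegrE ?(ltW a0) ?(ltW x0).
(* By the choice of [D], the budget [D * (1 - x^(-b))] exceeds that of [x / 2] by exactly [x^(-b)].
   The summand [1] pays for the single term in []1, 2]], after which [small] applies. *)
have big x K : 1 < x -> \sum_(k < K) peak a b (x / 2 ^+ k) <= Ca + 1 + D * (1 - x `^ (- b)).
  elim: K x => [|K ih] x x1.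
    have xb1 : x `^ (- b) <= 1.
      by rewrite powRN invf_le1 ?powR_gt0 ?(lt_trans ltr01)// ltW// powR_gt1.
    by rewrite big_ord0 !addr_ge0// mulr_ge0// subr_ge0.
  have x0 : 0 < x by exact: lt_trans x1.
  have xb1 : x `^ (- b) < 1 by rewrite powRN invf_lt1 ?powR_gt0// powR_gt1.
  rewrite big_ord_recl/= expr0 divr1.
  under eq_bigr do rewrite exprS invfM mulrA.
  have px : peak a b x <= x `^ (- b) by rewrite ge_min lexx orbT.
  have [x2|x2] := leP x 2.
    have hx : x / 2 <= 1 by rewrite ler_pdivrMr// mul1r.
    have hx0 : 0 < x / 2 by rewrite divr_gt0.
    have := small _ K hx0 hx.
    have : 0 <= D * (1 - x `^ (- b)) by rewrite mulr_ge0// subr_ge0 ltW.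
    by move=> h1 h2; lra.
  have hx : 1 < x / 2 by rewrite ltr_pdivlMr// mul1r.
  have := ih _ hx.
  rewrite powRM ?invr_ge0 ?(ltW x0)// -(powR_inv1 (ler0n _ 2)) -powRrM mulN1r opprK.
  have DE : D * (2 `^ b - 1) = 1 by rewrite mulVf// subr_eq0 gt_eqF.
  set z := 2 `^ b in DE *; set y := x `^ (- b) in px *.
  move=> h; have : D * (1 - y * z) + y = D * (1 - y).
    by rewrite -[X in _ + X]mulr1 -DE; ring.
  by move=> h2; lra.
exists (Ca + 1 + D); split; first by rewrite !addr_ge0.
move=> x K x0; have [x1|x1] := leP x 1.
  by apply: le_trans (small _ _ x0 x1) _; rewrite -addrA lerDl addr_ge0.
apply: le_trans (big _ _ x1) _; rewrite lerD2l ler_piMr//.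
by rewrite gerBl powR_ge0.
Qed.

End two_sided_sum.

(* With [w] the weight of a cell, [s] the average of [g] on it and [m], [N]
   bounding [s] from above through the maximal function and through Jensen,
   interpolation with parameter [c / p'] gives the exponent [1/q + 1/p']. *)
Lemma interpolate_avg (R : realType) (c p' q w s m N : R) :
  0 < c -> 0 < q -> c <= p' -> c^-1 + q^-1 = 1 ->
  0 < w -> 0 <= s -> s <= m -> 0 <= N -> w * s `^ c <= N `^ c ->
  w * s <= w `^ (q^-1 + p'^-1) * m `^ (c / p') * N `^ (1 - c / p').
Proof.
move=> c0 q0 cp cq w0 s0 sm N0 wsN.
have p'0 : 0 < p' by exact: lt_le_trans cp.
have [->|sn0] := eqVneq s 0; first by rewrite mulr0 !mulr_ge0 ?powR_ge0.
have s_gt0 : 0 < s by rewrite lt_neqAle eq_sym sn0.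
set th := c / p'.
have th0 : 0 <= th by rewrite divr_ge0 ?ltW.
have th1 : 0 <= 1 - th by rewrite subr_ge0 ler_pdivrMr// mul1r.
have sN : s <= N * w `^ (- c^-1).
  rewrite -(ler_pM2l (powR_gt0 (c^-1) w0)) mulrCA -powRD; last first.
    by rewrite (gt_eqF w0) implybT.
  rewrite subrr powRr0 mulr1.
  have := @ge0_ler_powR R (c^-1) _ (w * s `^ c) (N `^ c) _ _ wsN.
  rewrite invr_ge0 (ltW c0) !nnegrE mulr_ge0 ?powR_ge0 ?(ltW w0)// => /(_ isT isT isT).
  by rewrite powRM ?powR_ge0 ?(ltW w0)// -!powRrM divff ?gt_eqF// !powRr1.
have -> : w * s = w * s `^ th * s `^ (1 - th).
  rewrite -mulrA -powRD ?(gt_eqF s_gt0) ?implybT//.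
  by rewrite addrC subrK powRr1.
have -> : w `^ (q^-1 + p'^-1) = w * w `^ (- c^-1 * (1 - th)).
  rewrite -[X in X * _](powRr1 (ltW w0)) -powRD ?(gt_eqF w0) ?implybT//.
  congr (_ `^ _); rewrite /th -cq; have -> : q^-1 = 1 - c^-1 by rewrite -cq; ring.
  by field; rewrite !gt_eqF.
have h1 : s `^ th <= m `^ th.
  by rewrite ge0_ler_powR ?nnegrE// (le_trans s0).
have h2 : s `^ (1 - th) <= N `^ (1 - th) * w `^ (- c^-1 * (1 - th)).
  rewrite powRrM -powRM ?powR_ge0// ge0_ler_powR ?nnegrE//.
  by rewrite mulr_ge0 ?powR_ge0.
apply: (@le_trans _ _ (w * (m `^ th * (N `^ (1 - th) * w `^ (- c^-1 * (1 - th)))))).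
  by rewrite -mulrA ler_wpM2l ?(ltW w0)// ler_pM ?powR_ge0.
by rewrite le_eqVlt; apply/orP; left; apply/eqP; ring.
Qed.

(** * The sum over the scales, and the optimization over [lam] *)

Section kernel_bound.
Context {R : realType}.
Variables (n p q p' c s : R).
Hypotheses (p1 : 1 < p) (pq : p <= q) (pp' : p^-1 + p'^-1 = 1)
  (cq : c^-1 + q^-1 = 1) (p'0 : 0 < p') (c0 : 0 < c) (pn : p < n).
Hypothesis sE : s = - n + q / p * (n - p).

Let p0 : 0 < p. Proof. exact: lt_trans p1. Qed.
Let q0 : 0 < q. Proof. exact: lt_le_trans pq. Qed.
Let n0 : 0 < n. Proof. exact: lt_trans pn. Qed.
Let cp' : c <= p'.
Proof.
rewrite -[c]invrK -[p']invrK lef_pV2 ?posrE ?invr_gt0//.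
have -> : p'^-1 = 1 - p^-1 by rewrite -pp'; ring.
have -> : c^-1 = 1 - q^-1 by rewrite -cq; ring.
by rewrite lerB// lef_pV2 ?posrE.
Qed.
Let p'E : p'^-1 = 1 - p^-1. Proof. by rewrite -pp'; ring. Qed.

(** In the application [w k] and [a k] are the mass of the cell of level [k] and the average of [g]
    on it, [d] is the distance to [E], [m] the maximal function, and [N^c = J]. The range of [k]
    includes [K], so that [0 <= m] follows even for [K = 0]. *)
Definition kernel_hyp (C0 l d m N : R) (w a : nat -> R) (K : nat) :=
  forall k, (k <= K)%N -> [/\ 0 < w k, 0 <= a k, a k <= m, w k * a k `^ c <= N `^ c &
    w k <= C0 * (l / 2 ^+ k) `^ n * Num.max (l / 2 ^+ k) d `^ s].

(** After interpolation the mass bound leaves, up to constants,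
    [l_k^(-s/q) * max(l_k, d)^(s/q + s/p')]. With [x = l_k / d] this is [d^(s/p')] times [x^(-s/q)]
    if [x <= 1] and times [x^(s/p')] if [x > 1]. As [s < 0], both powers decay away from [x = 1]. *)
Lemma kernel_bound_neg C0 : 0 <= C0 -> s < 0 ->
  exists C, 0 <= C /\ forall l d m N w a K, 0 < l -> 0 < d -> 0 <= N ->
    kernel_hyp C0 l d m N w a K ->
    \sum_(k < K) (l / 2 ^+ k) `^ (1 - n) * (w k * a k) <=
    C * (d `^ (s / p') * m `^ (c / p') * N `^ (1 - c / p')).
Proof.
move=> C00 s0.
have a0 : 0 < - s / q by rewrite divr_gt0// oppr_gt0.
have b0 : 0 < - s / p' by rewrite divr_gt0// oppr_gt0.
have [C [CC CE]] := sum_peak a0 b0.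
pose kap := q^-1 + p'^-1; have kap0 : 0 < kap by rewrite addr_gt0 ?invr_gt0.
exists (C0 `^ kap * C); split; first by rewrite mulr_ge0 ?powR_ge0.
move=> l d m N w a K l0 d0 N0 H.
have ld0 : 0 < l / d by rewrite divr_gt0.
have := CE _ K ld0 => /(ler_wpM2l (powR_ge0 C0 kap)).
set X := _ * _ * _ `^ _; have X0 : 0 <= X by rewrite !mulr_ge0 ?powR_ge0.
move=> /(ler_wpM2r X0); apply: le_trans.
rewrite mulr_sumr mulr_suml; apply: ler_sum => k _.
have [w0 ak0 akm wak wk] := H k (ltnW (ltn_ord k)).
set lk := l / 2 ^+ k in wk *.
have lk0 : 0 < lk by rewrite divr_gt0// exprn_gt0.
have := interpolate_avg c0 q0 cp' cq w0 ak0 akm N0 wak.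
move=> /(ler_wpM2l (powR_ge0 lk (1 - n))) /le_trans; apply.
rewrite -/kap.
set M := Num.max lk d in wk *.
have M0 : 0 < M by rewrite lt_max lk0.
have wkap : w k `^ kap <= C0 `^ kap * (lk `^ (n * kap) * M `^ (s * kap)).
  have /le_trans : w k `^ kap <= (C0 * lk `^ n * M `^ s) `^ kap.
    by rewrite ge0_ler_powR ?nnegrE ?(ltW kap0) ?(ltW w0)// !mulr_ge0 ?powR_ge0.
  apply; rewrite (powRM _ (mulr_ge0 C00 (powR_ge0 _ _)) (powR_ge0 _ _)).
  by rewrite (powRM _ C00 (powR_ge0 _ _)) -!powRrM mulrA.
have lM : lk `^ (1 - n) * (lk `^ (n * kap) * M `^ (s * kap)) <=
    peak (- s / q) (- s / p') (l / d / 2 ^+ k) * d `^ (s / p').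
  have -> : l / d / 2 ^+ k = lk / d by rewrite /lk mulrAC.
  rewrite mulrA -powRD ?(gt_eqF lk0) ?implybT//.
  have -> : 1 - n + n * kap = - s / q.
    by rewrite sE /kap p'E; field; rewrite !gt_eqF.
  have skap : s * kap = s / q + s / p' by rewrite /kap; field; rewrite !gt_eqF.
  have xE : lk = (lk / d) * d by rewrite divfK ?gt_eqF.
  set x := lk / d in xE *; have x0 : 0 < x by rewrite divr_gt0.
  have dE e : d `^ e * d `^ (- e) = 1.
    by rewrite -powRD ?subrr ?powRr0// (gt_eqF d0) implybT.
  have [x1|x1] := leP x 1.
    have -> : M = d by rewrite /M xE; apply/max_idPr; rewrite ler_piMl ?(ltW d0).
    rewrite xE powRM ?(ltW x0) ?(ltW d0)// -mulrA -powRD ?(gt_eqF d0) ?implybT//.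
    have -> : - s / q + s * kap = s / p' by rewrite skap; ring.
    rewrite ler_wpM2r ?powR_ge0// le_min lexx/=.
    have h1 : x `^ (- s / q) <= 1.
      by rewrite -(powRr0 x) ger_powR ?x0 ?(ltW a0).
    have h2 : 1 <= x `^ (- (- s / p')).
      by rewrite -(powRr0 x) ger_powR ?x0// oppr_le0 ltW.
    exact: le_trans h1 h2.
  have -> : M = lk by rewrite /M; apply/max_idPl; rewrite xE ler_peMl ?(ltW d0) ?(ltW x1).
  rewrite -powRD ?(gt_eqF lk0) ?implybT//.
  have -> : - s / q + s * kap = s / p' by rewrite skap; ring.
  rewrite xE powRM ?(ltW x0) ?(ltW d0)// ler_wpM2r ?powR_ge0// le_min.
  rewrite [- s / p']mulNr opprK lexx andbT mulNr.
  have h1 : x `^ (s / p') <= 1.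
    by rewrite -(powRr0 x) ler_powR ?(ltW x1)// -oppr_ge0 -mulNr ltW.
  have h2 : 1 <= x `^ (- (s / q)).
    by rewrite -(powRr0 x) ler_powR ?(ltW x1)// -mulNr ltW.
  exact: le_trans h1 h2.
apply: (@le_trans _ _ (lk `^ (1 - n) * (C0 `^ kap * (lk `^ (n * kap) * M `^ (s * kap)) *
   m `^ (c / p') * N `^ (1 - c / p')))).
  by rewrite ler_wpM2l ?powR_ge0// ler_wpM2r ?powR_ge0// ler_wpM2r ?powR_ge0.
have := lM => /(ler_wpM2l (powR_ge0 C0 kap)).
have mN0 : 0 <= m `^ (c / p') * N `^ (1 - c / p') by rewrite mulr_ge0 ?powR_ge0.
move=> /(ler_wpM2r mN0); rewrite /X.
set P := peak _ _ _; set L1 := lk `^ (1 - n); set L2 := lk `^ (n * kap).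
set M1 := M `^ _; set m1 := m `^ _; set N1 := N `^ _; set d1 := d `^ _; set C1 := C0 `^ _.
have -> : C1 * (L1 * (L2 * M1)) * (m1 * N1) = L1 * (C1 * (L2 * M1) * m1 * N1) by ring.
by have -> : C1 * (P * d1) * (m1 * N1) = C1 * P * (d1 * m1 * N1) by ring.
Qed.

(* Here the weight singles out no scale; the series peaks at the scale [t]
   where the bounds [t * m] and [t `^ (- (n / p')) * N] of the terms meet. *)
Lemma kernel_bound_zero C0 : 1 <= C0 -> s = 0 ->
  exists C, 0 <= C /\ forall l d m N w a K, 0 < l -> 0 < d -> 0 <= N ->
    kernel_hyp C0 l d m N w a K ->
    \sum_(k < K) (l / 2 ^+ k) `^ (1 - n) * (w k * a k) <=
    C * (d `^ (s / p') * m `^ (c / p') * N `^ (1 - c / p')).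
Proof.
move=> C01 s0; have C00 : 0 <= C0 by exact: le_trans C01.
have b0 : 0 < n / p' by rewrite divr_gt0.
have [C [CC CE]] := sum_peak ltr01 b0.
exists (C0 * C); split; first by rewrite mulr_ge0.
move=> l d m N w a K l0 d0 N0 H.
rewrite s0 mul0r powRr0 mul1r.
have m_ge0 : 0 <= m by have [_ h1 h2 _ _] := H 0%N (leq0n _); exact: le_trans h1 h2.
have w_le k : (k <= K)%N -> w k <= C0 * (l / 2 ^+ k) `^ n.
  by move=> kK; have [_ _ _ _] := H k kK; rewrite s0 powRr0 mulr1.
(* If [m] or [N] vanishes, so do all the averages; the scale [t] below makes sense only when both
   are positive. *)
have [mN|] := boolP ((m == 0) || (N == 0)).
  rewrite big1; first by rewrite !mulr_ge0 ?powR_ge0.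
  move=> k _; have [w0 ak0 akm wak wk] := H k (ltnW (ltn_ord k)).
  suff -> : a k = 0 by rewrite !mulr0.
  case/orP: mN => /eqP mN; first by apply/le_anti; rewrite ak0 -mN akm.
  move: wak; rewrite mN [_ `^ c in leRHS]powR0 ?gt_eqF// pmulr_rle0// => h.
  have /eqP : a k `^ c = 0 by apply/le_anti; rewrite h powR_ge0.
  by rewrite powR_eq0 => /andP[/eqP].
rewrite negb_or => /andP[m0 N0'].
have m_gt0 : 0 < m by rewrite lt_neqAle eq_sym m0.
have N_gt0 : 0 < N by rewrite lt_neqAle eq_sym N0'.
have np0 : 0 < 1 + n / p' by rewrite addr_gt0.
pose e := (1 + n / p')^-1.
(* For [s = 0], [q] is the Sobolev exponent [n p / (n - p)], so that [1/c = 1/p' + 1/n]. *)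
have eE : 1 - c / p' = e.
  have qE : q^-1 = p^-1 - n^-1.
    have : q * (n - p) = n * p.
      move: sE; rewrite s0 => /(congr1 (fun z => p * z)); rewrite mulr0 mulrDr.
      have -> : p * (q / p * (n - p)) = q * (n - p) by field; rewrite gt_eqF.
      by move=> /eqP; rewrite mulrN eq_sym addrC subr_eq0 => /eqP ->; rewrite mulrC.
    move=> h; have -> : q = n * p / (n - p).
      by rewrite -h mulfK// subr_eq0 gt_eqF.
    by field; rewrite !gt_eqF ?subr_gt0.
  have cE : c^-1 = p'^-1 + n^-1.
    have -> : c^-1 = 1 - q^-1 by rewrite -cq; ring.
    by rewrite qE p'E; ring.
  have -> : c = (p'^-1 + n^-1)^-1 by rewrite -cE invrK.
  by rewrite /e; field; rewrite !gt_eqF// addr_gt0.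
pose t := (N / m) `^ e; have t0 : 0 < t by rewrite powR_gt0// divr_gt0.
have X1 : t * m = m `^ (c / p') * N `^ (1 - c / p').
  rewrite eE; have -> : c / p' = 1 - e by rewrite -eE; ring.
  rewrite /t powRM ?invr_ge0 ?(ltW N_gt0) ?(ltW m_gt0)//.
  rewrite -(powR_inv1 (ltW m_gt0)) -powRrM mulN1r powRD ?(gt_eqF m_gt0) ?implybT//.
  by rewrite powRr1 ?(ltW m_gt0)//; ring.
have X2 : t `^ (- (n / p')) * N = m `^ (c / p') * N `^ (1 - c / p').
  rewrite eE; have -> : c / p' = 1 - e by rewrite -eE; ring.
  rewrite /t -powRrM; have -> : e * - (n / p') = e - 1.
    by rewrite /e; field; rewrite !gt_eqF// addr_gt0.
  rewrite powRM ?invr_ge0 ?(ltW N_gt0) ?(ltW m_gt0)//.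
  rewrite -(powR_inv1 (ltW m_gt0)) -powRrM mulN1r opprB mulrAC mulrC.
  congr (_ * _); rewrite -[X in _ * X](powRr1 (ltW N_gt0)) -powRD ?subrK//.
  by rewrite (gt_eqF N_gt0) implybT.
set X := _ `^ _ * _ `^ _ in X1 X2 *.
have X0 : 0 <= X by rewrite mulr_ge0 ?powR_ge0.
have lt0 : 0 < l / t by rewrite divr_gt0.
have := CE _ K lt0 => /(ler_wpM2l C00) /(ler_wpM2r X0); apply: le_trans.
rewrite mulr_sumr mulr_suml; apply: ler_sum => k _.
have [w0 ak0 akm wak _] := H k (ltnW (ltn_ord k)); have := w_le k (ltnW (ltn_ord k)).
have -> : l / t / 2 ^+ k = l / 2 ^+ k / t by rewrite mulrAC.
set lk := l / 2 ^+ k.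
have lk0 : 0 < lk by rewrite divr_gt0// exprn_gt0.
clearbody lk; move=> wk; rewrite /peak -mulrA -[leRHS]mulrC minr_pMl//.
rewrite [leRHS]mulrC minr_pMr// le_min; apply/andP; split.
  rewrite powRr1 ?(ltW (divr_gt0 lk0 t0))//.
  rewrite -X1; have -> : lk / t * (t * m) = lk * m by rewrite mulrA divfK ?gt_eqF.
  apply: (@le_trans _ _ (lk `^ (1 - n) * (C0 * lk `^ n * m))).
    by rewrite ler_wpM2l ?powR_ge0// ler_pM ?(ltW w0).
  rewrite le_eqVlt; apply/orP; left; apply/eqP.
  have -> : lk `^ (1 - n) = lk / lk `^ n.
    by rewrite powRB ?(gt_eqF lk0) ?implybT// powRr1 ?ltW.
  by field; rewrite gt_eqF ?powR_gt0.
(* The second bound in the minimum comes from Jensen's inequality instead of the maximal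
   function. *)
have sN : w k * a k <= w k `^ q^-1 * N.
  have aN : a k <= N * w k `^ (- c^-1).
    rewrite -(ler_pM2l (powR_gt0 (c^-1) w0)) mulrCA -powRD; last first.
      by rewrite (gt_eqF w0) implybT.
    rewrite subrr powRr0 mulr1.
    have := @ge0_ler_powR R (c^-1) _ (w k * a k `^ c) (N `^ c) _ _ wak.
    rewrite invr_ge0 (ltW c0) !nnegrE mulr_ge0 ?powR_ge0 ?(ltW w0)// => /(_ isT isT isT).
    by rewrite powRM ?powR_ge0 ?(ltW w0)// -!powRrM divff ?gt_eqF// !powRr1.
  apply: le_trans (ler_wpM2l (ltW w0) aN) _.
  have -> : q^-1 = 1 - c^-1 by rewrite -cq; ring.
  rewrite powRD ?(gt_eqF w0) ?implybT// powRr1 ?(ltW w0)//.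
  by rewrite le_eqVlt; apply/orP; left; apply/eqP; ring.
apply: (@le_trans _ _ (lk `^ (1 - n) * ((C0 * lk `^ n) `^ q^-1 * N))).
  rewrite ler_wpM2l ?powR_ge0// (le_trans sN)// ler_wpM2r// ge0_ler_powR ?nnegrE ?invr_ge0 ?(ltW q0) ?(ltW w0)//.
  by rewrite mulr_ge0 ?powR_ge0.
rewrite powRM ?powR_ge0// -powRrM.
(* Since [C0 >= 1] and [q >= 1], the factor [C0^(1/q)] is at most [C0]. *)
apply: (@le_trans _ _ (lk `^ (1 - n) * (C0 * lk `^ (n / q) * N))).
  rewrite ler_wpM2l ?powR_ge0// ler_wpM2r// ler_wpM2r ?powR_ge0//.
  rewrite -[leRHS]powRr1// ler_powR// invf_le1//.
  by rewrite (le_trans _ pq)// ltW.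
rewrite powRM ?invr_ge0 ?(ltW lk0) ?(ltW t0)//.
have -> : t^-1 `^ (- (n / p')) = (t `^ (- (n / p')))^-1.
  by rewrite -(powR_inv1 (ltW t0)) -powRrM mulN1r opprK -powRN opprK.
rewrite -X2.
have -> : lk `^ (- (n / p')) = lk `^ (1 - n) * lk `^ (n / q).
  rewrite -powRD ?(gt_eqF lk0) ?implybT//; congr (_ `^ _).
  have : s / q = 0 by rewrite s0 mul0r.
  rewrite sE p'E => h; apply/eqP; rewrite -subr_eq0; apply/eqP.
  rewrite -[RHS]h; field; by rewrite !gt_eqF.
rewrite le_eqVlt; apply/orP; left; apply/eqP.
by field; exact: (lt0r_neq0 (powR_gt0 _ t0)).
Qed.

Lemma kernel_bound C0 : 1 <= C0 -> s <= 0 ->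
  exists C, 0 <= C /\ forall l d m N w a K, 0 < l -> 0 < d -> 0 <= N ->
    kernel_hyp C0 l d m N w a K ->
    \sum_(k < K) (l / 2 ^+ k) `^ (1 - n) * (w k * a k) <=
    C * (d `^ (s / p') * m `^ (c / p') * N `^ (1 - c / p')).
Proof.
move=> C01; rewrite le_eqVlt => /predU1P[|]; first exact: kernel_bound_zero.
exact/kernel_bound_neg/(le_trans ler01).
Qed.

(** [lam] is chosen so that the second term becomes [(H / h) J], at most [J / 2]. What remains is
    [J^(1 - e) <= 2 h^(p/p') A], and [(1 - e) / p = 1 / q]. Taking [h = 2 (H + 1)] rather than [2 H]
    keeps it positive when [H = 0]. *)
Lemma absorb H : 0 <= H -> exists C, 0 <= C /\ forall J A, 0 <= J -> 0 <= A ->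
  (forall lam, 0 < lam -> J <= lam `^ p * A + lam `^ (- p') * H * J `^ (p' / c)) ->
  J `^ q^-1 <= C * A `^ p^-1.
Proof.
move=> H0; pose h := 2 * (H + 1); have h0 : 0 < h by rewrite mulr_gt0// ltr_wpDl.
exists ((2 * h `^ (p / p')) `^ p^-1); split; first exact: powR_ge0.
move=> J A J0 A0 HJ.
have [->|J0'] := eqVneq J 0.
  by rewrite powR0 ?invr_neq0 ?gt_eqF// mulr_ge0 ?powR_ge0.
have J_gt0 : 0 < J by rewrite lt_neqAle eq_sym J0'.
pose lam := (h * J `^ (p' / c - 1)) `^ p'^-1.
have b0 : 0 < h * J `^ (p' / c - 1) by rewrite mulr_gt0// powR_gt0.
have lam0 : 0 < lam by rewrite powR_gt0.
have := HJ _ lam0.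
have -> : lam `^ (- p') * H * J `^ (p' / c) = H / h * J.
  rewrite /lam -powRrM mulrN mulVf ?gt_eqF// powR_inv1 ?ltW//.
  rewrite powRB ?(gt_eqF J_gt0) ?implybT// powRr1 ?ltW//.
  by field; rewrite (gt_eqF h0) (gt_eqF J_gt0) gt_eqF ?powR_gt0.
have hH : H / h <= 2^-1.
  by rewrite ler_pdivrMr// /h mulrA mulVf// mul1r lerDl.
move=> HJ1; have {HJ1} : J <= 2 * lam `^ p * A.
  have := ler_wpM2r (ltW J_gt0) hH; rewrite -mulrA; lra.
rewrite /lam -powRrM [p'^-1 * p]mulrC => HJ1.
rewrite (powRM _ (ltW h0) (powR_ge0 _ _)) -powRrM in HJ1.
pose e := (p' / c - 1) * (p / p').
have HJ2 : J `^ (1 - e) <= 2 * h `^ (p / p') * A.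
  rewrite powRB ?(gt_eqF J_gt0) ?implybT// powRr1 ?(ltW J_gt0)//.
  rewrite ler_pdivrMr ?powR_gt0//; apply: le_trans HJ1 _.
  by rewrite le_eqVlt; apply/orP; left; apply/eqP; rewrite /e; ring.
have := @ge0_ler_powR R p^-1 _ _ _ _ _ HJ2.
rewrite invr_ge0 (ltW p0) !nnegrE powR_ge0 !mulr_ge0 ?powR_ge0// => /(_ isT isT isT).
rewrite powRM ?mulr_ge0 ?powR_ge0// -powRrM.
have -> // : (1 - e) / p = q^-1.
rewrite /e; have -> : q^-1 = 1 - c^-1 by rewrite -cq; ring.
have -> : 1 - c^-1 = p^-1 + p'^-1 - c^-1 by rewrite pp'.
by field; rewrite !gt_eqF.
Qed.

End kernel_bound.

(** * The weighted inequality for an abstract oscillation kernel *)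

Lemma kernel_powE (R : realType) (Ck d m N s c p' : R) : 0 < p' -> 0 <= Ck ->
  (Ck * (d `^ (s / p') * m `^ (c / p') * N `^ (1 - c / p'))) `^ p' =
  Ck `^ p' * (d `^ s * m `^ c * N `^ (p' - c)).
Proof.
move=> p'0 Ck0; have p'n : p' != 0 by rewrite gt_eqF.
rewrite !powRM ?mulr_ge0 ?powR_ge0// -!powRrM.
by rewrite (divfK p'n s) (divfK p'n c) mulrBl mul1r (divfK p'n c).
Qed.

Section core.
Context d (T : measurableType d) (R : realType).
Variable mu : {sigma_finite_measure set T -> \bar R}.
Variables (n p q p' c s C0 C1 : R).
Hypotheses (p1 : 1 < p) (pq : p <= q) (pp' : p^-1 + p'^-1 = 1)
  (cq : c^-1 + q^-1 = 1) (p'0 : 0 < p') (c0 : 0 < c).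
Hypothesis C10 : 0 <= C1.

Let p0 : 0 < p. Proof. exact: lt_trans p1. Qed.
Let q0 : 0 < q. Proof. exact: lt_le_trans pq. Qed.
Let qc : q^-1 + c^-1 = 1. Proof. by rewrite addrC. Qed.

Local Open Scope ereal_scope.

Section instance.
Variables (Q : set T) (E : nat -> set (T * T)).
Hypothesis mQ : measurable Q.
Hypothesis mE : forall k, measurable (E k).
Hypothesis E_sym : forall k x y, E k (x, y) -> E k (y, x).
Hypothesis E_trans : forall k x y z, E k (x, y) -> E k (y, z) -> E k (x, z).
Hypothesis E_dom : forall k x y, E k (x, y) -> Q x.
Hypothesis E_sub : forall k, E k.+1 `<=` E k.
Variables (D W f v : T -> R) (l L B : R).
Hypothesis l0 : (0 < l)%R.
Hypothesis WE : forall x, Q x -> W x = (D x `^ s)%R.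
Hypothesis mW : measurable_fun setT W.
Hypothesis W0 : forall x, (0 <= W x)%R.
Hypothesis W_fin : \int[mu]_(x in Q) (W x)%:E < +oo.
Hypothesis W_pos : forall k x, Q x -> 0 < cell_int mu (E k) (EFin \o W) x.
Hypothesis mf : measurable_fun setT f.
Hypothesis f0 : forall x, (0 <= f x)%R.
Hypothesis fD : forall x, Q x -> (0 < f x)%R -> (0 < D x)%R.
Hypothesis mv : measurable_fun setT v.
Hypothesis v0 : forall x, (0 <= v x)%R.
Hypothesis vB : forall x, Q x -> (v x <= B)%R.
Hypothesis W_mass : forall k x, Q x -> (0 < f x)%R ->
  cell_int mu (E k) (EFin \o W) x <=
  (C0 * (l / 2 ^+ k) `^ n * Num.max (l / 2 ^+ k) (D x) `^ s)%:E.
Hypothesis v_osc : forall K x, Q x -> (v x)%:E <=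
  \sum_(k < K) ((C1 * (l / 2 ^+ k) `^ (1 - n))%:E * cell_int mu (E k) (EFin \o f) x) +
  (L / 2 ^+ K)%:E.

Let g x := (v x `^ (q - 1))%R.
Let mg : measurable_fun setT g.
Proof. exact: (measurableT_comp (@measurable_powR R (q - 1)) mv). Qed.
Let g0 x : (0 <= g x)%R. Proof. exact: powR_ge0. Qed.
Let q1 : (0 <= q - 1)%R. Proof. by rewrite subr_ge0 (le_trans (ltW p1)). Qed.
Let gB x : Q x -> (g x <= B `^ (q - 1))%R.
Proof.
move=> Qx; rewrite ge0_ler_powR ?nnegrE ?vB//.
by rewrite (le_trans (v0 x))// vB.
Qed.
Let gc x : (g x `^ c = v x `^ q)%R. Proof. exact: powRB1K. Qed.
Let vg x : (v x * g x = v x `^ q)%R. Proof. exact: mulr_powRB1. Qed.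

Let J := \int[mu]_(x in Q) (v x `^ q * W x)%:E.
Let A := \int[mu]_(x in Q) (f x `^ p)%:E.
Let I := \int[mu]_(x in Q) (g x * W x)%:E.
Let mom k x := cell_moment mu E W g k x.
Let G K x := (\sum_(k < K) (l / 2 ^+ k) `^ (1 - n) * mom k x)%R.

Let mhW (h : T -> R) : measurable_fun setT h -> measurable_fun setT (fun x => (h x * W x)%:E).
Proof. by move=> mh; apply/measurable_EFinP; exact: measurable_funM. Qed.

Let int_fin (h : T -> R) M : (forall x, 0 <= h x)%R ->
  (forall x, Q x -> h x <= M)%R -> \int[mu]_(x in Q) (h x * W x)%:E < +oo.
Proof.
move=> h0 hM.
have [[y Qy]|nQ] := pselect (exists y, Q y); last first.
  by rewrite integral0_eq ?ltry// => x Qx; exfalso; apply: nQ; exists x.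
have M0 : (0 <= M)%R by exact: le_trans (h0 y) (hM _ Qy).
apply: (@le_lt_trans _ _ (M%:E * \int[mu]_(x in Q) (W x)%:E)).
  rewrite -ge0_integralZl//; last 2 first.
  - by apply: measurable_funTS; exact/measurable_EFinP.
  - by move=> x _; rewrite lee_fin.
  apply: le_integral_nneg => x Qx; first by rewrite lee_fin mulr_ge0.
  by rewrite -EFinM lee_fin ler_wpM2r// hM.
by rewrite lte_mul_pinfty ?lee_fin.
Qed.

Let vq0 x : (0 <= v x `^ q)%R. Proof. exact: powR_ge0. Qed.

Let J0 : 0 <= J.
Proof. by apply: integral_ge0 => x _; rewrite lee_fin mulr_ge0. Qed.

Let Jfin : J \is a fin_num.
Proof.
rewrite ge0_fin_numE//; apply: (@int_fin (fun x => v x `^ q)%R (B `^ q)%R) => //.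
move=> x Qx; rewrite ge0_ler_powR ?nnegrE ?vB ?(ltW q0)//.
by rewrite (le_trans (v0 x))// vB.
Qed.

Lemma core_lhs_fin : J \is a fin_num. Proof. exact: Jfin. Qed.

Let I0 : 0 <= I.
Proof. by apply: integral_ge0 => x _; rewrite lee_fin mulr_ge0. Qed.

Let Ifin : I \is a fin_num.
Proof. by rewrite ge0_fin_numE//; exact: (int_fin g0 gB). Qed.

Let mom0 k x : (0 <= mom k x)%R.
Proof. exact: cell_moment_ge0. Qed.

Let lk0 k : (0 < l / 2 ^+ k)%R. Proof. by rewrite divr_gt0// exprn_gt0. Qed.

Let momE k x : Q x -> (mom k x)%:E = cell_int mu (E k) (fun x => (g x * W x)%:E) x.
Proof. by move=> Qx; exact: (cell_momentE mQ mE E_sym E_dom mW W0 g0 gB W_fin). Qed.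

Let L0 : (exists x, Q x) -> (0 <= L)%R.
Proof.
move=> [x Qx]; have := v_osc 0 Qx; rewrite big_ord0 add0e expr0 divr1 lee_fin.
exact: le_trans.
Qed.

Let mG K : measurable_fun setT (G K).
Proof.
apply: measurable_sum => k; apply: measurable_funM => //.
rewrite /mom /cell_moment; apply: measurableT_comp => //.
apply: (measurable_cell_int mu (mE k) (mhW mg)) => x.
by rewrite lee_fin mulr_ge0.
Qed.

Let G0 K x : (0 <= G K x)%R.
Proof. by apply: sumr_ge0 => k _; rewrite mulr_ge0 ?powR_ge0. Qed.

(** Multiply [v_osc] by [g W] and integrate over [Q]; the left side is [J] because [v g = v^q]. On
    the right, [cell_int_sym] moves the integration over cells from [f] to [g W]. *)
Let duality K : J <= C1%:E * \int[mu]_(x in Q) (f x * G K x)%:E + (L / 2 ^+ K)%:E * I.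
Proof.
have [Qne|nQ] := pselect (exists x, Q x); last first.
  have -> : J = 0 by apply: integral0_eq => x Qx; exfalso; apply: nQ; exists x.
  have -> : I = 0 by apply: integral0_eq => x Qx; exfalso; apply: nQ; exists x.
  rewrite mule0 adde0 mule_ge0 ?lee_fin//; apply: integral_ge0 => x _.
  by rewrite lee_fin mulr_ge0.
have LK0 : (0 <= L / 2 ^+ K)%R by rewrite divr_ge0 ?L0// exprn_ge0.
pose a k := (C1 * (l / 2 ^+ k) `^ (1 - n))%R.
have a0 k : (0 <= a k)%R by rewrite mulr_ge0 ?powR_ge0.
have mEf : measurable_fun setT (EFin \o f) by exact/measurable_EFinP.
have Ef0 x : 0 <= (EFin \o f) x by rewrite lee_fin.
have mcf k := measurable_cell_int mu (mE k) mEf Ef0.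
have cf0 k x : 0 <= cell_int mu (E k) (EFin \o f) x by exact: cell_int_ge0.
have gW0 x : 0 <= (g x * W x)%:E by rewrite lee_fin mulr_ge0.
apply: (@le_trans _ _ (\int[mu]_(x in Q) (\sum_(k < K)
    ((a k)%:E * ((g x * W x)%:E * cell_int mu (E k) (EFin \o f) x)) +
    (L / 2 ^+ K)%:E * (g x * W x)%:E))).
  apply: le_integral_nneg => x Qx; first by rewrite lee_fin mulr_ge0.
  rewrite -vg -mulrA EFinM muleC.
  apply: le_trans (lee_wpmul2l (gW0 x) (v_osc K Qx)) _.
  rewrite ge0_muleDr ?lee_fin//; last first.
    by apply: sume_ge0 => k _; apply: mule_ge0; [exact: (a0 k)|exact: cf0].
  rewrite [X in _ + X <= _]muleC leeD2r// ge0_sume_distrr//.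
    by apply: lee_sum => k _; rewrite muleCA.
  by move=> k _; apply: mule_ge0; [exact: (a0 k)|exact: cf0].
have mt k : measurable_fun setT (fun x => (g x * W x)%:E * cell_int mu (E k) (EFin \o f) x).
  by apply: emeasurable_funM => //; exact: mhW.
rewrite ge0_integralD//; last 4 first.
- by move=> x _; apply: sume_ge0 => k _; apply: mule_ge0; [rewrite lee_fin|exact: mule_ge0].
- by apply: measurable_funTS; apply: emeasurable_sum => k; exact: measurable_funeM.
- by move=> x _; apply: mule_ge0; [rewrite lee_fin|exact: gW0].
- by apply: measurable_funTS; apply: measurable_funeM; exact: mhW.
rewrite [X in _ + X <= _]ge0_integralZl//; last exact/measurable_funTS/mhW.
rewrite leeD2r// ge0_integral_sum//; last 2 first.
- by move=> k; apply: measurable_funTS; exact: measurable_funeM.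
- by move=> k x _; apply: mule_ge0; [rewrite lee_fin|exact: mule_ge0].
have -> : \int[mu]_(x in Q) (f x * G K x)%:E = \sum_(k < K)
    ((l / 2 ^+ k) `^ (1 - n))%:E * \int[mu]_(x in Q) ((EFin \o f) x * cell_int mu (E k) (fun x => (g x * W x)%:E) x).
  have mcg k := measurable_cell_int mu (mE k) (mhW mg) gW0.
  have mfcg k : measurable_fun setT (fun x => (EFin \o f) x * cell_int mu (E k) (fun x => (g x * W x)%:E) x).
    exact: emeasurable_funM.
  have fcg0 k x : 0 <= (EFin \o f) x * cell_int mu (E k) (fun x => (g x * W x)%:E) x.
    by rewrite mule_ge0 ?cell_int_ge0.
  rewrite (eq_bigr (fun k : 'I_K => \int[mu]_(x in Q) (((l / 2 ^+ k) `^ (1 - n))%:E * ((EFin \o f) x * cell_int mu (E k) (fun x => (g x * W x)%:E) x)))); last first.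
    move=> k _; rewrite ge0_integralZl// ?lee_fin ?powR_ge0//.
    exact: measurable_funTS.
  rewrite -ge0_integral_sum//; last 2 first.
  - by move=> k; apply: measurable_funTS; exact: measurable_funeM.
  - by move=> k x _; rewrite mule_ge0 ?lee_fin ?powR_ge0.
  apply: eq_integral => x /set_mem Qx; rewrite /G mulr_sumr -sumEFin.
  by apply: eq_bigr => k _; rewrite -momE// -!EFinM; congr EFin; ring.
rewrite ge0_sume_distrr//; last first.
  move=> k _; rewrite mule_ge0 ?lee_fin ?powR_ge0//.
  by apply: integral_ge0 => x _; rewrite mule_ge0 ?cell_int_ge0.
apply: lee_sum => k _.
rewrite (ge0_integralZl mu mQ (measurable_funTS (mt k)) (fun x _ => mule_ge0 (gW0 x) (cf0 k x)) (a0 k : 0 <= (a k)%:E)).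
rewrite (cell_int_sym mu (mE k) (E_sym (k := k)) (E_dom (k := k)))//; last exact: mhW.
by rewrite muleA -EFinM.
Qed.

Section with_kernel_bound.
Variable Ck : R.
Hypothesis Ck0 : (0 <= Ck)%R.
Hypothesis CkE : forall l d m N w a K, (0 < l)%R -> (0 < d)%R -> (0 <= N)%R ->
    kernel_hyp n c s C0 l d m N w a K ->
    (\sum_(k < K) (l / 2 ^+ k) `^ (1 - n) * (w k * a k) <=
    Ck * (d `^ (s / p') * m `^ (c / p') * N `^ (1 - c / p')))%R.

Let Jr := fine J.
Let Jr0 : (0 <= Jr)%R. Proof. exact: fine_ge0. Qed.
Let JE : J = Jr%:E. Proof. exact: esym (fineK Jfin). Qed.
Let N := (Jr `^ c^-1)%R.
Let H0 := (Ck `^ p' * (2 * (2 * q) `^ c))%R.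

(** Young's inequality for [lam f] and [G / lam]. The power [p'] of the kernel bound is
    [D^s m^c N^(p' - c)] up to a constant, and [D^s] is the weight [W], so the second term is ready
    for the maximal inequality. *)
Let pointwise K x lam : Q x -> (0 < lam)%R -> (f x * G K x <= lam `^ p * f x `^ p +
  lam `^ (- p') * Ck `^ p' * N `^ (p' - c) * (max_avg mu E W g K x `^ c * W x))%R.
Proof.
move=> Qx lam0.
(* [D x > 0], which the kernel bound requires, is known only where [f x > 0]. *)
have [fx0|fx0] := eqVneq (f x) 0%R.
  rewrite fx0 mul0r addr_ge0// ?mulr_ge0 ?powR_ge0//.
have fx : (0 < f x)%R by rewrite lt_neqAle eq_sym fx0 f0.
have Dx := fD Qx fx.
set m := max_avg mu E W g K x.
have GE : (G K x <= Ck * (D x `^ (s / p') * m `^ (c / p') * N `^ (1 - c / p')))%R.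
  have -> : G K x = (\sum_(k < K) (l / 2 ^+ k) `^ (1 - n) *
      (cell_mass mu E W k x * cell_avg mu E W g k x))%R.
    apply: eq_bigr => k _; congr (_ * _)%R.
    rewrite /cell_avg mulrC divfK// gt_eqF//.
    exact: (cell_mass_gt0 mQ mE E_sym E_dom mW W0 W_fin W_pos).
  apply: (@CkE l (D x) m N (fun k => cell_mass mu E W k x)
    (fun k => cell_avg mu E W g k x) K l0 Dx (powR_ge0 _ _)).
  move=> k kK; split.
  - exact: (cell_mass_gt0 mQ mE E_sym E_dom mW W0 W_fin W_pos).
  - exact: (cell_avg_ge0 mQ mE E_sym E_dom mW W0 g0 W_fin).
  - exact: cell_avg_le_max.
  - rewrite /N -powRrM mulVf ?gt_eqF// powRr1//.
    suff : (cell_mass mu E W k x * cell_avg mu E W g k x `^ c)%:E <= J by rewrite JE lee_fin.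
    rewrite /J; under [leRHS]eq_integral do rewrite -gc.
    exact: (cell_avg_jensen mQ mE E_sym E_dom mW W0 mg g0 gB W_fin W_pos c0 q0 cq).
  - rewrite -lee_fin (cell_massE mQ mE E_sym E_dom mW W0 W_fin).
    exact: W_mass.
have p'n : p' != 0%R by rewrite gt_eqF.
have GE' : (G K x `^ p' <= Ck `^ p' * (W x * m `^ c * N `^ (p' - c)))%R.
  have m0 : (0 <= m)%R.
    exact: (max_avg_ge0 mQ mE E_sym E_dom mW W0 g0 W_fin).
  have := @ge0_ler_powR R p' (ltW p'0) _ _ _ _ GE.
  rewrite !nnegrE G0 !mulr_ge0 ?powR_ge0// => /(_ isT isT) /le_trans; apply.
  by rewrite (kernel_powE _ _ _ _ _ p'0 Ck0) WE.
have := @conjugate_powR R (lam * f x)%R (G K x / lam)%R p p' _ _ p0 p'0 pp'.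
rewrite mulr_ge0 ?(ltW lam0)// divr_ge0 ?(ltW lam0)// => /(_ isT isT).
rewrite (_ : lam * f x * (G K x / lam) = f x * G K x)%R; last first.
  by field; rewrite gt_eqF.
move=> /le_trans; apply; apply: lerD.
  rewrite powRM ?(ltW lam0)// ler_pdivrMr// ler_peMr ?mulr_ge0 ?powR_ge0//.
  exact: ltW.
apply: (@le_trans _ _ ((G K x / lam) `^ p')%R).
  rewrite ler_pdivrMr// ler_peMr ?powR_ge0//.
  by rewrite ltW// (conjugate_gt1 p'0 p0)// addrC.
rewrite powRM ?invr_ge0 ?(ltW lam0)// -(powR_inv1 (ltW lam0)) -powRrM mulN1r.
rewrite [leLHS]mulrC -!mulrA ler_wpM2l ?powR_ge0//.
apply: (le_trans GE'); rewrite ler_wpM2l ?powR_ge0//.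
by rewrite le_eqVlt; apply/orP; left; apply/eqP; ring.
Qed.

Let key K lam : A < +oo -> (0 < lam)%R ->
  (Jr <= lam `^ p * (C1 * fine A) + lam `^ (- p') * (C1 * H0) * Jr `^ (p' / c) + L / 2 ^+ K * fine I)%R.
Proof.
move=> Afin lam0.
have A0 : 0 <= A by apply: integral_ge0 => x _; rewrite lee_fin powR_ge0.
have AE : A = (fine A)%:E by rewrite fineK// ge0_fin_numE.
have IE : I = (fine I)%:E by exact: esym (fineK Ifin).
have := duality K.
set FG := \int[mu]_(x in Q) _ => dual.
pose m := max_avg mu E W g K.
have mm : measurable_fun setT m.
  exact: (measurable_max_avg mQ mE E_sym E_dom mW W0 mg g0 W_fin).
have mmc : measurable_fun setT (fun x => m x `^ c)%R.
  exact: (measurableT_comp (@measurable_powR R c) mm).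
have mfp : measurable_fun setT (fun x => (f x `^ p)%:E).
  by apply/measurable_EFinP; exact: (measurableT_comp (@measurable_powR R p) mf).
pose h := (lam `^ (- p') * Ck `^ p' * N `^ (p' - c))%R.
have h0 : (0 <= h)%R by rewrite !mulr_ge0 ?powR_ge0.
have FGle : FG <= (lam `^ p)%:E * A + h%:E * \int[mu]_(x in Q) (m x `^ c * W x)%:E.
  rewrite /A -!ge0_integralZl ?lee_fin ?powR_ge0//; last 4 first.
  - exact/measurable_funTS/mhW.
  - by move=> x _; rewrite lee_fin mulr_ge0 ?powR_ge0.
  - exact: measurable_funTS.
  - by move=> x _; rewrite lee_fin powR_ge0.
  rewrite -ge0_integralD//; last 4 first.
  - by move=> x _; rewrite mule_ge0 ?lee_fin ?powR_ge0.
  - by apply: measurable_funTS; exact: measurable_funeM.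
  - by move=> x _; rewrite mule_ge0 ?lee_fin// mulr_ge0 ?powR_ge0.
  - by apply: measurable_funTS; apply: measurable_funeM; exact: mhW.
  apply: le_integral_nneg => x Qx; first by rewrite lee_fin mulr_ge0.
  by rewrite -!EFinM -EFinD lee_fin; exact: pointwise.
have mmax : \int[mu]_(x in Q) (m x `^ c * W x)%:E <= (2 * (2 * q) `^ c * Jr)%:E.
  have := max_avg_maximal mQ mE E_sym E_trans E_dom E_sub mW W0 mg g0 gB W_fin W_pos c0 q0 cq K.
  under [X in _ <= _ * X -> _]eq_integral do rewrite gc.
  by rewrite -/J JE -EFinM.
have : J <= C1%:E * ((lam `^ p)%:E * A + h%:E * (2 * (2 * q) `^ c * Jr)%:E) + (L / 2 ^+ K)%:E * I.
  apply: (le_trans dual); apply: leeD2r; apply: lee_wpmul2l; first by rewrite lee_fin.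
  apply: (le_trans FGle); apply: leeD2l; apply: lee_wpmul2l => //.
have -> : C1%:E * ((lam `^ p)%:E * A + h%:E * (2 * (2 * q) `^ c * Jr)%:E) + (L / 2 ^+ K)%:E * I =
    (C1 * (lam `^ p * fine A + h * (2 * (2 * q) `^ c * Jr)) + L / 2 ^+ K * fine I)%:E.
  by rewrite [in LHS]AE [in LHS]IE.
rewrite JE lee_fin => /le_trans; apply.
rewrite lerD2r mulrDr; apply: lerD.
  by rewrite le_eqVlt; apply/orP; left; apply/eqP; ring.
(* The maximal inequality contributes a factor [J], to be merged with the power of [N = J^(1/c)]. *)
have NJ : (N `^ (p' - c) * Jr = Jr `^ (p' / c))%R.
  rewrite /N -powRrM mulrC.
  have -> : (c^-1 * (p' - c) = p' / c - 1)%R by field; rewrite gt_eqF.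
  by rewrite mulr_powRB1// divr_gt0.
rewrite -NJ /h /H0 le_eqVlt; apply/orP; left; apply/eqP; ring.
Qed.

(** Let [K] tend to infinity in [key]: only the remainder [L I / 2^K] depends on [K], and [I] is
    finite. *)
Lemma core_instance : A < +oo -> forall lam, (0 < lam)%R ->
  (Jr <= lam `^ p * (C1 * fine A) + lam `^ (- p') * (C1 * H0) * Jr `^ (p' / c))%R.
Proof.
move=> Afin lam lam0; set X := (X in (_ <= X)%R).
apply/ler_addgt0Pr => e e0.
have Z0 : (0 <= `|L * fine I| / e)%R by rewrite divr_ge0// ltW.
pose K := (Num.truncn (`|L * fine I| / e)%R).+1.
apply: (le_trans (key K Afin lam0)); rewrite -/X lerD2l.
have K2 : (`|L * fine I| / e <= 2 ^+ K)%R.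
  apply: (le_trans (ltW (truncnS_gt _))); rewrite -natrX ler_nat.
  by apply: ltnW; exact: ltn_expl.
rewrite mulrAC ler_pdivrMr ?exprn_gt0// (le_trans (ler_norm _))//.
by move: K2; rewrite ler_pdivrMr// [(2 ^+ K * e)%R]mulrC.
Qed.

End with_kernel_bound.

End instance.

End core.

(** * Partial derivatives of Lipschitz functions *)

Section lipschitz_rV.
Context {R : realType} {n : nat}.
Implicit Types (x y : 'rV[R]_n) (A Q : set 'rV[R]_n) (u U : 'rV[R]_n -> R) (L e : R).

Lemma coord_le_norm x i : `|x ord0 i| <= `|x|.
Proof.
rewrite [leRHS]mx_normrE.
exact: (le_bigmax _ (fun j => `|x j.1 j.2|) (ord0, i)).
Qed.

Lemma norm_le_coord x e : 0 <= e -> (forall i, `|x ord0 i| <= e) -> `|x| <= e.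
Proof.
move=> e0 xe; rewrite [leLHS]mx_normrE; apply: bigmax_le => // -[j i] _ /=.
by rewrite ord1.
Qed.

(** Measurability here refers to the sigma-algebra generated by the coordinates, so open sets have
    to be written as countable unions of boxes: cubes with rational centres and radii
    [1 / (m + 1)]. *)
Lemma measurable_nbhs_rV A :
  (forall x, A x -> exists2 e, 0 < e & forall y, (forall i, `|y ord0 i - x ord0 i| < e) -> A y) ->
  measurable A.
Proof.
move=> openA; pose T := ({ffun 'I_n -> rat} * nat)%type.
pose c (r : T) : 'rV[R]_n := \row_i ratr (r.1 i).
pose F (r : T) := cube (c r) r.2.+1%:R^-1.
pose G (r : T) := if `[< F r `<=` A >] then F r else set0.
suff -> : A = \bigcup_r G r.
  apply: countable_bigcupT_measurable; first exact: countableP.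
  by move=> r; rewrite /G; case: ifP => _ //; exact: measurable_box.
apply/seteqP; split => [x Ax|x [r _]]; last first.
  by rewrite /G; case: asboolP => // FA; exact: FA.
have [e e0 xA] := openA _ Ax.
pose m := Num.truncn (2 / e).
have d0 : 0 < m.+1%:R^-1 :> R by rewrite invr_gt0.
have de : m.+1%:R^-1 + m.+1%:R^-1 <= e.
  have : 2 / e < m.+1%:R by exact: truncnS_gt.
  rewrite ltr_pdivrMr// => h.
  have -> : m.+1%:R^-1 + m.+1%:R^-1 = 2 / m.+1%:R :> R by rewrite mulr_natl mulr2n.
  by rewrite ler_pdivrMr// mulrC ltW.
have /choice[r rx] : forall i, exists q : rat,
    ratr q \in `]x ord0 i - m.+1%:R^-1, x ord0 i + m.+1%:R^-1[.
  move=> i; apply: rat_in_itvoo.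
  by rewrite ltrBlDr -addrA ltrDl addr_gt0.
exists ([ffun i => r i], m) => //; rewrite /G asboolT.
  move=> i; rewrite !mxE ffunE; have := rx i; rewrite in_itv/= => /andP[h1 h2].
  by rewrite lerBlDr (ltW h2)/= -ltrBlDr.
move=> y yF; apply: xA => i; have := yF i; have := rx i.
rewrite in_itv/= !mxE ffunE => /andP[h1 h2] /andP[h3 h4].
move: (ratr (r i) : R) (m.+1%:R^-1 : R) (y ord0 i) (x ord0 i) de h1 h2 h3 h4.
by move=> ? ? ? ? *; rewrite ltr_norml; apply/andP; split; lra.
Qed.

(** The sets where [U > c] are open. The radius uses [|L| + 1], which is positive whatever [L]
    is. *)
Lemma measurable_lipschitz_rV U L :
  (forall x y, `|U x - U y| <= L * `|x - y|) -> measurable_fun setT U.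
Proof.
move=> UL _; apply: (measurability _ (RGenOInfty.measurableE R)) => // _ [_ [c ->] <-].
rewrite setTI; apply: measurable_nbhs_rV => x /=; rewrite in_itv/= andbT => cx.
have L1 : 0 < `|L| + 1 by rewrite ltr_wpDl.
exists ((U x - c) / (`|L| + 1)) => [|y yx]; first by rewrite divr_gt0// subr_gt0.
rewrite /= in_itv/= andbT.
have e0 : 0 <= (U x - c) / (`|L| + 1) by rewrite divr_ge0 ?subr_ge0 ?(ltW cx) ?(ltW L1).
have : `|y - x| <= (U x - c) / (`|L| + 1).
  by apply: norm_le_coord => // i; rewrite !mxE; exact/ltW/yx.
rewrite ler_pdivlMr// => h.
have := UL x y; rewrite distrC [`|x - y|]distrC => h2.
have h3 : U x - U y <= L * `|y - x| by apply: le_trans h2; rewrite distrC ler_norm.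
have h4 : L * `|y - x| <= `|L| * `|y - x| by rewrite ler_wpM2r// ler_norm.
have [yx0|yx0] := eqVneq (`|y - x|) 0.
  by move: h3; rewrite yx0 mulr0; lra.
have : 0 < `|y - x| by rewrite lt_neqAle eq_sym yx0/=.
by move: h; rewrite mulrDr mulr1 [`|y - x| * _]mulrC; lra.
Qed.

(** McShane's extension: the infimum over [z] in [Q] of the cones [u z + L |x - z|]. *)
Lemma lipschitz_extension Q u L : 0 <= L -> Q !=set0 ->
  (forall x y, Q x -> Q y -> `|u x - u y| <= L * `|x - y|) ->
  exists U : 'rV[R]_n -> R, (forall x, Q x -> U x = u x) /\
    (forall x y, `|U x - U y| <= L * `|x - y|).
Proof.
move=> L0 [z0 Qz0] uL.
pose S x := [set u z + L * `|x - z| | z in Q].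
have S0 x : S x !=set0 by exists (u z0 + L * `|x - z0|); exists z0.
have Slb x : lbound (S x) (u z0 - L * `|x - z0|).
  move=> _ [z Qz <-].
  have h1 : u z0 - u z <= L * `|z0 - z| by apply: le_trans (uL _ _ Qz0 Qz); exact: ler_norm.
  have h2 : `|z0 - z| <= `|x - z0| + `|x - z|.
    by rewrite (le_trans (ler_distD x _ _))// distrC.
  have h3 := ler_wpM2l L0 h2; rewrite mulrDr in h3.
  by lra.
have hlb x : has_lbound (S x) by eexists; exact: Slb.
exists (fun x => inf (S x)); split=> [x Qx|].
  apply/le_anti/andP; split.
    apply: (ge_inf (hlb x)); exists x => //.
    by rewrite subrr normr0 mulr0 addr0.
  apply: lb_le_inf => // _ [z Qz <-].
  have := uL _ _ Qx Qz; rewrite ler_norml => /andP[_]; lra.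
have le1 x y : inf (S x) <= inf (S y) + L * `|x - y|.
  rewrite -lerBlDr; apply: lb_le_inf => // _ [z Qz <-].
  have h1 : inf (S x) <= u z + L * `|x - z| by apply: (ge_inf (hlb x)); exists z.
  have h2 := ler_wpM2l L0 (ler_distD y x z); rewrite mulrDr in h2.
  by lra.
move=> x y; rewrite ler_norml; have := le1 x y; have := le1 y x.
by rewrite [`|y - x|]distrC; lra.
Qed.

End lipschitz_rV.

(** * Derivability through rational increments *)

Section derivable_line.
Context {R : realType}.
Implicit Types (phi : R -> R) (t L : R).

Definition quotient phi t h : R := h^-1 *: (phi (h + t) - phi t).

(* Derivability in terms of countably many increments, to make the set of
   points of derivability measurable. *)
Definition cauchy_quotient phi t := forall j : nat, exists m : nat,
  forall r r' : rat, 0 < `|ratr r : R| < m.+1%:R^-1 -> 0 < `|ratr r' : R| < m.+1%:R^-1 ->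
    `|quotient phi t (ratr r) - quotient phi t (ratr r')| <= j.+1%:R^-1.

Lemma derivable_quotient phi t :
  derivable phi t 1 <-> cvg (quotient phi t h @[h --> 0^']).
Proof.
rewrite /derivable; have -> // : (fun h => h^-1 *: ((phi \o shift t) (h *: 1) - phi t)) = quotient phi t.
by apply/funext => h; rewrite /quotient /= [_ *: 1]mulr1.
Qed.

Lemma quotient_continuous phi t h : continuous phi -> h != 0 ->
  {for h, continuous (quotient phi t)}.
Proof.
move=> cphi h0; apply: cvgZ; first exact: cvgV.
apply: cvgB; last exact: cvg_cst.
apply: (@continuous_comp _ _ _ (fun x => x + t) phi); last exact: cphi.
by apply: cvgD; [exact: cvg_id|exact: cvg_cst].
Qed.

Lemma rat_approx phi t h (e d : R) : continuous phi -> 0 < `|h| < d -> 0 < e ->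
  exists2 r : rat, 0 < `|ratr r : R| < d & `|quotient phi t h - quotient phi t (ratr r)| < e.
Proof.
move=> cphi /andP[h0 hd] e0.
have h1 : h != 0 by rewrite -normr_gt0.
have /cvgrPdist_lt/(_ e e0) H1 := quotient_continuous (t := t) cphi h1.
have H2 : \forall x \near h, 0 < `|x|.
  have : {for h, continuous (fun x : R => `|x|)} by exact: norm_continuous.
  by move=> /(@cvgr_gt _ _ _ _ _ (`|h|)); apply.
have H3 : \forall x \near h, `|x| < d.
  have : {for h, continuous (fun x : R => `|x|)} by exact: norm_continuous.
  by move=> /(@cvgr_lt _ _ _ _ _ (`|h|)); apply.
have : \forall x \near h, [/\ `|quotient phi t h - quotient phi t x| < e, 0 < `|x| & `|x| < d].
  by near=> x; split; near: x.
move=> /nbhs_ballP[r /= r0 hr].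
have [q /itvP qE] : exists q, ratr q \in `]h, h + r[ by apply: rat_in_itvoo; rewrite ltrDl.
have [|b1 b2 b3] := hr (ratr q).
  by rewrite /ball/= ltr_distlC qE andbT (lt_trans _ (_ : h < _)) ?qE// ltrBlDr ltrDl.
by exists q => //; rewrite b2 b3.
Unshelve. all: by end_near. Qed.

(** For continuous [phi] the quotient is continuous in [h != 0], so every increment can be replaced
    by a rational one of nearly the same quotient; completeness then gives the limit. *)
Lemma cauchy_quotientP phi t : continuous phi ->
  cauchy_quotient phi t <-> derivable phi t 1.
Proof.
move=> cphi; rewrite derivable_quotient; split.
- move=> H; apply/cauchy_cvgP/cauchy_ballP => e e0.
  have e20 : 0 < e / 2 by rewrite divr_gt0.
  have e40 : 0 < e / 2 / 2 by rewrite divr_gt0.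
  have [m Hm] := H (Num.truncn (2 / e)).
  have je : (Num.truncn (2 / e)).+1%:R^-1 < e / 2.
    by rewrite -[ltRHS]invrK invf_div ltf_pV2 ?posrE ?divr_gt0// truncnS_gt.
  have md : 0 < m.+1%:R^-1 :> R by rewrite invr_gt0.
  pose A := [set quotient phi t h | h in [set h | 0 < `|h| < m.+1%:R^-1]].
  have AF : \forall h \near 0^', A (quotient phi t h).
    near=> h; exists h => //=; apply/andP; split.
      by rewrite normr_gt0; near: h; exact: nbhs_dnbhs_neq.
    by near: h; apply: dnbhs0_lt.
  exists (A, A) => // -[_ _] [/= [h hm <-] [h' hm' <-]].
  have [r rm hr] := rat_approx t cphi hm e40.
  have [r' rm' hr'] := rat_approx t cphi hm' e40.
  have := Hm _ _ rm rm'.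
  move: (quotient phi t h) (quotient phi t h') (quotient phi t (ratr r)) (quotient phi t (ratr r')) hr hr' => a b c d ac bd /le_lt_trans/(_ je) cd.
  rewrite /ball/=.
  have -> : a - b = (a - c) + (c - d) - (b - d) by ring.
  apply: (le_lt_trans (ler_normB _ _)).
  have := ler_normD (a - c) (c - d); lra.
- move=> /cvg_ex[l /= /cvgrPdist_lt H] j.
  have j0 : 0 < j.+1%:R^-1 / 2 :> R by rewrite divr_gt0.
  have := H _ j0; rewrite near_withinE => /nbhs_ballP[d /= d0 hd].
  have md : (Num.truncn d^-1).+1%:R^-1 < d.
    by rewrite -[ltRHS]invrK ltf_pV2 ?posrE ?invr_gt0// truncnS_gt.
  have key (r : rat) : 0 < `|ratr r : R| < (Num.truncn d^-1).+1%:R^-1 ->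
      `|l - quotient phi t (ratr r)| < j.+1%:R^-1 / 2.
    move=> /andP[r0 rm]; apply: hd; last by rewrite -normr_gt0.
    by rewrite /ball/= sub0r normrN; exact: lt_trans md.
  exists (Num.truncn d^-1) => r r' /key h1 /key h2.
  move: (quotient phi t (ratr r)) (quotient phi t (ratr r')) (j.+1%:R^-1 : R) h1 h2 => a b c h1 h2.
  have -> : a - b = (l - b) - (l - a) by ring.
  apply: (le_trans (ler_normB _ _)); lra.
Unshelve. all: by end_near. Qed.

End derivable_line.

Section partial_derivatives.
Context {R : realType} {n : nat}.
Variables (U : 'rV[R]_n -> R) (L : R).
Hypothesis UL : forall x y, `|U x - U y| <= L * `|x - y|.
Local Notation leb := (@lebesgue_rV R n).
Implicit Types (x : 'rV[R]_n) (i : 'I_n).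

(** In dimension [0] the Lipschitz hypothesis does not determine the sign of [L]; an index rules
    this case out. *)
Let L0 : 'I_n -> 0 <= L.
Proof.
move=> i; have := UL (const_mx 1) 0; rewrite subr0 => h.
have : 0 <= L * `|const_mx 1 : 'rV[R]_n| by exact: le_trans h.
rewrite pmulr_lge0// normr_gt0; apply/eqP => /rowP/(_ i).
by rewrite !mxE => /eqP; rewrite oner_eq0.
Qed.

Definition slice x i t : R := U (upd x i t).

Lemma slice_lipschitz x i s t : `|slice x i s - slice x i t| <= L * `|s - t|.
Proof.
apply: (le_trans (UL _ _)); rewrite ler_wpM2l ?(L0 i)//.
apply: norm_le_coord => // j; rewrite !mxE; case: ifP => // _.
by rewrite subrr normr0.
Qed.

Lemma slice_upd x i s : slice (upd x i s) i = slice x i.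
Proof.
apply/funext => t; congr U; apply/rowP => j; rewrite !mxE.
by case: eqP.
Qed.

Lemma quotient_slice x i :
  (fun h => h^-1 *: ((U \o shift x) (h *: delta_mx ord0 i) - U x)) =
  quotient (slice x i) (x ord0 i).
Proof.
apply/funext => h; rewrite /quotient /slice upd_id; congr (_ *: (U _ - _)).
apply/rowP => j; rewrite !mxE eqxx/=; case: eqP => [->|_].
  by rewrite mulr1.
by rewrite mulr0 add0r.
Qed.

Lemma derivable_slice x i :
  derivable U x (delta_mx ord0 i) <-> derivable (slice x i) (x ord0 i) 1.
Proof. by rewrite derivable_quotient /derivable quotient_slice. Qed.

Let slice_continuous x i : continuous (slice x i).
Proof. exact: (lipschitz_continuous (slice_lipschitz x i)). Qed.

Let mU : measurable_fun setT U. Proof. exact: measurable_lipschitz_rV UL. Qed.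

Let measurable_quotient i h : measurable_fun setT
  (fun x => quotient (slice x i) (x ord0 i) h).
Proof.
rewrite /quotient /slice; under eq_fun do rewrite upd_id.
apply: measurable_funM => //; apply: measurable_funB => //.
apply: (measurableT_comp mU); apply: measurable_fun_rV => j.
under eq_fun do rewrite mxE; case: eqP => [_|_]; last exact: measurable_coord.
by apply: measurable_funD => //; exact: measurable_coord.
Qed.

Definition diff_set i := [set x | derivable U x (delta_mx ord0 i)].

Lemma measurable_diff_set i : measurable (diff_set i).
Proof.
pose F (j m : nat) (r r' : rat) : set 'rV[R]_n :=
  [set x | 0 < `|ratr r : R| < m.+1%:R^-1 -> 0 < `|ratr r' : R| < m.+1%:R^-1 ->
    `|quotient (slice x i) (x ord0 i) (ratr r) -
      quotient (slice x i) (x ord0 i) (ratr r')| <= j.+1%:R^-1].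
suff -> : diff_set i = \bigcap_j \bigcup_m ~` (\bigcup_r \bigcup_r' ~` F j m r r').
  apply: bigcapT_measurable => j; apply: bigcupT_measurable => m.
  apply: measurableC; apply: bigcupT_measurable_rat => r.
  apply: bigcupT_measurable_rat => r'; apply: measurableC.
  have [c1|c1] := boolP (0 < `|ratr r : R| < m.+1%:R^-1); last first.
    by rewrite (_ : F _ _ _ _ = setT)//; apply/seteqP; split => // x _; rewrite /F/= (negbTE c1).
  have [c2|c2] := boolP (0 < `|ratr r' : R| < m.+1%:R^-1); last first.
    by rewrite (_ : F _ _ _ _ = setT)//; apply/seteqP; split => // x _; rewrite /F/= (negbTE c2).
  pose D x := `|quotient (slice x i) (x ord0 i) (ratr r) -
      quotient (slice x i) (x ord0 i) (ratr r')|.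
  have mD : measurable_fun setT D.
    apply: measurableT_comp => //.
    exact: (measurable_funB (measurable_quotient i (ratr r)) (measurable_quotient i (ratr r'))).
  rewrite (_ : F _ _ _ _ = D @^-1` `]-oo, j.+1%:R^-1]%classic); last first.
    apply/seteqP; split => x; rewrite /F/= in_itv/=; first exact.
    by [].
  by rewrite -[X in measurable X]setTI; apply: mD.
apply/seteqP; split => x.
  move=> /derivable_slice/(cauchy_quotientP _ (@slice_continuous x i)) H j _.
  have [m Hm] := H j; exists m => // -[r _ [r' _]]; apply => c1 c2; exact: Hm.
move=> H; apply/derivable_slice/(cauchy_quotientP _ (@slice_continuous x i)) => j.
have [m _ Hm] := H j I; exists m => r r' c1 c2; apply: contrapT => c3.
by apply: Hm; exists r => //; exists r' => // h; exact/c3/h.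
Qed.

(** The value [0] off [diff_set] avoids the junk values of ['D_] and gives a measurable function on
    the whole space. *)
Definition abs_partial i x : R :=
  if x \in diff_set i then `|'D_(delta_mx ord0 i) U x| else 0.

Lemma abs_partial_ge0 i x : 0 <= abs_partial i x.
Proof. by rewrite /abs_partial; case: ifP. Qed.

(** On [diff_set] the derivative is the limit of the quotients with increments [1 / (k + 1)]. *)
Lemma measurable_abs_partial i : measurable_fun setT (abs_partial i).
Proof.
have -> : abs_partial i = (fun x => `|'D_(delta_mx ord0 i) U x|) \_ (diff_set i).
  by [].
apply/(measurable_restrictT _ _).1; first exact: measurable_diff_set.
apply: measurableT_comp => //.
apply: (@measurable_fun_cvg _ _ R _ (fun k x => quotient (slice x i) (x ord0 i) k.+1%:R^-1)).
  by move=> k; apply: measurable_funTS; exact: measurable_quotient.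
move=> x dx; have : quotient (slice x i) (x ord0 i) h @[h --> 0^'] --> 'D_(delta_mx ord0 i) U x.
  by rewrite /derive quotient_slice; move: dx; rewrite /diff_set/= /derivable quotient_slice.
move=> H; apply: (cvg_comp _ _ _ H).
move=> A [e /= e0 eA]; exists (Num.truncn e^-1) => // k /= ke; apply: eA => //=; last first.
rewrite sub0r normrN gtr0_norm ?invr_gt0// -[ltRHS]invrK ltf_pV2 ?posrE ?invr_gt0//.
by apply: lt_le_trans (truncnS_gt _) _; rewrite ler_nat.
Qed.

(** The increment is the integral of the density from [lipschitz_ae_derivable], which is the
    derivative at almost every point of the segment. Almost every point thus lies in [diff_set], and
    the value [0] chosen off it does no harm. *)
Lemma slice_increment_le x i a b : a <= b ->
  (`|slice x i b - slice x i a|%:E <=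
   \int[lebesgue_measure]_(t in `[a, b[) (abs_partial i (upd x i t))%:E)%E.
Proof.
rewrite le_eqVlt => /predU1P[->|ab].
  by rewrite subrr normr0; apply: integral_ge0 => t _; rewrite lee_fin abs_partial_ge0.
have [g [gint gE gder]] := lipschitz_ae_derivable ab (slice_lipschitz x i).
have mab : measurable (`]a, b]%classic : set (measurableTypeR R)) by exact: measurable_itv.
have mg : measurable_fun (`]a, b]%classic : set (measurableTypeR R)) g.
  by apply/measurable_EFinP; exact: measurable_int gint.
have mupd : measurable_fun setT (fun t : measurableTypeR R => upd x i t).
  apply: measurable_fun_rV => j; under eq_fun do rewrite mxE.
  by case: eqP => _; [exact: measurable_id|exact: measurable_cst].
have mpart : measurable_fun setT (fun t : measurableTypeR R => (abs_partial i (upd x i t))%:E).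
  apply/measurable_EFinP; exact: (measurableT_comp (measurable_abs_partial i) mupd).
rewrite gE ?ab ?lexx ?(ltW ab)//.
apply: (@le_trans _ _ (\int[lebesgue_measure]_(t in `]a, b]) `|(g t)%:E|)%E).
  apply: (le_trans _ (le_abse_integral _ mab (proj2 (measurable_EFinP _ _) mg))).
  rewrite /Rintegral; case: (\int[_]_(_ in _) _)%E => [r| |] //=.
  - by rewrite normr0 leey.
  - by rewrite normr0 leey.
have moo : measurable (`]a, b[%classic : set (measurableTypeR R)) by exact: measurable_itv.
have mgoo : measurable_fun (`]a, b[%classic : set (measurableTypeR R)) (fun t => `|(g t)%:E|%E).
  apply: measurableT_comp => //; apply/measurable_EFinP.
  apply: measurable_funS mg => //.
  by apply: subset_itvl; rewrite bnd_simp.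
rewrite -integral_itv_bndo_bndc//.
apply: (@le_trans _ _ (\int[lebesgue_measure]_(t in `]a, b[) (abs_partial i (upd x i t))%:E)%E).
  rewrite le_eqVlt; apply/orP; left; apply/eqP.
  apply: ge0_ae_eq_integral => //.
  - exact: measurable_funTS.
  - by move=> t _; rewrite lee_fin abs_partial_ge0.
  apply: (@filterS _ _ (ae_filter_ringOfSetsType lebesgue_measure) _ _ _ gder).
  move=> t /= H; rewrite in_itv/= => tab.
  have [dt gt] := H tab.
  have : diff_set i (upd x i t).
    by rewrite /diff_set/= derivable_slice slice_upd mxE eqxx.
  rewrite /abs_partial => /mem_set ->; congr (`|_|%:E).
  rewrite -gt /derive quotient_slice slice_upd mxE eqxx.
  have -> // : (fun h => h^-1 *: ((slice x i \o shift t) (h *: 1) - slice x i t)) = quotient (slice x i) t.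
  by apply/funext => h; rewrite /quotient/= [_ *: 1]mulr1.
apply: ge0_subset_integral => //.
- exact: measurable_funTS.
- by move=> t _; rewrite lee_fin abs_partial_ge0.
- by apply: subset_itvr; rewrite bnd_simp.
Qed.

End partial_derivatives.

(** * Dyadic cubes *)

Section dyadic_cells.
Context {R : realType} {n : nat}.
Variables (a : 'rV[R]_n) (l : R).
Hypothesis l0 : 0 < l.
Local Notation leb := (@lebesgue_rV R n).
Let Q := box a (a + const_mx l).
Implicit Types (x y : 'rV[R]_n) (k : nat) (i : 'I_n).

Definition dyadic_pos k x i : R := (x ord0 i - a ord0 i) / l * 2 ^+ k.
(** On [Q] the position is nonnegative, so the truncation is the integer part. *)
Definition dyadic_idx k x i : nat := Num.truncn (dyadic_pos k x i).
Definition dyadic k : set ('rV[R]_n * 'rV[R]_n) :=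
  [set z | [/\ Q z.1, Q z.2 & forall i, dyadic_idx k z.1 i = dyadic_idx k z.2 i]].
Definition dyadic_corner k y : 'rV[R]_n :=
  \row_i (a ord0 i + l / 2 ^+ k * (dyadic_idx k y i)%:R).

Lemma dyadic_idxP k x i m : Q x ->
  dyadic_idx k x i = m <-> m%:R <= dyadic_pos k x i < m.+1%:R.
Proof.
move=> Qx; have x0 : 0 <= dyadic_pos k x i.
  have /andP[h _] := Qx i.
  by rewrite /dyadic_pos mulr_ge0 ?exprn_ge0// divr_ge0 ?subr_ge0// ltW.
split=> [<-|h]; first exact: truncn_itv.
exact: truncn_def.
Qed.

Lemma dyadic_idx_lt k x i : Q x -> (dyadic_idx k x i < 2 ^ k)%N.
Proof.
move=> Qx; have /andP[h _] := (dyadic_idxP k i _ Qx).1 erefl.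
rewrite -(ltr_nat R) natrX; apply: (le_lt_trans h).
rewrite /dyadic_pos -[ltRHS]mul1r ltr_pM2r ?exprn_gt0// ltr_pdivrMr// mul1r ltrBlDl.
by have /andP[_] := Qx i; rewrite !mxE.
Qed.

Lemma dyadic_sym k x y : dyadic k (x, y) -> dyadic k (y, x).
Proof. by move=> [/= ? ? h]; split => //= i; rewrite h. Qed.

Lemma dyadic_trans k x y z : dyadic k (x, y) -> dyadic k (y, z) -> dyadic k (x, z).
Proof. by move=> [/= ? ? h] [/= ? ? h']; split => //= i; rewrite h h'. Qed.

Lemma dyadic_dom k x y : dyadic k (x, y) -> Q x.
Proof. by case. Qed.

Lemma dyadic_refl k x : Q x -> dyadic k (x, x).
Proof. by move=> Qx; split. Qed.

Lemma dyadic_sub k : dyadic k.+1 `<=` dyadic k.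
Proof.
move=> [x y] [/= Qx Qy h]; split => //= i.
(* Halving a cell index gives the index of its parent cell. *)
have key z : Q z -> dyadic_idx k z i = (dyadic_idx k.+1 z i %/ 2)%N.
  move=> Qz; have := (dyadic_idxP k.+1 i _ Qz).1 erefl.
  have := (dyadic_idxP k i _ Qz).1 erefl.
  have -> : dyadic_pos k.+1 z i = dyadic_pos k z i * 2.
    by rewrite /dyadic_pos exprSr mulrA.
  move: (dyadic_pos k z i) (dyadic_idx k z i) (dyadic_idx k.+1 z i) => t j m.
  move=> /andP[h1 h2] /andP[h3 h4].
  have c1 : (j * 2 < m.+1)%N.
    by rewrite -(ltr_nat R) natrM; apply: le_lt_trans h4; rewrite ler_pM2r.
  have c2 : (m < j.+1 * 2)%N.
    by rewrite -(ltr_nat R) natrM; apply: (le_lt_trans h3); rewrite ltr_pM2r.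
  lia.
by rewrite !key// h.
Qed.

Lemma measurable_dyadic k : measurable (dyadic k).
Proof.
have mQ : measurable Q by exact: measurable_box.
pose A m i : set 'rV[R]_n := [set x | m%:R <= dyadic_pos k x i < m.+1%:R].
have mA m i : measurable (A m i).
  rewrite (_ : A m i = (fun x => dyadic_pos k x i) @^-1` `[m%:R, m.+1%:R[%classic); last first.
    by apply/seteqP; split => x; rewrite /A/= in_itv.
  have mp : measurable_fun setT (fun x => dyadic_pos k x i).
    apply: measurable_funM => //; apply: measurable_funM => //.
    by apply: measurable_funB => //; exact: measurable_coord.
  by rewrite -[X in measurable X]setTI; apply: mp.
suff -> : dyadic k = (Q `*` Q) `&`
    \big[setI/setT]_(i < n) \bigcup_m (A m i `*` A m i).
  apply: measurableI; first exact: measurableX.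
  apply: bigsetI_measurable => i _; apply: bigcupT_measurable => m.
  exact: measurableX.
rewrite -bigcap_seq; apply/seteqP; split => [[x y] [/= Qx Qy h]|[x y] [[/= Qx Qy] h]].
  split => // i _; exists (dyadic_idx k x i) => //; split => /=.
    exact/(dyadic_idxP k i _ Qx).
  by rewrite h; exact/(dyadic_idxP k i _ Qy).
split => //= i; have [|m _ [/= h1 h2]] := h i; first by rewrite /= mem_index_enum.
by rewrite ((dyadic_idxP k i m Qx).2 h1) ((dyadic_idxP k i m Qy).2 h2).
Qed.

Lemma dyadic_cell k y : Q y ->
  cell (dyadic k) y = box (dyadic_corner k y) (dyadic_corner k y + const_mx (l / 2 ^+ k)).
Proof.
move=> Qy.
have lk0 : 0 < l / 2 ^+ k by rewrite divr_gt0// exprn_gt0.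
have posE x i m : (m%:R <= dyadic_pos k x i < m.+1%:R) =
    (a ord0 i + l / 2 ^+ k * m%:R <= x ord0 i < a ord0 i + l / 2 ^+ k * m%:R + l / 2 ^+ k).
  have -> : dyadic_pos k x i = (x ord0 i - a ord0 i) / (l / 2 ^+ k).
    by rewrite /dyadic_pos; field; rewrite (gt_eqF l0) gt_eqF ?exprn_gt0.
  rewrite ler_pdivlMr// ltr_pdivrMr// -[m.+1%:R]natr1 mulrDl mul1r.
  by rewrite lerBrDl ltrBlDl addrA [_%:R * _]mulrC.
apply/seteqP; split => x.
  move=> [/= _ Qx h] i; rewrite !mxE -posE h.
  exact: (dyadic_idxP k i _ Qx).1.
move=> xb.
have xi i : (dyadic_idx k y i)%:R <= dyadic_pos k x i < (dyadic_idx k y i).+1%:R.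
  by rewrite posE; have := xb i; rewrite !mxE.
have Qx : Q x.
  move=> i; rewrite !mxE; have := xb i; rewrite !mxE => /andP[h1 h2].
  apply/andP; split.
    by apply: le_trans h1; rewrite lerDl mulr_ge0// ltW.
  apply: (lt_le_trans h2); rewrite -addrA lerD2l.
  (* The index is an integer below [2^k], so the right end of the cell stays within that of [Q]. *)
  have h3 : (dyadic_idx k y i).+1%:R <= 2 ^+ k :> R.
    by rewrite -natrX ler_nat; exact: dyadic_idx_lt.
  have := ler_wpM2l (ltW lk0) h3.
  by rewrite divfK ?gt_eqF ?exprn_gt0// -[(dyadic_idx k y i).+1%:R]natr1 mulrDr mulr1.
by split => //= i; apply/esym/(dyadic_idxP k i _ Qx).
Qed.

Lemma dyadic_cell0 y : Q y -> cell (dyadic 0) y = Q.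
Proof.
move=> Qy; apply/seteqP; split => x; first by case.
move=> Qx; split => //= i.
by have := dyadic_idx_lt 0 i Qx; have := dyadic_idx_lt 0 i Qy; rewrite expn0 !ltnS !leqn0 => /eqP -> /eqP ->.
Qed.

Lemma lebesgue_cube (c : 'rV[R]_n) s : 0 <= s ->
  leb (box c (c + const_mx s)) = (s ^+ n)%:E.
Proof.
move=> s0; rewrite lebesgue_rV_box; last by move=> i; rewrite !mxE lerDl.
congr EFin; under eq_bigr do rewrite !mxE addrAC subrr add0r.
by rewrite prodr_const card_ord.
Qed.

End dyadic_cells.

(** * Means of a Lipschitz function over cubes *)

Section cube_means.
Context {R : realType} {n : nat}.
Local Notation leb := (@lebesgue_rV R n).
Variables (U : 'rV[R]_n -> R) (L : R).
Hypothesis L0 : 0 <= L.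
Hypothesis UL : forall x y, `|U x - U y| <= L * `|x - y|.
Implicit Types (A B : set 'rV[R]_n).

Let mU : measurable_fun setT U. Proof. exact: measurable_lipschitz_rV UL. Qed.

Lemma cube_integrable c s : 0 <= s ->
  leb.-integrable (box c (c + const_mx s)) (EFin \o U).
Proof.
move=> s0; apply: measurable_bounded_integrable.
- exact: measurable_box.
- by apply: (@le_lt_trans _ _ (s ^+ n)%:E); [rewrite -(lebesgue_cube c s0)|rewrite ltry].
- exact: measurable_funTS.
- exists (`|U c| + L * s); split; first exact: num_real.
  move=> M cM x xc; apply/ltW/le_lt_trans/cM.
  have -> : U x = (U x - U c) + U c by rewrite subrK.
  rewrite (le_trans (ler_normD _ _))// addrC lerD2l (le_trans (UL _ _))// ler_wpM2l//.
  apply: norm_le_coord => // i; have := xc i; rewrite !mxE => /andP[h1 h2].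
  by rewrite ger0_norm ?subr_ge0// lerBlDl ltW.
Qed.

Lemma mean_dist_le B r : measurable B -> 0 < fine (leb B) -> (leb B < +oo)%E ->
  leb.-integrable B (EFin \o U) ->
  (`|r - mean B U|%:E <= (fine (leb B))^-1%:E * \int[leb]_(z in B) `|r - U z|%:E)%E.
Proof.
move=> mB B0 Bfin iB.
have icst : leb.-integrable B (EFin \o cst r).
  apply/integrableP; split; first by apply/measurable_EFinP; exact: measurable_cst.
  by rewrite /= integral_cst//= lte_mul_pinfty// lee_fin.
have -> : r - mean B U = (fine (leb B))^-1 * \int[leb]_(z in B) (r - U z).
  rewrite RintegralB// Rintegral_cst// /mean mulrBr mulrCA mulVf ?gt_eqF// mulr1.
  by rewrite [X in _ - X]mulrC.
rewrite normrM gtr0_norm ?invr_gt0// EFinM lee_wpmul2l ?lee_fin ?invr_ge0 ?(ltW B0)//.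
have iBr : leb.-integrable B (EFin \o (fun z => r - U z)) by exact: (integrableB mB icst iB).
apply: (le_trans _ (le_abse_integral _ mB (measurable_int _ iBr))).
rewrite /Rintegral; case: (\int[_]_(_ in _) _)%E => [s| |] //=.
- by rewrite normr0 leey.
- by rewrite normr0 leey.
Qed.

Lemma mean_mean_dist_le A B : measurable A -> 0 < fine (leb A) -> (leb A < +oo)%E ->
  leb.-integrable A (EFin \o U) ->
  measurable B -> 0 < fine (leb B) -> (leb B < +oo)%E ->
  leb.-integrable B (EFin \o U) ->
  (`|mean A U - mean B U|%:E <= (fine (leb A))^-1%:E * ((fine (leb B))^-1%:E *
    \int[leb]_(x in A) \int[leb]_(z in B) `|U x - U z|%:E))%E.
Proof.
move=> mA A0 Afin iA mB B0 Bfin iB.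
rewrite distrC; apply: (le_trans (mean_dist_le (mean B U) mA A0 Afin iA)).
rewrite lee_wpmul2l ?lee_fin ?invr_ge0 ?(ltW A0)//.
have mUU : measurable_fun setT (fun z : 'rV[R]_n * 'rV[R]_n => `|U z.1 - U z.2|%:E).
  apply/measurable_EFinP; apply: measurableT_comp => //.
  by apply: measurable_funB; exact: measurableT_comp.
have mI := @measurable_fun_integral_in _ _ _ _ R leb B _ mB mUU (fun z => normr_ge0 _).
rewrite -ge0_integralZl//; last 3 first.
- exact: measurable_funTS.
- by move=> x _; apply: integral_ge0 => z _; rewrite lee_fin.
- by rewrite lee_fin invr_ge0 ltW.
apply: le_integral_nneg => x _; rewrite ?lee_fin//.
by rewrite distrC; exact: mean_dist_le.
Qed.

End cube_means.

(** * Telescoping over the dyadic cubes *)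

Section oscillation.
Context {R : realType} {n : nat}.
Local Notation leb := (@lebesgue_rV R n).
Variables (U : 'rV[R]_n -> R) (L : R).
Hypothesis L0 : 0 <= L.
Hypothesis UL : forall x y, `|U x - U y| <= L * `|x - y|.
Variables (a : 'rV[R]_n) (l : R).
Hypothesis l0 : 0 < l.
Let Q := box a (a + const_mx l).
Let lk k := l / 2 ^+ k.
Let lk0 k : 0 < lk k. Proof. by rewrite divr_gt0// exprn_gt0. Qed.

(** The sum arises from changing one coordinate at a time; it is at most [n] times the Euclidean
    norm of the gradient. *)
Definition abs_grad x : R := \sum_(i < n) abs_partial U i x.

Lemma abs_grad_ge0 x : 0 <= abs_grad x.
Proof. by apply: sumr_ge0 => i _; exact: abs_partial_ge0. Qed.

Lemma measurable_abs_grad : measurable_fun setT abs_grad.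
Proof. by apply: measurable_sum => i; exact: (measurable_abs_partial UL). Qed.

Let mU : measurable_fun setT U. Proof. exact: measurable_lipschitz_rV UL. Qed.

Lemma cube_poincare c s : 0 < s ->
  (\int[leb]_(x in box c (c + const_mx s)) \int[leb]_(y in box c (c + const_mx s))
     `|U x - U y|%:E <=
   (s ^+ n * s)%:E * \int[leb]_(x in box c (c + const_mx s)) (abs_grad x)%:E)%E.
Proof.
move=> s0; set P := box c (c + const_mx s); have mP : measurable P by exact: measurable_box.
have sE i : (c + const_mx s) ord0 i - c ord0 i = s by rewrite !mxE addrAC subrr add0r.
have H1 i : c ord0 i <= (c + const_mx s) ord0 i by rewrite -subr_ge0 sE ltW.
have H2 i x t : P x -> c ord0 i <= t < (c + const_mx s) ord0 i ->
    (`|U x - U (upd x i t)|%:E <=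
     \int[lebesgue_measure]_(r in `[c ord0 i, (c + const_mx s)%R ord0 i[)
       (abs_partial U i (upd x i r))%:E)%E.
  move=> Px /andP[t1 t2].
  have /andP[x1 x2] := Px i.
  have sub (b1 b2 : R) : c ord0 i <= b1 -> b2 <= (c + const_mx s) ord0 i ->
      (\int[lebesgue_measure]_(r in `[b1, b2[) (abs_partial U i (upd x i r))%:E <=
       \int[lebesgue_measure]_(r in `[c ord0 i, (c + const_mx s)%R ord0 i[) (abs_partial U i (upd x i r))%:E)%E.
    move=> b1c b2c; apply: ge0_subset_integral.
    - exact: measurable_itv.
    - exact: measurable_itv.
    - apply: measurable_funTS; apply/measurable_EFinP.
      apply: (measurableT_comp (measurable_abs_partial UL i)).
      apply: measurable_fun_rV => j; under eq_fun do rewrite mxE.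
      by case: eqP => _; [exact: measurable_id|exact: measurable_cst].
    - by move=> r _; rewrite lee_fin abs_partial_ge0.
    - by apply: subset_itv; rewrite bnd_simp.
  have xE : U x = slice U x i (x ord0 i) by rewrite /slice upd_id.
  rewrite xE -/(slice U x i t); have [xt|tx] := leP (x ord0 i) t.
    rewrite distrC; apply: (le_trans (slice_increment_le UL x i xt)).
    by apply: sub => //; exact: ltW.
  apply: (le_trans (slice_increment_le UL x i (ltW tx))).
  by apply: sub => //; exact: ltW.
have := @box_poincare R n c (c + const_mx s) U (abs_partial U) H1 mU
  (measurable_abs_partial UL) (@abs_partial_ge0 _ _ U) H2.
have -> : \prod_(i < n) ((c + const_mx s) ord0 i - c ord0 i) = s ^+ n.
  by under eq_bigr do rewrite sE; rewrite prodr_const card_ord.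
under [X in (_ <= _ * X)%E -> _]eq_bigr do rewrite sE.
rewrite -ge0_sume_distrr; last first.
  by move=> i _; apply: integral_ge0 => x _; rewrite lee_fin abs_partial_ge0.
rewrite -ge0_integral_sum//; last 2 first.
- by move=> i; apply: measurable_funTS; apply/measurable_EFinP; exact: (measurable_abs_partial UL).
- by move=> i x _; rewrite lee_fin abs_partial_ge0.
rewrite muleA -EFinM.
under [X in (_ <= _ * X)%E -> _]eq_integral do rewrite sumEFin.
by [].
Qed.

Let cubek k y := box (dyadic_corner a l k y) (dyadic_corner a l k y + const_mx (lk k)).

Let lebk k y : leb (cubek k y) = (lk k ^+ n)%:E.
Proof. exact/lebesgue_cube/ltW/lk0. Qed.

Let mk k y : measurable (cubek k y). Proof. exact: measurable_box. Qed.

Let fink k y : (leb (cubek k y) < +oo)%E. Proof. by rewrite lebk ltry. Qed.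

Let posk k y : 0 < fine (leb (cubek k y)).
Proof. by rewrite lebk/= exprn_gt0. Qed.

Let intk k y : leb.-integrable (cubek k y) (EFin \o U).
Proof. exact/(cube_integrable L0 UL)/ltW/lk0. Qed.

(** Enlarge the smaller cube to its parent in the double integral and apply [cube_poincare] there.
    Dividing by both volumes leaves [l_k^(1-n)] times the ratio [2^n] of the volumes. *)
Lemma mean_step k y : Q y ->
  (`|mean (cell (dyadic a l k.+1) y) U - mean (cell (dyadic a l k) y) U|%:E <=
   (2 ^+ n * (l / 2 ^+ k) `^ (1 - n%:R))%:E *
     cell_int leb (dyadic a l k) (EFin \o abs_grad) y)%E.
Proof.
move=> Qy; rewrite /cell_int !dyadic_cell//.
rewrite -/(lk k) -/(lk k.+1) -/(cubek k y) -/(cubek k.+1 y).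
have sub : cubek k.+1 y `<=` cubek k y.
  rewrite /cubek /lk -!dyadic_cell// => x.
  exact: dyadic_sub.
apply: (le_trans (mean_mean_dist_le UL (mk _ _) (posk _ _) (fink _ _) (intk _ _)
  (mk _ _) (posk _ _) (fink _ _) (intk _ _))).
have mUU : measurable_fun setT (fun z : 'rV[R]_n * 'rV[R]_n => `|U z.1 - U z.2|%:E).
  apply/measurable_EFinP; apply: measurableT_comp => //.
  by apply: measurable_funB; exact: measurableT_comp.
have mI := @measurable_fun_integral_in _ _ _ _ R leb (cubek k y) _ (mk k y) mUU (fun z => normr_ge0 _).
have h1 : (\int[leb]_(x in cubek k.+1 y) \int[leb]_(z in cubek k y) `|U x - U z|%:E <=
    (lk k ^+ n * lk k)%:E * \int[leb]_(x in cubek k y) (abs_grad x)%:E)%E.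
  apply: (le_trans _ (cube_poincare _ (lk0 k))).
  apply: ge0_subset_integral => //; [exact: mk|by apply: measurable_funTS; exact: mI|].
  by move=> x _; apply: integral_ge0 => z _; rewrite lee_fin.
have c1 : 0 <= (fine (leb (cubek k y)))^-1 by rewrite invr_ge0 ltW.
have c2 : 0 <= (fine (leb (cubek k.+1 y)))^-1 by rewrite invr_ge0 ltW.
apply: (le_trans (lee_wpmul2l (_ : (0 <= _%:E)%E) (lee_wpmul2l (_ : (0 <= _%:E)%E) h1))) => //.
rewrite !muleA -!EFinM; apply: lee_wpmul2r.
  by apply: integral_ge0 => x _; rewrite lee_fin abs_grad_ge0.
rewrite lee_fin !lebk /= le_eqVlt; apply/orP; left; apply/eqP.
have -> : lk k.+1 = lk k / 2 by rewrite /lk exprSr invfM mulrA.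
rewrite -/(lk k) powRB ?(gt_eqF (lk0 k)) ?implybT// powRr1 ?(ltW (lk0 k))//.
rewrite powR_mulrn ?(ltW (lk0 k))// expr_div_n.
by field; rewrite !gt_eqF ?exprn_gt0.
Qed.

(** After [K] steps the mean over the cell of [y] differs from [U y] by at most [L] times the side
    of the cell, because [UL] is stated for the sup norm. *)
Lemma oscillation_le K y : Q y ->
  (`|U y - mean Q U|%:E <= \sum_(k < K) ((2 ^+ n * (l / 2 ^+ k) `^ (1 - n%:R))%:E *
     cell_int leb (dyadic a l k) (EFin \o abs_grad) y) + (L * l / 2 ^+ K)%:E)%E.
Proof.
move=> Qy.
apply: (@le_trans _ _ (\sum_(k < K) ((2 ^+ n * (l / 2 ^+ k) `^ (1 - n%:R))%:E *
     cell_int leb (dyadic a l k) (EFin \o abs_grad) y) +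
   `|U y - mean (cell (dyadic a l K) y) U|%:E)%E).
  elim: K => [|K ih]; first by rewrite big_ord0 add0e dyadic_cell0.
  apply: (le_trans ih); rewrite big_ord_recr/= -addeA leeD2l//.
  apply: le_trans (leeD2r _ (mean_step K Qy)).
  by rewrite -EFinD lee_fin [leRHS]addrC; exact: ler_distD.
rewrite leeD2l// dyadic_cell// -/(lk K) -/(cubek K y).
apply: (le_trans (mean_dist_le (U y) (mk _ _) (posk _ _) (fink _ _) (intk _ _))).
have yP : cubek K y y by rewrite /cubek /lk -dyadic_cell//; exact: dyadic_refl.
apply: (@le_trans _ _ ((fine (leb (cubek K y)))^-1%:E * \int[leb]_(z in cubek K y) (cst (L * lk K)%:E) z)%E).
  rewrite lee_wpmul2l ?lee_fin ?invr_ge0 ?(ltW (posk _ _))//.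
  apply: le_integral_nneg => [z _|z Pz]; first by rewrite lee_fin.
  rewrite lee_fin (le_trans (UL _ _))// ler_wpM2l//.
  apply: norm_le_coord => [|i]; first exact: ltW.
  have := Pz i; have := yP i; rewrite !mxE => /andP[h1 h2] /andP[h3 h4].
  by rewrite ler_norml; apply/andP; split; lra.
have -> : (\int[leb]_(z in cubek K y) (cst (L * lk K)%:E) z = (L * lk K * lk K ^+ n)%:E)%E.
  by rewrite integral_cst// [RHS]EFinM; congr (_ * _)%E; exact: lebk.
rewrite -EFinM lee_fin lebk /=.
rewrite le_eqVlt; apply/orP; left; apply/eqP; rewrite /lk.
by field; rewrite !gt_eqF ?exprn_gt0 ?divr_gt0 ?exprn_gt0.
Qed.

End oscillation.

(** * The distance weight *)

Lemma powR_nonincreasing (R : realType) (s a b : R) :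
  s <= 0 -> 0 < a -> a <= b -> b `^ s <= a `^ s.
Proof.
move=> s0 a0 ab; have b0 : 0 < b by exact: lt_le_trans ab.
rewrite -[s]opprK powRN [leRHS]powRN lef_pV2 ?posrE ?powR_gt0//.
by apply: ge0_ler_powR => //; rewrite ?nnegrE ?oppr_ge0// ltW.
Qed.

Section euclidean_distance.
Context {R : realType} {n : nat}.
Implicit Types (x y e : 'rV[R]_n) (E : set 'rV[R]_n).

Lemma enorm_ge0 x : 0 <= enorm x.
Proof. exact: sqrtr_ge0. Qed.

Lemma sqr_enorm x : enorm x ^+ 2 = \sum_i x ord0 i ^+ 2.
Proof. by rewrite sqr_sqrtr// sumr_ge0// => i _; rewrite sqr_ge0. Qed.

Lemma coord_le_enorm x i : `|x ord0 i| <= enorm x.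
Proof.
rewrite -sqrtr_sqr ler_wsqrtr// (bigD1 i)//= lerDl sumr_ge0// => j _.
exact: sqr_ge0.
Qed.

Lemma enorm_le_norm x : enorm x <= n%:R * `|x|.
Proof.
have nx : 0 <= n%:R * `|x| by rewrite mulr_ge0.
rewrite -(ler_pXn2r (ltn0Sn 1)) ?nnegrE ?enorm_ge0// sqr_enorm.
apply: (@le_trans _ _ (\sum_(i < n) `|x| ^+ 2)).
  apply: ler_sum => i _; rewrite -real_normK ?num_real//.
  by rewrite lerXn2r ?nnegrE// coord_le_norm.
rewrite sumr_const card_ord -[leLHS]mulr_natl exprMn; apply: ler_wpM2r => //.
by case: n => [|m]; rewrite ?expr0n// expr2 ler_peMl// ler1n.
Qed.

Lemma enorm_eq0 x : enorm x = 0 -> forall i, x ord0 i = 0.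
Proof. by move=> x0 i; apply/eqP; rewrite -normr_le0 -x0 coord_le_enorm. Qed.

Lemma enorm_triangle x y : enorm (x + y) <= enorm x + enorm y.
Proof.
have [x0|x0] := eqVneq (enorm x) 0.
  rewrite x0 add0r (_ : x + y = y)//; apply/rowP => i.
  by rewrite mxE (enorm_eq0 x0) add0r.
have [y0|y0] := eqVneq (enorm y) 0.
  rewrite y0 addr0 (_ : x + y = x)//; apply/rowP => i.
  by rewrite mxE (enorm_eq0 y0) addr0.
have A0 : 0 < enorm x by rewrite lt_neqAle eq_sym x0 enorm_ge0.
have B0 : 0 < enorm y by rewrite lt_neqAle eq_sym y0 enorm_ge0.
have xy : \sum_i x ord0 i * y ord0 i <= enorm x * enorm y.
  (* Cauchy-Schwarz for the normalized vectors, termwise from [2 a b <= a^2 + b^2]. *)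
  have : \sum_i (2 * (x ord0 i / enorm x) * (y ord0 i / enorm y)) <=
      \sum_i ((x ord0 i / enorm x) ^+ 2 + (y ord0 i / enorm y) ^+ 2).
    apply: ler_sum => i _; rewrite -subr_ge0.
    have := sqr_ge0 (x ord0 i / enorm x - y ord0 i / enorm y).
    by congr (_ <= _); ring.
  rewrite big_split/=.
  under [X in _ <= X + _]eq_bigr do rewrite expr_div_n.
  under [X in _ <= _ + X]eq_bigr do rewrite expr_div_n.
  rewrite -!mulr_suml -!sqr_enorm !divff ?expf_neq0//.
  have -> : \sum_i (2 * (x ord0 i / enorm x) * (y ord0 i / enorm y)) =
      2 * (\sum_i x ord0 i * y ord0 i) / (enorm x * enorm y).
    by rewrite mulr_sumr mulr_suml; apply: eq_bigr => i _; field; rewrite x0 y0.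
  by rewrite ler_pdivrMr ?mulr_gt0//; lra.
rewrite -(ler_pXn2r (ltn0Sn 1)) ?nnegrE ?addr_ge0 ?enorm_ge0// sqrrD !sqr_enorm.
under eq_bigr do rewrite mxE sqrrD.
rewrite !big_split/= lerD2r lerD2l.
by rewrite -mulr2n lerMn2r xy orbT.
Qed.

Variable E : set 'rV[R]_n.
Hypothesis E0 : E !=set0.

Let lbE x : has_lbound [set enorm (x - y) | y in E].
Proof. by exists 0 => _ [y _ <-]; exact: enorm_ge0. Qed.

Let neE x : [set enorm (x - y) | y in E] !=set0.
Proof. by have [y Ey] := E0; exists (enorm (x - y)); exists y. Qed.

Lemma dist_ge0 x : 0 <= dist x E.
Proof. by apply: lb_le_inf => // _ [y _ <-]; exact: enorm_ge0. Qed.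

Lemma dist_le x e : E e -> dist x E <= enorm (x - e).
Proof. by move=> Ee; apply: (ge_inf (lbE x)); exists e. Qed.

Lemma dist_near x r : dist x E < r -> exists2 e, E e & enorm (x - e) < r.
Proof.
move=> /(inf_lt (neE x))[_ [e Ee <-] er].
by exists e.
Qed.

Lemma dist_leD x y : dist x E <= dist y E + enorm (x - y).
Proof.
rewrite -lerBlDr; apply: lb_le_inf => // _ [e Ee <-].
rewrite lerBlDr (le_trans (dist_le x Ee))// [leRHS]addrC.
by rewrite (_ : x - e = (x - y) + (y - e)) ?enorm_triangle// subrKA.
Qed.

Lemma dist_lipschitz x y : `|dist x E - dist y E| <= n%:R * `|x - y|.
Proof.
have h u v : dist u E - dist v E <= n%:R * `|u - v|.
  by rewrite lerBlDl (le_trans (dist_leD u v))// lerD2l enorm_le_norm.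
by rewrite ler_norml lerNl opprB h distrC h.
Qed.

Lemma measurable_dist : measurable_fun setT (fun x => dist x E).
Proof. exact: (measurable_lipschitz_rV dist_lipschitz). Qed.

End euclidean_distance.

(** * Mass of the weight on cubes *)

Section weight.
Context {R : realType} {n : nat}.
Local Notation leb := (@lebesgue_rV R n).
Variables (E : set 'rV[R]_n) (s C1 : R).
Hypotheses (E0 : E !=set0) (s0 : s <= 0) (n0 : (0 < n)%N).
Hypothesis Aikawa : forall x r, E x -> 0 < r ->
  ((leb (cube x r))^-1 * \int[leb]_(y in cube x r) dist_pow E s y <=
   (C1 * r `^ s)%:E)%E.

(* For [s < 0] this is [0], not [+oo], on the set where [dist x E = 0]. *)
Definition weight x : R := dist x E `^ s.

Lemma weight_ge0 x : 0 <= weight x. Proof. exact: powR_ge0. Qed.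

Lemma measurable_weight : measurable_fun setT weight.
Proof. exact: (measurableT_comp (@measurable_powR R s) (measurable_dist E0)). Qed.

Lemma measurable_dist_eq0 : measurable [set x | dist x E = 0].
Proof.
have := measurable_dist E0 measurableT (measurable_set1 0).
by rewrite setTI; apply.
Qed.

Lemma dist_pow_ge0 x : (0 <= dist_pow E s x)%E.
Proof. by rewrite /dist_pow; case: ifP => _; rewrite ?leey// lee_fin powR_ge0. Qed.

Lemma weight_le_dist_pow x : ((weight x)%:E <= dist_pow E s x)%E.
Proof. by rewrite /dist_pow; case: ifP => _; rewrite ?leey. Qed.

Lemma dist_powE x : dist x E <> 0 \/ s = 0 -> dist_pow E s x = (weight x)%:E.
Proof.
rewrite /dist_pow /weight => -[/eqP/negbTE -> //|s_eq0].
by rewrite !s_eq0 ltxx andbF.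
Qed.

Lemma dist_pow_cube_le x r : E x -> 0 < r ->
  (\int[leb]_(y in cube x r) dist_pow E s y <= (C1 * r `^ s * (2 * r) ^+ n)%:E)%E.
Proof.
move=> Ex r0.
have cr : leb (cube x r) = ((2 * r) ^+ n)%:E.
  rewrite /cube lebesgue_rV_box; last by move=> i; rewrite !mxE lerD2l ge0_cp ?ltW.
  congr EFin; under eq_bigr do rewrite !mxE.
  rewrite (eq_bigr (fun=> 2 * r)) ?prodr_const ?card_ord// => i _.
  by ring.
have := Aikawa Ex r0; rewrite [X in (X^-1 * _)%E](_ : _ = ((2 * r) ^+ n)%:E)//.
have c0 : 0 < (2 * r) ^+ n by rewrite exprn_gt0// mulr_gt0.
rewrite inver gt_eqF// => /(lee_wpmul2l (_ : (0 <= ((2 * r) ^+ n)%:E)%E)).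
rewrite lee_fin ltW// => /(_ isT); rewrite muleA -EFinM divff ?gt_eqF// mul1e.
by rewrite -EFinM mulrC.
Qed.

Lemma box_sub_cube (c y e : 'rV[R]_n) (l rho : R) : 0 <= rho ->
  box c (c + const_mx l) y -> enorm (y - e) < rho ->
  box c (c + const_mx l) `<=` cube e (l + rho : R).
Proof.
move=> rho0 Py ye z Pz i; have := Py i; have := Pz i; rewrite !mxE.
have := le_lt_trans (coord_le_enorm (y - e) i) ye; rewrite !mxE ltr_norml.
by move=> /andP[h1 h2] /andP[h3 h4] /andP[h5 h6]; apply/andP; split; lra.
Qed.

(** The first two terms are the constants of the two cases of [weight_mass], and the final [1] makes
    the sum at least [1], as [kernel_bound] wants. The absolute value covers any sign of [C1]. *)
Definition mass_const : R :=
  `|C1| * 2 ^+ n * (2 * n%:R + 2) ^+ n * (2 * n%:R) `^ (- s) + 2 `^ (- s) + 1.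

Lemma mass_const_ge1 : 1 <= mass_const.
Proof.
by rewrite lerDr addr_ge0 ?powR_ge0// !mulr_ge0 ?powR_ge0 ?exprn_ge0// addr_ge0// mulr_ge0.
Qed.

(* If [dist y E] is at most [2 n l], the cube lies in one of comparable size
   centred on [E]; otherwise [dist] varies by at most a factor 2 on it. *)
Lemma weight_mass (c : 'rV[R]_n) (l : R) (y : 'rV[R]_n) : 0 < l -> box c (c + const_mx l) y ->
  (\int[leb]_(x in box c (c + const_mx l)) (weight x)%:E <=
   (mass_const * l `^ n%:R * Num.max l (dist y E) `^ s)%:E)%E.
Proof.
move=> l0 Py; set P := box c _; set d := dist y E.
have mP : measurable P by exact: measurable_box.
have n1 : 1 <= n%:R :> R by rewrite ler1n.
pose La : R := 2 * n%:R.
have La1 : 1 <= La by rewrite /La; lra.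
have La0 : 0 < La by exact: lt_le_trans La1.
have d0 : 0 <= d by exact: dist_ge0.
have mW : measurable_fun setT (fun x => (weight x)%:E).
  by apply/measurable_EFinP; exact: measurable_weight.
pose K1 := `|C1| * 2 ^+ n * (La + 2) ^+ n * La `^ (- s).
have K10 : 0 <= K1 by rewrite !mulr_ge0 ?powR_ge0 ?exprn_ge0// addr_ge0// ltW.
have K20 : 0 <= 2 `^ (- s) :> R by exact: powR_ge0.
have lmax : 0 < Num.max l d by rewrite lt_max l0.
rewrite powR_mulrn ?(ltW l0)//.
have X0 : 0 <= l ^+ n * Num.max l d `^ s by rewrite mulr_ge0 ?powR_ge0// exprn_ge0// ltW.
have [dl|dl] := leP d (La * l).
  have [e Ee ye] : exists2 e, E e & enorm (y - e) < d + l.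
    by apply: dist_near => //; rewrite ltrDl.
  have r0 : 0 < (La + 2) * l by rewrite mulr_gt0// addr_gt0.
  have ye' : enorm (y - e) < (La + 1) * l by rewrite (lt_le_trans ye)// mulrDl mul1r lerD2r.
  have PC : P `<=` cube e ((La + 2) * l).
    have -> : (La + 2) * l = l + (La + 1) * l by ring.
    by apply: (box_sub_cube _ Py ye'); rewrite mulr_ge0 ?addr_ge0 ?(ltW l0) ?(ltW La0).
  apply: (@le_trans _ _ (\int[leb]_(x in cube e ((La + 2) * l)) (weight x)%:E)%E).
    apply: ge0_subset_integral => //.
    - exact: measurable_box.
    - exact: measurable_funTS.
    - by move=> x _; rewrite lee_fin weight_ge0.
  apply: (@le_trans _ _ (\int[leb]_(x in cube e ((La + 2) * l)) dist_pow E s x)%E).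
    apply: le_integral_nneg => [x _|x _]; first by rewrite lee_fin weight_ge0.
    exact: weight_le_dist_pow.
  apply: (le_trans (dist_pow_cube_le Ee r0)); rewrite lee_fin.
  have h1 : ((La + 2) * l) `^ s <= l `^ s.
    rewrite powRM ?addr_ge0 ?(ltW La0) ?(ltW l0)// ler_piMl ?powR_ge0//.
    by rewrite -[leRHS](powRr0 (La + 2)) ler_powR//; lra.
  (* In this case [max(l, d) <= La * l], so [l^s] may be traded for the power of the maximum at the
     cost of [La^(-s)]. *)
  have h2 : l `^ s <= La `^ (- s) * Num.max l d `^ s.
    have : (La * l) `^ s <= Num.max l d `^ s.
      apply: (powR_nonincreasing s0 lmax).
      by rewrite ge_max dl andbT ler_peMl// ltW.
    rewrite powRM ?(ltW La0) ?(ltW l0)// powRN => h.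
    by rewrite mulrC ler_pdivlMr ?powR_gt0// mulrC.
  apply: (@le_trans _ _ (K1 * (l ^+ n * Num.max l d `^ s))); last first.
    rewrite mulrA -[leRHS]mulrA -[leLHS]mulrA ler_wpM2r// /mass_const -/La -/K1.
    by rewrite -addrA lerDl addr_ge0.
  apply: (@le_trans _ _ (`|C1| * l `^ s * (2 * ((La + 2) * l)) ^+ n)).
    rewrite ler_wpM2r ?exprn_ge0 ?mulr_ge0 ?addr_ge0 ?(ltW La0) ?(ltW l0)//.
    apply: (@le_trans _ _ (`|C1| * ((La + 2) * l) `^ s)); last by rewrite ler_wpM2l.
    by rewrite ler_wpM2r ?powR_ge0// ler_norm.
  rewrite !exprMn.
  have Y0 : 0 <= `|C1| * 2 ^+ n * (La + 2) ^+ n * l ^+ n.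
    by rewrite !mulr_ge0 ?exprn_ge0 ?addr_ge0 ?(ltW La0) ?(ltW l0).
  have := ler_wpM2l Y0 h2; rewrite /K1.
  move: (l `^ s) (La `^ (- s)) (Num.max l d `^ s) => x1 x2 x3.
  by congr (_ <= _); ring.
have dpos : 0 < d by rewrite (lt_trans _ dl)// mulr_gt0.
have ld : l <= d by rewrite ltW// (le_lt_trans _ dl)// ler_peMl// ltW.
have -> : Num.max l d = d by apply/max_idPr.
apply: (@le_trans _ _ (\int[leb]_(x in P) (cst (2 `^ (- s) * d `^ s)%:E) x)%E).
  apply: le_integral_nneg => [x _|x Px]; first by rewrite lee_fin weight_ge0.
  rewrite lee_fin /weight.
  have -> : 2 `^ (- s) * d `^ s = (d / 2) `^ s.
    by rewrite powRM ?invr_ge0// -(powR_inv1 (ler0n _ 2)) -powRrM mulN1r mulrC.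
  have hd : d / 2 <= dist x E.
    have : `|d - dist x E| <= n%:R * l.
      apply: (le_trans (dist_lipschitz E0 y x)); rewrite ler_wpM2l//.
      apply: norm_le_coord => [|i]; first exact: ltW.
      have := Px i; have := Py i; rewrite !mxE => /andP[h1 h2] /andP[h3 h4].
      by rewrite ler_norml; apply/andP; split; lra.
    rewrite ler_norml => /andP[_ h].
    have h2 : 2 * (n%:R * l) < d by rewrite mulrA.
    move: (n%:R * l) h h2 => t h h2; lra.
  have hd0 : 0 < d / 2 by rewrite divr_gt0.
  exact: (powR_nonincreasing s0 hd0 hd).
have -> : (\int[leb]_(x in P) (cst (2 `^ (- s) * d `^ s)%:E) x = (2 `^ (- s) * d `^ s * l ^+ n)%:E)%E.
  by rewrite integral_cst// [RHS]EFinM; congr (_ * _)%E; apply/lebesgue_cube/ltW.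
rewrite lee_fin.
have Z0 : 0 <= l ^+ n * d `^ s by rewrite mulr_ge0 ?powR_ge0// exprn_ge0// ltW.
apply: (@le_trans _ _ (2 `^ (- s) * (l ^+ n * d `^ s))); first by rewrite mulrAC -mulrA.
rewrite -[leRHS]mulrA ler_wpM2r// /mass_const -/La -/K1 -addrA [K1 + _]addrC -addrA lerDl.
by rewrite addr_ge0.
Qed.

(** [dist_pow] is [+oo] on this set. The box lies in a cube centred on [E], where the hypothesis
    makes the integral of [dist_pow] finite. *)
Lemma dist_eq0_null (c : 'rV[R]_n) (l : R) : 0 < l -> s < 0 ->
  leb (box c (c + const_mx l) `&` [set x | dist x E = 0]) = 0%E.
Proof.
move=> l0 sn; set P := box c _.
have mP : measurable P by exact: measurable_box.
have cP : P c by move=> i; rewrite !mxE lexx/= ltrDl.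
have [e Ee] := E0.
have rho0 : 0 < enorm (c - e) + 1 by rewrite ltr_wpDl ?enorm_ge0.
have PC : P `<=` cube e (l + (enorm (c - e) + 1)).
  by apply: (box_sub_cube (ltW rho0) cP); rewrite ltrDl.
have r0 : 0 < l + (enorm (c - e) + 1) by rewrite addr_gt0.
have mZ : measurable (P `&` [set x | dist x E = 0]).
  by apply: measurableI => //; exact: measurable_dist_eq0.
have : (\int[leb]_(x in P `&` [set x | dist x E = 0%R]) (cst +oo) x < +oo)%E.
  apply: le_lt_trans (_ : (_ <= (C1 * (l + (enorm (c - e) + 1)) `^ s * (2 * (l + (enorm (c - e) + 1))) ^+ n)%:E)%E) (ltry _).
  apply: (le_trans _ (dist_pow_cube_le Ee r0)).
  rewrite [leLHS]integral_mkcond [leRHS]integral_mkcond.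
  apply: le_integral_nneg => x _; first by rewrite /patch; case: ifP => _ //; rewrite /cst leey.
  rewrite /patch; case: ifPn => [/set_mem [Px dx]|_].
    case: ifPn => [_|/negP[]]; last by apply/mem_set/PC.
    by rewrite /dist_pow (dx : dist x E = 0) eqxx sn.
  by case: ifPn => _; [exact: dist_pow_ge0|exact: lexx].
rewrite integral_cst//.
have [//|nz] := eqVneq (leb (P `&` [set x | dist x E = 0])) 0%E.
by rewrite gt0_mulye ?ltxx// lt0e nz/=; exact: measure_ge0.
Qed.

End weight.

(** Only [f] has to be measurable, to discard [N] from its integral; on the right the part over [N]
    is merely nonnegative. *)
Lemma le_integral_off_null d (T : measurableType d) (R : realType)
    (mu : {measure set T -> \bar R}) (D N : set T) (f g : T -> \bar R) :
  measurable D -> measurable N -> mu (D `&` N) = 0%E -> measurable_fun setT f ->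
  (forall x, D x -> (0 <= f x)%E) -> (forall x, D x -> (0 <= g x)%E) ->
  (forall x, D x -> ~ N x -> (f x <= g x)%E) ->
  (\int[mu]_(x in D) f x <= \int[mu]_(x in D) g x)%E.
Proof.
move=> mD mN DN0 mf f0 g0 fg.
have -> : (\int[mu]_(x in D) f x = \int[mu]_(x in D `\` N) f x)%E.
  rewrite -[in LHS](setUIDK D N) setUC ge0_integral_setU//.
  - rewrite [X in (_ + X)%E](@null_set_integral _ _ _ mu) ?adde0//.
    + exact: measurableI.
    + exact: measurable_funTS.
  - exact: measurableD.
  - exact: measurableI.
  - exact: measurable_funTS.
  - by move=> x [[]|[]] *; exact: f0.
  - by apply/disj_setPRL => x [_ Nx] [_].
rewrite [leLHS]integral_mkcond [leRHS]integral_mkcond.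
apply: le_integral_nneg => x _; rewrite /patch; case: ifPn => [/set_mem[Dx Nx]|_].
- exact: f0.
- exact: lexx.
- by rewrite mem_set// fg.
- case: ifPn => [/set_mem Dx|_]; [exact: g0|exact: lexx].
Qed.

(** * From the Lipschitz extension back to [u] *)

Section gradient_comparison.
Context {R : realType} {n : nat}.
Local Notation leb := (@lebesgue_rV R n).
Implicit Types (u U : 'rV[R]_n -> R) (a x : 'rV[R]_n).

Lemma eq_mean Q u U : (forall x, Q x -> U x = u x) -> mean Q U = mean Q u.
Proof.
by move=> Uu; rewrite /mean; congr (_ / _); apply: eq_Rintegral => x /set_mem/Uu.
Qed.

Lemma eq_grad_interior a b u U x : (forall y, box a b y -> U y = u y) ->
  (forall i, a ord0 i < x ord0 i < b ord0 i) -> grad U x = grad u x.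
Proof.
move=> Uu xab; apply/rowP => i; rewrite !mxE; apply: near_eq_derive.
have : \forall y \near x, forall j, a ord0 j < (y : 'rV[R]_n) ord0 j < b ord0 j.
  have F : Filter (nbhs x) by exact: nbhs_filter.
  apply: (@filter_forall _ _ (fun j => [set y : 'rV[R]_n | a ord0 j < y ord0 j < b ord0 j]) _ F) => j; have /andP[aj bj] := xab j.
  have cj := @coord_continuous R 1 n ord0 j x.
  near=> y; apply/andP; split.
  - by near: y; exact: (@cvgr_gt _ _ _ F _ _ cj _ aj).
  - by near: y; exact: (@cvgr_lt _ _ _ F _ _ cj _ bj).
apply: filterS => y yab; apply: Uu => j.
by have /andP[/ltW -> ->] := yab j.
Unshelve. all: by end_near. Qed.

Lemma abs_grad_le_enorm U x : abs_grad U x <= n%:R * enorm (grad U x).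
Proof.
apply: (@le_trans _ _ (\sum_(i < n) enorm (grad U x))).
  apply: ler_sum => i _; rewrite /abs_partial; case: ifP => _; last exact: enorm_ge0.
  by apply: le_trans (coord_le_enorm (grad U x) i); rewrite mxE.
by rewrite sumr_const card_ord -[leLHS]mulr_natl.
Qed.

Lemma hyperplane_null a i :
  let H := [set x : 'rV[R]_n | x ord0 i = a ord0 i] in measurable H /\ leb H = 0%E.
Proof.
move=> H; have mH : measurable H.
  have := @measurable_coord _ R n i measurableT _ (measurable_set1 (a ord0 i)).
  by rewrite setTI; apply.
split => //; apply: (lebesgue_rV_slices0 (i := i) mH) => x.
rewrite (_ : [set t | _] = [set a ord0 i]) ?lebesgue_measure_set1//.
by apply/seteqP; split => t; rewrite /H /= mxE eqxx.
Qed.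

(** Off the faces [x_i = a_i] a point of the half-open box is interior, so the gradients of [U] and
    [u] agree there whatever [u] does outside. These faces are null. *)
Lemma integral_abs_grad_le a b u U L p : (0 < n)%N -> 0 <= p ->
  (forall x y, `|U x - U y| <= L * `|x - y|) ->
  (forall y, box a b y -> U y = u y) ->
  (\int[leb]_(x in box a b) (abs_grad U x `^ p)%:E <=
   (n%:R `^ p)%:E * \int[leb]_(x in box a b) (enorm (grad u x) `^ p)%:E)%E.
Proof.
move=> n0 p0 UL Uu.
have mQ := measurable_box a b.
pose N := [set x : 'rV[R]_n | exists i, x ord0 i = a ord0 i].
pose Ni i := [set x : 'rV[R]_n | x ord0 i = a ord0 i].
have NE : N = \big[setU/set0]_(i < n) Ni i.
  rewrite -bigcup_seq; apply/seteqP; split => [x [i xi]|x [i _ xi]].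
    by exists i => //=; rewrite mem_index_enum.
  by exists i.
have mN : measurable N.
  by rewrite NE; apply: bigsetU_measurable => i _; have [] := hyperplane_null a i.
have N0 : leb N = 0%E.
  apply/negligibleP => //; rewrite NE.
  apply: (big_ind (fun A => leb.-negligible A)) => [|A B|i _].
  - exact: negligible_set0.
  - exact: negligibleU.
  - by apply/negligibleP; have [] := hyperplane_null a i.
have nR0 : 0 < n%:R :> R by rewrite ltr0n.
have mF : measurable_fun setT (fun x => ((abs_grad U x / n%:R) `^ p)%:E).
  apply/measurable_EFinP; apply: (measurableT_comp (@measurable_powR R p)).
  by apply: measurable_funM => //; exact: measurable_abs_grad UL.
have F0 x : (0 <= ((abs_grad U x / n%:R) `^ p)%:E)%E by rewrite lee_fin powR_ge0.
(* The constant is taken out of the left integral, whose integrand is known to be measurable, and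
   not out of the one with [grad u]. *)
rewrite (eq_integral (fun x => ((n%:R `^ p)%:E * ((abs_grad U x / n%:R) `^ p)%:E)%E)).
  rewrite ge0_integralZl//; last exact: measurable_funTS.
  apply: lee_wpmul2l; first by rewrite lee_fin powR_ge0.
  apply: (@le_integral_off_null _ _ _ _ _ N) => //.
  - apply: (subset_measure0 _ mN _ N0) => //; exact: measurableI.
  - by move=> x _; rewrite lee_fin powR_ge0.
  move=> x Qx Nx; rewrite lee_fin ge0_ler_powR ?nnegrE//.
  - by apply: divr_ge0; [exact: abs_grad_ge0|exact: ltW].
  - exact: enorm_ge0.
  rewrite ler_pdivrMr// mulrC -(eq_grad_interior Uu); first exact: abs_grad_le_enorm.
  move=> i; have /andP[ax ->] := Qx i; rewrite andbT lt_neqAle ax andbT.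
  by apply/eqP => xi; apply: Nx; exists i.
move=> x _; rewrite -EFinM; congr EFin.
have q0 : 0 <= abs_grad U x / n%:R by apply: divr_ge0; [exact: abs_grad_ge0|exact: ltW].
by rewrite -(powRM _ (ltW nR0) q0) mulrC divfK// gt_eqF.
Qed.

End gradient_comparison.

(** * The Sobolev-Poincaré inequality *)

Section singular_set.
Context {R : realType} {n : nat}.
Local Notation leb := (@lebesgue_rV R n).
Variables (E : set 'rV[R]_n) (s C1 : R).
Hypotheses (E0 : E !=set0) (s0 : s <= 0).
Hypothesis Aikawa : forall x r, E x -> 0 < r ->
  ((leb (cube x r))^-1 * \int[leb]_(y in cube x r) dist_pow E s y <=
   (C1 * r `^ s)%:E)%E.

(** The points where [dist_pow] is [+oo] while [weight] is [0]; elsewhere the two agree when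
    [s <= 0], and for [s = 0] the set is empty. *)
Definition singular_set : set 'rV[R]_n := [set x | dist x E = 0 /\ s < 0].

Lemma measurable_singular_set : measurable singular_set.
Proof.
have [sn|sn] := boolP (s < 0).
  rewrite (_ : singular_set = [set x | dist x E = 0]); first exact: measurable_dist_eq0.
  by apply/seteqP; split => x; rewrite /singular_set/=; [case|].
rewrite (_ : singular_set = set0) //.
by apply/seteqP; split => x //; rewrite /singular_set/= (negbTE sn) => -[].
Qed.

Lemma singular_set_null (c : 'rV[R]_n) (l : R) : 0 < l ->
  leb (box c (c + const_mx l) `&` singular_set) = 0%E.
Proof.
move=> l0; have [sn|sn] := boolP (s < 0).
  rewrite (_ : singular_set = [set x | dist x E = 0]).
    exact: (dist_eq0_null E0 Aikawa).
  by apply/seteqP; split => x; rewrite /singular_set/=; [case|].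
rewrite (_ : singular_set = set0) ?setI0 ?measure0//.
by apply/seteqP; split => x //; rewrite /singular_set/= (negbTE sn) => -[].
Qed.

Lemma dist_neq0_off x : ~ singular_set x -> dist x E <> 0 \/ s = 0.
Proof.
move=> Zx; have [->|sn] := eqVneq s 0; first by right.
by left => x0; apply: Zx; split => //; rewrite lt_neqAle sn.
Qed.

Lemma measurable_dist_pow : measurable_fun setT (dist_pow E s).
Proof.
rewrite (_ : dist_pow E s = fun x => if x \in singular_set then +oo%E else (weight E s x)%:E).
  apply: measurable_fun_ifT => //.
    by apply: (@measurable_fun_bool _ _ _ _ true); rewrite setTI preimage_mem_true;
      exact: measurable_singular_set.
  by apply/measurable_EFinP; exact: measurable_weight.
apply/funext => x; rewrite /dist_pow; congr (if _ then _ else _).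
by apply/idP/idP => [/andP[/eqP x0 sn]|/set_mem[-> ->]]; [exact/mem_set|rewrite eqxx].
Qed.

Lemma integral_dist_pow_le (c : 'rV[R]_n) (l : R) (h : 'rV[R]_n -> R) : 0 < l ->
  measurable_fun setT h -> (forall x, 0 <= h x) ->
  (\int[leb]_(x in box c (c + const_mx l)) ((h x)%:E * dist_pow E s x) <=
   \int[leb]_(x in box c (c + const_mx l)) (h x * weight E s x)%:E)%E.
Proof.
move=> l0 mh h0.
apply: (le_integral_off_null (measurable_box _ _) measurable_singular_set).
- exact: singular_set_null.
- by apply: emeasurable_funM; [exact/measurable_EFinP|exact: measurable_dist_pow].
- by move=> x _; apply: mule_ge0; [rewrite lee_fin|exact: dist_pow_ge0].
- by move=> x _; rewrite lee_fin; apply: mulr_ge0 => //; exact: weight_ge0.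
- by move=> x _ /dist_neq0_off/dist_powE ->; rewrite -EFinM.
Qed.

(** Off the null singular set the weight is at least [M^s], where [M] exceeds the distance to [E] on
    the whole cube. *)
Lemma weight_cube_gt0 (c : 'rV[R]_n) (l : R) : 0 < l ->
  (0 < \int[leb]_(x in box c (c + const_mx l)) (weight E s x)%:E)%E.
Proof.
move=> l0; pose M := dist c E + n%:R * l + 1.
have M0 : 0 < M by rewrite ltr_wpDl// addr_ge0 ?dist_ge0// mulr_ge0// ltW.
apply: (@lt_le_trans _ _ (\int[leb]_(x in box c (c + const_mx l)) (cst (M `^ s)%:E) x)%E).
  rewrite integral_cst; last exact: measurable_box.
  rewrite [X in (_ < _ * X)%E](_ : _ = (l ^+ n)%:E); last exact/lebesgue_cube/ltW.
  by rewrite -EFinM lte_fin mulr_gt0 ?powR_gt0 ?exprn_gt0.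
apply: (le_integral_off_null (measurable_box _ _) measurable_singular_set).
- exact: singular_set_null.
- exact: measurable_cst.
- by move=> x _; rewrite lee_fin powR_ge0.
- by move=> x _; rewrite lee_fin weight_ge0.
move=> x Px /dist_neq0_off[dx|s_eq0]; last by rewrite lee_fin /weight s_eq0 !powRr0.
have dx0 : 0 < dist x E by rewrite lt_neqAle eq_sym dist_ge0// andbT; apply/eqP.
rewrite lee_fin; apply: (powR_nonincreasing s0 dx0).
apply: (le_trans (_ : _ <= dist c E + n%:R * l)); last by rewrite lerDl.
have : `|dist x E - dist c E| <= n%:R * l.
  apply: (le_trans (dist_lipschitz E0 x c)); rewrite ler_wpM2l//.
  apply: norm_le_coord => [|i]; first exact: ltW.
  have := Px i; rewrite !mxE => /andP[h1 h2].
  by rewrite ler_norml; apply/andP; split; lra.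
by rewrite ler_norml => /andP[_]; rewrite lerBlDl.
Qed.

End singular_set.

(** * The inequality for globally Lipschitz functions *)

Section weighted_inequality.
Context {R : realType} {n : nat}.
Local Notation leb := (@lebesgue_rV R n).
Variables (p q C1 : R).
Hypotheses (p1 : 1 < p) (pq : p <= q) (pn : p < n%:R) (s0 : wexp n p q <= 0).

Let s := wexp n p q.
Let p0 : 0 < p. Proof. exact: lt_trans p1. Qed.
Let q1 : 1 < q. Proof. exact: lt_le_trans pq. Qed.
Let q0 : 0 < q. Proof. exact: lt_trans q1. Qed.
Let n0 : (0 < n)%N. Proof. by rewrite -(ltr0n R) (lt_trans p0). Qed.
Let p' : R := p / (p - 1).
Let c : R := q / (q - 1).
Let p'0 : 0 < p'. Proof. by rewrite divr_gt0// subr_gt0. Qed.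
Let c0 : 0 < c. Proof. by rewrite divr_gt0// subr_gt0. Qed.
Let pp' : p^-1 + p'^-1 = 1.
Proof. by rewrite /p' invf_div; field; rewrite gt_eqF. Qed.
Let cq : c^-1 + q^-1 = 1.
Proof. by rewrite /c invf_div; field; rewrite gt_eqF. Qed.

Lemma weighted_poincare : exists C : R, 0 < C /\
  forall E : set 'rV[R]_n, E !=set0 ->
  (forall (x : 'rV[R]_n) (r : R), E x -> 0 < r ->
    ((leb (cube x r))^-1 * \int[leb]_(y in cube x r) dist_pow E s y <=
     (C1 * r `^ s)%:E)%E) ->
  forall (U : 'rV[R]_n -> R) (L : R) (a : 'rV[R]_n) (l : R),
  0 <= L -> (forall x y, `|U x - U y| <= L * `|x - y|) -> 0 < l ->
  forall Q, Q = box a (a + const_mx l) ->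
  ((\int[leb]_(x in Q) (`|U x - mean Q U| `^ q * weight E s x)%:E) `^ q^-1 <=
   C%:E * (\int[leb]_(x in Q) (abs_grad U x `^ p)%:E) `^ p^-1)%E.
Proof.
have sE : s = - n%:R + q / p * (n%:R - p) by [].
have [Ck [Ck0 CkE]] :=
  kernel_bound p1 pq pp' cq p'0 c0 pn sE (@mass_const_ge1 R n s C1) s0.
pose H := 2 ^+ n * (Ck `^ p' * (2 * (2 * q) `^ c)) : R.
have H0 : 0 <= H by rewrite !mulr_ge0 ?exprn_ge0 ?powR_ge0.
have [Ca [Ca0 CaE]] := absorb p1 pq pp' cq p'0 c0 H0.
pose C := Ca * (2 ^+ n) `^ p^-1 + 1.
have C_gt0 : 0 < C by rewrite ltr_wpDl// mulr_ge0// powR_ge0.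
exists C; split => // E E0 Aikawa U L a l L0 UL l0 _ ->; set Q := box a _.
have mQ : measurable Q by exact: measurable_box.
have mZ := measurable_singular_set s E0.
pose Z := singular_set E s.
(* The kernel bound needs a positive [D]. For [s = 0] the distance enters only through its power
   [0], so [1] can stand for it, even on [E]. *)
pose D x := if s == 0 then 1 else dist x E.
pose W := weight E s.
(* Cutting [f] off on the null singular set makes [D] positive wherever [f] is, without changing the
   integrals over cells. *)
pose f x := abs_grad U x * \1_(~` Z) x.
pose v x := `|U x - mean Q U|.
have mf : measurable_fun setT f.
  apply: measurable_funM; first exact: measurable_abs_grad UL.
  by apply: measurable_indic; exact: measurableC.
have f0 x : 0 <= f x by apply: mulr_ge0; [exact: abs_grad_ge0|rewrite indicE].
have fZ x : ~ Z x -> f x = abs_grad U x.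
  by move=> Zx; rewrite /f indicE mem_set// mulr1.
have f_le x : f x <= abs_grad U x.
  rewrite /f indicE; case: (_ \in _); first by rewrite mulr1.
  by rewrite mulr0 abs_grad_ge0.
have mv : measurable_fun setT v.
  apply: measurableT_comp => //; apply: measurable_funB => //.
  exact: measurable_lipschitz_rV UL.
have v0 x : 0 <= v x by exact: normr_ge0.
have mW : measurable_fun setT W by exact: measurable_weight.
have W0 x : 0 <= W x by exact: weight_ge0.
have WE x : Q x -> W x = D x `^ s.
  by move=> _; rewrite /W /weight /D; case: eqP => // ->; rewrite !powRr0.
have fD x : Q x -> 0 < f x -> 0 < D x.
  move=> _; rewrite /D; case: eqP => // sn0 fx.
  rewrite lt_neqAle dist_ge0// andbT eq_sym; apply/eqP => dx0.
  have Zx : Z x by split => //; rewrite lt_neqAle s0 andbT; apply/eqP.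
  by move: fx; rewrite /f indicE; case: (boolP (x \in _)) => [/set_mem/(_ Zx)//|_]; rewrite mulr0 ltxx.
have lk0 k : 0 < l / 2 ^+ k by rewrite divr_gt0// exprn_gt0.
have cellE k x : Q x -> cell (dyadic a l k) x =
    box (dyadic_corner a l k x) (dyadic_corner a l k x + const_mx (l / 2 ^+ k)).
  exact: (dyadic_cell l0).
have cellx k x : Q x -> cell (dyadic a l k) x x by exact: dyadic_refl.
have W_mass k x : Q x -> 0 < f x ->
    (cell_int leb (dyadic a l k) (EFin \o W) x <=
     (@mass_const R n s C1 * (l / 2 ^+ k) `^ n%:R * Num.max (l / 2 ^+ k) (D x) `^ s)%:E)%E.
  move=> Qx _; rewrite /cell_int cellE//.
  have := cellx k x Qx; rewrite cellE// => /(weight_mass E0 s0 n0 Aikawa (lk0 k)).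
  suff -> : Num.max (l / 2 ^+ k) (D x) `^ s = Num.max (l / 2 ^+ k) (dist x E) `^ s by [].
  by rewrite /D; case: eqP => // ->; rewrite !powRr0.
have W_pos k x : Q x -> (0 < cell_int leb (dyadic a l k) (EFin \o W) x)%E.
  by move=> Qx; rewrite /cell_int cellE//; exact: (weight_cube_gt0 E0 s0 Aikawa).
have W_fin : (\int[leb]_(x in Q) (W x)%:E < +oo)%E.
  have Qa : Q a by move=> i; rewrite !mxE lexx/= ltrDl.
  exact: le_lt_trans (weight_mass E0 s0 n0 Aikawa l0 Qa) (ltry _).
have vB x : Q x -> v x <= L * l.
  move=> Qx; have := oscillation_le L0 UL l0 0 Qx.
  by rewrite big_ord0 add0e expr0 divr1 lee_fin.
have f_cell k x : Q x ->
    (cell_int leb (dyadic a l k) (EFin \o abs_grad U) x <=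
     cell_int leb (dyadic a l k) (EFin \o f) x)%E.
  move=> Qx; rewrite /cell_int cellE//.
  apply: (le_integral_off_null (measurable_box _ _) mZ).
  - exact: (singular_set_null E0 Aikawa).
  - by apply/measurable_EFinP; exact: measurable_abs_grad UL.
  - by move=> y _; rewrite lee_fin abs_grad_ge0.
  - by move=> y _; rewrite lee_fin.
  - by move=> y _ Zy; rewrite /= fZ.
have v_osc K x : Q x -> ((v x)%:E <=
    \sum_(k < K) ((2 ^+ n * (l / 2 ^+ k) `^ (1 - n%:R))%:E *
      cell_int leb (dyadic a l k) (EFin \o f) x) + (L * l / 2 ^+ K)%:E)%E.
  move=> Qx; apply: (le_trans (oscillation_le L0 UL l0 K Qx)).
  apply: leeD => //; apply: lee_sum => k _; apply: lee_wpmul2l; last exact: f_cell.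
  by rewrite lee_fin mulr_ge0 ?powR_ge0// exprn_ge0.
pose J := (\int[leb]_(x in Q) (v x `^ q * W x)%:E)%E.
pose A := (\int[leb]_(x in Q) (f x `^ p)%:E)%E.
have J0 : (0 <= J)%E by apply: integral_ge0 => x _; rewrite lee_fin mulr_ge0 ?powR_ge0.
have A0 : (0 <= A)%E by apply: integral_ge0 => x _; rewrite lee_fin powR_ge0.
apply: (@le_trans _ _ (C%:E * A `^ p^-1)%E); last first.
  apply: lee_wpmul2l; first by rewrite lee_fin ltW.
  have AG : (A <= \int[leb]_(x in Q) (abs_grad U x `^ p)%:E)%E.
    apply: le_integral_nneg => x _; first by rewrite lee_fin powR_ge0.
    by rewrite lee_fin ge0_ler_powR ?nnegrE ?abs_grad_ge0 ?(ltW p0).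
  apply: gt0_ler_poweR => //; rewrite ?invr_ge0 ?(ltW p0)//.
  - by rewrite in_itv/= A0 leey.
  - by rewrite in_itv/= leey (le_trans A0 AG).
(* [core_instance] asks for a finite [A]. If [A] is infinite, so is the right-hand side, because the
   summand [1] in [C] keeps it positive. *)
have [Aoo|Afin] := eqVneq A +oo%E.
  by rewrite Aoo poweRyr ?invr_eq0 ?gt_eqF// gt0_muley ?lte_fin// leey.
have Alt : (A < +oo)%E by rewrite lt_neqAle Afin leey.
have Jfin : J \is a fin_num.
  exact: (core_lhs_fin p1 pq mQ mW W0 W_fin v0 vB).
have AfinE : A = (fine A)%:E by rewrite fineK// ge0_fin_numE.
have C10 : 0 <= 2 ^+ n :> R by exact: exprn_ge0.
have key := core_instance p1 pq pp' cq p'0 c0 C10 mQ (measurable_dyadic a l0)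
  (@dyadic_sym _ _ a l) (@dyadic_trans _ _ a l) (@dyadic_dom _ _ a l) (@dyadic_sub _ _ a l l0)
  l0 WE mW W0 W_fin W_pos mf f0 fD mv v0 vB W_mass v_osc Ck0 CkE Alt.
rewrite -/J -/A in key.
have {key} := CaE (fine J) (2 ^+ n * fine A) (fine_ge0 J0) (mulr_ge0 C10 (fine_ge0 A0)) key.
rewrite powRM ?fine_ge0// mulrA => JA.
rewrite [leLHS](_ : _ = J `^ q^-1)%E// -(fineK Jfin) AfinE !poweR_EFin -EFinM lee_fin.
apply: (le_trans JA); rewrite ler_wpM2r ?powR_ge0//.
by rewrite /C lerDl.
Qed.

End weighted_inequality.

Theorem theorem7p2 (R : realType) (n : nat) (p q C1 : R) :
  1 < p -> p <= q -> p < n%:R -> q <= n%:R * p / (n%:R - p) ->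
  exists C : R, forall E : set 'rV[R]_n, E !=set0 -> closed E ->
    (forall (x : 'rV[R]_n) (r : R), E x -> 0 < r ->
      ((lebesgue_rV (cube x r))^-1 *
         \int[@lebesgue_rV R n]_(y in cube x r) dist_pow E (wexp n p q) y
       <= (C1 * r `^ wexp n p q)%:E)%E) ->
    forall (Q : set 'rV[R]_n) (u : 'rV[R]_n -> R), is_cube Q ->
      [lipschitz u x | x in Q] ->
      ((\int[@lebesgue_rV R n]_(x in Q)
          ((`|u x - mean Q u| `^ q)%:E * dist_pow E (wexp n p q) x)) `^ q^-1
       <= C%:E * (\int[@lebesgue_rV R n]_(x in Q)
          (enorm (grad u x) `^ p)%:E) `^ p^-1)%E.
Proof.
move=> p1 pq pn qn.
have p0 : 0 < p by exact: lt_trans p1.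
have q0 : 0 < q by exact: lt_le_trans pq.
have n0 : (0 < n)%N by rewrite -(ltr0n R) (lt_trans p0).
(* This is the upper bound on [q] multiplied by [(n - p) / p]. *)
have s0 : wexp n p q <= 0.
  rewrite /wexp addrC subr_le0 mulrAC ler_pdivrMr//.
  by rewrite -ler_pdivlMr// subr_gt0.
have [C [C0 CP]] := weighted_poincare C1 p1 pq pn s0.
(* The factor [n] is the cost of passing from the sum of the partial derivatives to the Euclidean
   norm of the gradient. *)
exists (C * n%:R) => E E0 _ Aikawa Q u [a [b [ab b_a QE]]] lip_u.
pose i0 := Ordinal n0; pose l := b ord0 i0 - a ord0 i0.
have l0 : 0 < l by rewrite subr_gt0.
have bE : b = a + const_mx l.
  by apply/rowP => i; rewrite !mxE /l (b_a i0 i) addrC subrK.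
have Q0 : Q !=set0 by exists a; rewrite QE => i; rewrite lexx ab.
have [L /ltW L0 uL] : exists2 L, 0 < L &
    forall x y, Q x -> Q y -> `|u x - u y| <= L * `|x - y|.
  have [L L0 LP] := pinfty_ex_gt0 lip_u.
  by exists L => // x y Qx Qy; exact: (LP (x, y)).
have [U [Uu UL]] := lipschitz_extension L0 Q0 uL.
rewrite bE in QE; set G := (\int[_]_(x in Q) (enorm _ `^ _)%:E)%E.
have G0 : (0 <= G)%E by apply: integral_ge0 => x _; rewrite lee_fin powR_ge0.
have mU : measurable_fun setT (fun x => `|U x - mean Q U| `^ q).
  apply: (measurableT_comp (@measurable_powR R q)); apply: measurableT_comp => //.
  by apply: measurable_funB => //; exact: measurable_lipschitz_rV UL.
have -> : (\int[@lebesgue_rV R n]_(x in Q)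
      ((`|u x - mean Q u| `^ q)%:E * dist_pow E (wexp n p q) x) =
    \int[@lebesgue_rV R n]_(x in Q)
      ((`|U x - mean Q U| `^ q)%:E * dist_pow E (wexp n p q) x))%E.
  by apply: eq_integral => x /set_mem Qx; rewrite (eq_mean Uu) Uu.
(* The values [+oo] of [dist_pow] sit on a null set, so the real-valued weight gives the same
   bound. *)
apply: (@le_trans _ _ ((\int[@lebesgue_rV R n]_(x in Q)
    (`|U x - mean Q U| `^ q * weight E (wexp n p q) x)%:E) `^ q^-1)%E).
  apply: gt0_ler_poweR; rewrite ?invr_ge0 ?(ltW q0)//.
  - rewrite in_itv/= leey andbT; apply: integral_ge0 => x _.
    by apply: mule_ge0; [rewrite lee_fin powR_ge0|exact: dist_pow_ge0].
  - rewrite in_itv/= leey andbT; apply: integral_ge0 => x _.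
    by rewrite lee_fin; apply: mulr_ge0; [exact: powR_ge0|exact: weight_ge0].
  - have v0 x : 0 <= `|U x - mean Q U| `^ q by exact: powR_ge0.
    by have := integral_dist_pow_le E0 s0 Aikawa a l0 mU v0; rewrite -QE.
apply: (le_trans (CP E E0 Aikawa U L a l L0 UL l0 Q QE)).
rewrite EFinM -muleA; apply: lee_wpmul2l; first by rewrite lee_fin ltW.
have -> : (n%:R%:E * G `^ p^-1 = ((n%:R `^ p)%:E * G) `^ p^-1)%E.
  rewrite poweRM ?lee_fin ?powR_ge0// poweR_EFin -powRrM divff ?gt_eqF// powRr1//.
have H : (\int[@lebesgue_rV R n]_(x in Q) (abs_grad U x `^ p)%:E <= (n%:R `^ p)%:E * G)%E.
  rewrite /G QE; apply: (integral_abs_grad_le n0 (ltW p0) UL) => y Qy.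
  by apply: Uu; rewrite QE.
have H0 : (0 <= \int[@lebesgue_rV R n]_(x in Q) (abs_grad U x `^ p)%:E)%E.
  by apply: integral_ge0 => x _; rewrite lee_fin powR_ge0.
apply: gt0_ler_poweR; rewrite ?invr_ge0 ?(ltW p0)//.
- by rewrite in_itv/= leey H0.
- by rewrite in_itv/= leey (le_trans H0 H).
Qed.
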